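(* Let $n\ge3$, and let $\gamma_0$ be a fixed positive-definite multiple of the Killing form of $\mathrm{SU}(n)$, regarded as a (bi-invariant) Riemannian Einstein metric on $\mathrm{SU}(n)$. Then $\gamma_0$ is an isolated point of the set of all left-invariant Riemannian Einstein metrics on $\mathrm{SU}(n)$ normalized so as to have the same Einstein constant as $\gamma_0$.
   Context: Left-invariant Riemannian metrics on $\mathrm{SU}(n)$ are identified with positive-definite inner products on the Lie algebra $\mathfrak{su}(n)$, a subset of the finite-dimensional vector space of symmetric bilinear forms, with the subspace topology. A metric $\gamma$ is Einstein if its Ricci tensor equals $\kappa\gamma$ for a constant $\kappa$, called its Einstein constant. The Killing form of $\mathfrak{su}(n)$ is negative definite. *)

(* Defs.v *)
From HB Require Import structures.
From mathcomp Require Import all_boot all_order all_algebra.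
From mathcomp Require Import all_classical all_reals.
From mathcomp Require Import topology normedtype.
From mathcomp Require Import complex.

Set Implicit Arguments.
Unset Strict Implicit.
Unset Printing Implicit Defensive.

Import Order.TTheory GRing.Theory Num.Theory.
Import numFieldNormedType.Exports.

Local Open Scope ring_scope.
Local Open Scope complex_scope.
Local Open Scope sesquilinear_scope.

Section SpecialUnitaryAlgebra.
Variables (R : realType) (n : nat).

Definition skew_hermitian_traceless : {pred 'M[R[i]]_n} :=
  fun A => (A ^t* == - A) && (\tr A == 0).

Fact skew_hermitian_traceless_zmod : zmod_closed skew_hermitian_traceless.
Proof.
split=> [|A B]; first by rewrite unfold_in trmx0 map_mx0 oppr0 mxtrace0 !eqxx.
move=> /andP[/eqP hA /eqP tA] /andP[/eqP hB /eqP tB].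
rewrite unfold_in; apply/andP; split; apply/eqP; last first.
  by rewrite linearB /= tA tB subrr.
by rewrite linearB /= map_mxB hA hB opprD.
Qed.
HB.instance Definition _ := GRing.isZmodClosed.Build _
  skew_hermitian_traceless skew_hermitian_traceless_zmod.

(* The Lie algebra of SU(n), a real vector space of complex matrices. *)
Record su := Su {
  su_val :> 'M[R[i]]_n;
  su_valP : su_val \in skew_hermitian_traceless }.

HB.instance Definition _ := [isSub for su_val].
HB.instance Definition _ := [Choice of su by <:].
HB.instance Definition _ := [SubChoice_isSubZmodule of su by <:].

Fact su_scale_subproof (a : R) (X : su) :
  a%:C *: su_val X \in skew_hermitian_traceless.
Proof.
have /andP[/eqP hX /eqP tX] := su_valP X.
rewrite unfold_in; apply/andP; split; apply/eqP; last first.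
  by rewrite linearZ /= tX mulr0.
by rewrite linearZ /= map_mxZ hX scalerN; congr (- (_ *: _)); exact: conjc_real.
Qed.

Definition su_scale (a : R) (X : su) : su := Su (su_scale_subproof a X).

Fact su_scaleA a b X : su_scale a (su_scale b X) = su_scale (a * b) X.
Proof. by apply: val_inj; rewrite /= scalerA rmorphM. Qed.
Fact su_scale1 : left_id 1 su_scale.
Proof. by move=> X; apply: val_inj; rewrite /= scale1r. Qed.
Fact su_scaleDr : right_distributive su_scale +%R.
Proof. by move=> a X Y; apply: val_inj; rewrite /= scalerDr. Qed.
Fact su_scaleDl X : {morph su_scale^~ X : a b / a + b}.
Proof. by move=> a b; apply: val_inj; rewrite /= rmorphD scalerDl. Qed.
HB.instance Definition _ := GRing.Zmodule_isLmodule.Build R su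
  su_scaleA su_scale1 su_scaleDr su_scaleDl.

(* Finite dimension: X is sent to the pair (A, B) with X = A + i B; the image
   is cut out by A^T = - A, B^T = B and tr B = 0. *)
Local Notation Rmx := ('M[R]_n * 'M[R]_n)%type.

Definition su_eqns (p : Rmx) : 'M[R]_n * 'M[R]_n * R^o :=
  (p.1^T + p.1, p.2^T - p.2, \tr p.2).

Fact su_eqns_linear : linear su_eqns.
Proof.
move=> a [A B] [A' B']; rewrite /su_eqns /=.
congr (_, _, _) => /=; last by rewrite linearP.
  by rewrite linearP scalerDr addrACA.
by rewrite linearP /= scalerBr opprD addrACA.
Qed.
HB.instance Definition _ := GRing.isLinear.Build R Rmx _ _ su_eqns
  su_eqns_linear.

Definition su_space : {vspace Rmx} := lker (linfun su_eqns).

Definition su_parts (X : su) : Rmx :=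
  (map_mx (@complex.Re R) X, map_mx (@complex.Im R) X).

Fact su_parts_in X : su_parts X \in su_space.
Proof.
have /andP[/eqP/matrixP hX /eqP tX] := su_valP X.
rewrite memv_ker lfunE /= /su_eqns /=.
have hij i j : (su_val X j i)^* = - su_val X i j.
  by have := hX i j; rewrite !mxE => <-.
apply/eqP; congr (_, _, _).
- apply/matrixP => i j; rewrite !mxE; have := hij i j.
  by case: (su_val X j i) (su_val X i j) => a b [c d] [-> _] /=; rewrite addNr.
- apply/matrixP => i j; rewrite !mxE; have := hij i j.
  by case: (su_val X j i) (su_val X i j) => a b [c d] [_ /oppr_inj ->] /=;
    rewrite subrr.
- have <- : complex.Im (\tr (su_val X)) = 0 by rewrite tX.
  rewrite /mxtrace (raddf_sum (@complex.Im R)).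
  by apply: eq_bigr => i _; rewrite mxE.
Qed.

Fact su_of_parts_subproof (u : subvs_of su_space) :
  \matrix_(i, j) (((vsval u).1 i j) +i* ((vsval u).2 i j))
    \in skew_hermitian_traceless.
Proof.
have := subvsP u; rewrite memv_ker lfunE /= => /eqP[].
move: (vsval u) => [A B] /= /matrixP hA /matrixP hB tB.
rewrite unfold_in; apply/andP; split; apply/eqP.
  apply/matrixP => i j; rewrite !mxE.
  have /eqP := hA i j; rewrite !mxE addr_eq0 => /eqP hAij.
  have /eqP := hB i j; rewrite !mxE subr_eq0 => /eqP hBij.
  by apply/eqP; rewrite eq_complex /= hAij hBij !eqxx.
rewrite /mxtrace; apply/eqP; rewrite eq_complex.
rewrite (raddf_sum (@complex.Re R)) (raddf_sum (@complex.Im R)) /=.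
apply/andP; split; apply/eqP.
  apply: big1 => i _; rewrite mxE /=.
  by have /eqP := hA i i; rewrite !mxE -mulr2n mulrn_eq0 /= => /eqP.
by rewrite -[RHS]tB; apply: eq_bigr => i _; rewrite mxE.
Qed.

Definition su_of_parts (u : subvs_of su_space) : su := Su (su_of_parts_subproof u).

Fact su_vect_axiom : Vector.axiom (dim (subvs_of su_space)) su.
Proof.
pose f X := VectorInternalTheory.v2r (vsproj su_space (su_parts X)).
exists f.
- move=> a X Y; rewrite /f.
  have -> : su_parts (a *: X + Y) = a *: su_parts X + su_parts Y.
    by congr pair; apply/matrixP => i j; rewrite !mxE;
      case: (su_val X i j) (su_val Y i j) => [x x'] [y y'] /=;
      rewrite !mul0r ?addr0 ?subr0.
  rewrite (linearP (vsproj su_space)) /=.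
  have [vZ vD] := v2r_semilinear (VectorInternalTheory.v2r_subproof (subvs_of su_space)).
  by rewrite [LHS]vD; congr (_ + _); exact: vZ.
- exists (su_of_parts \o VectorInternalTheory.r2v) => [X|r] /=.
    rewrite VectorInternalTheory.v2rK; apply: val_inj => /=.
    rewrite vsprojK ?su_parts_in //; apply/matrixP => i j; rewrite !mxE /=.
    by case: (su_val X i j).
  rewrite /f -[RHS]VectorInternalTheory.r2vK; congr VectorInternalTheory.v2r.
  apply: val_inj; rewrite /= vsprojK ?su_parts_in // /su_parts.
  case: (VectorInternalTheory.r2v r) => -[A B] h /=.
  by congr pair; apply/matrixP => i j; rewrite !mxE.
Qed.
HB.instance Definition _ := Lmodule_hasFinDim.Build R su su_vect_axiom.

Fact su_bracket_subproof (X Y : su) :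
  su_val X *m su_val Y - su_val Y *m su_val X \in skew_hermitian_traceless.
Proof.
have /andP[/eqP hX _] := su_valP X; have /andP[/eqP hY _] := su_valP Y.
rewrite unfold_in; apply/andP; split; apply/eqP.
  rewrite linearB /= map_mxB !trmx_mul !map_mxM hX hY.
  by rewrite !mulmxN !mulNmx !opprK opprB.
by rewrite linearB /= mxtrace_mulC subrr.
Qed.

Definition su_bracket (X Y : su) : su := Su (su_bracket_subproof X Y).

Fact su_bracket_bilinear : bilinear_for *:%R *:%R su_bracket.
Proof.
split=> [Z a X Y|Z a X Y]; apply: val_inj => /=.
  rewrite mulmxDl mulmxDr -scalemxAl -scalemxAr scalerBr opprD.
  by rewrite addrACA.
rewrite mulmxDl mulmxDr -scalemxAl -scalemxAr scalerBr opprD.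
by rewrite addrACA.
Qed.
HB.instance Definition _ := bilinear_isBilinear.Build R su su su *:%R *:%R
  su_bracket su_bracket_bilinear.

End SpecialUnitaryAlgebra.

(* Left-invariant metrics on a Lie group with Lie algebra V, i.e. inner
   products on V. *)
Notation metric V := {dot V for idfun}.

HB.instance Definition _ (R : realType) (V : vectType R) :=
  gen_eqMixin (metric V).
HB.instance Definition _ (R : realType) (V : vectType R) :=
  gen_choiceMixin (metric V).

Fact metric_eq (R : realType) (V : vectType R) (g g' : metric V) :
  (forall X Y, g X Y = g' X Y) -> g = g'.
Proof.
case: g g' => [f hf] [f' hf'] /= e.
have {}e : f = f' by apply/funext => X; apply/funext => Y; exact: e.
case: f' / e hf' => -[[d] [b1 b2 b3 b4] [h]].
case: hf => -[d'] [b1' b2' b3' b4'] [h'].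
rewrite (Prop_irrelevance d' d) (Prop_irrelevance h' h).
rewrite (Prop_irrelevance b1' b1) (Prop_irrelevance b2' b2).
by rewrite (Prop_irrelevance b3' b3) (Prop_irrelevance b4' b4).
Qed.

Section MetricTopology.
Variables (R : realType) (V : vectType R).

Definition gram (g : metric V) : 'M[R]_(\dim {:V}) :=
  \matrix_(i, j) g (vbasis {:V})`_i (vbasis {:V})`_j.

(* The topology induced from the finite-dimensional space of symmetric bilinear
   forms, which is identified with R^N by the coefficients in some basis. *)
HB.instance Definition _ := Topological.copy (metric V)
  (initial_topology gram).

End MetricTopology.

Section Curvature.
Variables (R : realType) (V : vectType R) (br : {bilinear V -> V -> V}).

Definition lftrace (f : 'End(V)) : R :=
  \tr (passmx.mxof (vbasis {:V}) (vbasis {:V}) f).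

Definition ad (X : V) : 'End(V) := linfun (br X).

Definition killing (X Y : V) : R := lftrace (ad X \o ad Y)%VF.

(* A left-invariant connection is given by its values nabla X Y on
   left-invariant vector fields.  The pairing g Y Z of two such fields is
   constant, so that its derivative along X drops out of the compatibility
   condition.  If br is a Lie bracket, exactly one nabla satisfies
   levi_civita g nabla. *)
Definition levi_civita (g : metric V) (nabla : 'Hom(V, 'End(V))) : Prop :=
  (forall X Y, nabla X Y - nabla Y X = br X Y) /\
  (forall X Y Z, g (nabla X Y) Z + g Y (nabla X Z) = 0).

Definition curvature (nabla : 'Hom(V, 'End(V))) (X Y : V) : 'End(V) :=
  (nabla X \o nabla Y)%VF - (nabla Y \o nabla X)%VF - nabla (br X Y).

Fact curvature_is_linear (nabla : 'Hom(V, 'End(V))) (Y Z : V) :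
  linear (fun X => curvature nabla X Y Z).
Proof.
move=> a X X'; rewrite /curvature.
have -> : nabla (a *: X + X') = a *: nabla X + nabla X' by rewrite linearP.
have -> : nabla (br (a *: X + X') Y) = a *: nabla (br X Y) + nabla (br X' Y).
  by rewrite linearPl linearP.
have E u v : nabla Y (a *: u + v) = a *: nabla Y u + nabla Y v.
  by rewrite linearP.
rewrite !(add_lfunE, opp_lfunE, scale_lfunE, comp_lfunE) E.
by rewrite !scalerBr !opprD [X in X + _ = _]addrACA [LHS]addrACA.
Qed.

(* linfun is meaningful here by curvature_is_linear. *)
Definition ricci (nabla : 'Hom(V, 'End(V))) (Y Z : V) : R :=
  lftrace (linfun (fun X => curvature nabla X Y Z)).

Definition is_einstein (g : metric V) (kappa : R) : Prop :=
  exists2 nabla, levi_civita g nabla &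
    forall Y Z, ricci nabla Y Z = kappa * g Y Z.

End Curvature.

(* Main.v *)
From HB Require Import structures.
Require Import Defs.
From mathcomp Require Import all_boot all_order all_algebra.
From mathcomp Require Import all_classical all_reals topology.
From mathcomp Require Import normedtype complex ring lra.

Set Implicit Arguments.
Unset Strict Implicit.
Unset Printing Implicit Defensive.

Import Order.TTheory GRing.Theory Num.Theory.
Local Open Scope ring_scope.
Local Open Scope complex_scope.
Local Open Scope sesquilinear_scope.

(** Fix a basis e of su(n) that is orthonormal for - tr (X Y), which is a multiple of the
    bi-invariant metric. A left-invariant metric becomes a positive symmetric matrix A, the
    bi-invariant one becomes A = 1 after rescaling, and the Koszul formula turns the Einstein
    condition with the constant of the bi-invariant metric into the matrix equation
      4 n - 2 Lam P A + A (Lam P P) A - 2 n A = 0,   P = A^-1,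
    where Lam U V has the entries tr (ad_x U ad_y^T V) (einstein_frame, einstein_op). It remains
    to show that A = 1 is an isolated solution (isolated_identity).

    The linearized equation, S = n^-1 Lam 1 S, does not suffice: for n >= 3 its solutions are
    the forms kZ Z (X, Y) = - tr (Z (X Y + Y X)) / 2 with Z hermitian and trace-free, and they
    are infinitesimal Einstein deformations. So a solution A = 1 + h S with S of norm one is
    followed to third order.

    - First order (linear_normal_form): S is within O(h) of some kZ Z, by an explicit formula
      for the inverse of n - Lam 1 off its kernel (resolvent).
    - Second order (quadratic_obstruction): contracting the quadratic term with the frame
      leaves a multiple of the trace-free part of Z^2, which is therefore O(h). So the
      eigenvalues of Z are nearly equal up to sign, and Z is within O(h) of a multiple of a
      hermitian involution J. The trace of J is an integer near 0, hence 0. This yields the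
      form A = 1 + t kZ J + t^2 B with B bounded (cone_normal_form).
    - Third order (third_order_obstruction): the forms built from J span a small algebra in
      which everything can be computed. The second-order equation determines the trace of
      (kZ J)^2 B up to O(t), although it leaves B undetermined, and then the trace of kZ J
      against the third-order term is a nonzero constant up to O(t). It should be O(t):
      for small t this is a contradiction.

    All trace identities come from one fact, the completeness relation
    \sum_x tr (e_x X) e_x = tr X / n - X, and the analysis consists of Taylor expansions with
    explicit uniform remainders (jet), which stand in for a compactness argument. *)

(** * Entries and traces of matrices *)

(** Proves equalities between traces of cyclically rotated products. *)
Ltac trace_rot :=
  by rewrite ?mulmxA; do 7 try (rewrite [LHS]mxtrace_mulC ?mulmxA; try reflexivity).

Section Entries.
Variables (R : pzRingType) (m p : nat).
Implicit Types A B : 'M[R]_(m, p).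
(** Unlike mxE, these rules do not unfold the entries of the operands, so that ring sees those
    entries as atoms. *)
Lemma addmxE A B i j : (A + B) i j = A i j + B i j.
Proof. by rewrite mxE. Qed.
Lemma oppmxE A i j : (- A) i j = - A i j.
Proof. by rewrite mxE. Qed.
Lemma scalemxE a A i j : (a *: A) i j = a * A i j.
Proof. by rewrite mxE. Qed.
End Entries.

(** * The quadratic form built from structure constants *)

Section Polarization.
Variables (F : comPzRingType) (N : nat) (a : 'I_N -> 'M[F]_N).

(** When a x is the matrix of ad e_x in a frame, the Ricci tensor depends on the structure
    constants only through expressions of this form (ricci_formula). *)
Definition Lam (U V : 'M[F]_N) : 'M[F]_N :=
  \matrix_(x, y) \tr (a x *m U *m (a y)^T *m V).

Lemma LamE U V x y : Lam U V x y = \tr (a x *m U *m (a y)^T *m V).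
Proof. by rewrite mxE. Qed.

Lemma LamDl U U' V : Lam (U + U') V = Lam U V + Lam U' V.
Proof. by apply/matrixP => x y; rewrite addmxE !LamE mulmxDr !mulmxDl raddfD. Qed.

Lemma LamDr U V V' : Lam U (V + V') = Lam U V + Lam U V'.
Proof. by apply/matrixP => x y; rewrite addmxE !LamE mulmxDr raddfD. Qed.

Lemma LamZl k U V : Lam (k *: U) V = k *: Lam U V.
Proof.
by apply/matrixP => x y; rewrite scalemxE !LamE -scalemxAr -!scalemxAl linearZ.
Qed.

Lemma LamZr k U V : Lam U (k *: V) = k *: Lam U V.
Proof. by apply/matrixP => x y; rewrite scalemxE !LamE -scalemxAr linearZ. Qed.

(** Both traces are sums over the index pairs of U and of W; antisymmetry of a x i j in x and i
    exchanges these pairs. *)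
Lemma Lam_swap U V W : (forall x i j, a x i j = - a i x j) ->
  \tr (U *m Lam V W) = \tr (W *m Lam V U).
Proof.
move=> aA.
have E X Y Z : \tr (X *m Lam Y Z) =
    \sum_y \sum_x \sum_l \sum_i X y x * Z l i * (a x *m Y *m (a y)^T) i l.
  rewrite /mxtrace; apply: eq_bigr => y _; rewrite mxE; apply: eq_bigr => x _.
  rewrite LamE /mxtrace exchange_big /= mulr_sumr; apply: eq_bigr => i _.
  by rewrite mxE mulr_sumr; apply: eq_bigr => l _; rewrite -mulrA [Z _ _ * _]mulrC.
have q x y i l : (a x *m V *m (a y)^T) i l = (a i *m V *m (a l)^T) x y.
  have q' k : (a x *m V) i k = - (a i *m V) x k.
    by rewrite !mxE -sumrN; apply: eq_bigr => j _; rewrite aA mulNr.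
  rewrite [LHS]mxE [RHS]mxE; apply: eq_bigr => k _.
  have -> : (a y)^T k l = - (a l)^T k y by rewrite mxE aA [in RHS]mxE.
  by rewrite q' mulrNN.
rewrite !E [RHS](eq_bigr (fun y => \sum_l \sum_i \sum_x
  W y x * U l i * (a x *m V *m (a y)^T) i l)); last first.
  move=> y _; rewrite exchange_big /=; apply: eq_bigr => l _; exact: exchange_big.
rewrite [RHS]exchange_big /=; apply: eq_bigr => y _.
rewrite [RHS]exchange_big /=; apply: eq_bigr => x _.
apply: eq_bigr => l _; apply: eq_bigr => i _.
by rewrite q [U _ _ * _]mulrC.
Qed.
End Polarization.

(** * Trace identities for an orthonormal frame of the traceless matrices *)

(** The frame is known only through the completeness relation fierz and the pairing orth_e; both
    hold for an orthonormal basis of su(n), and they make every contraction over it computable. *)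
Section TraceAlgebra.
Variables (F : numFieldType) (n N : nat) (e : 'I_N -> 'M[F]_n).
Hypothesis n_gt0 : (0 < n)%N.
Hypothesis tr_e : forall x, \tr (e x) = 0.
Hypothesis fierz : forall X, \sum_x \tr (e x *m X) *: e x = (\tr X / n%:R)%:M - X.
Hypothesis orth_e : forall x y, \tr (e x *m e y) = - (x == y)%:R.

Let nF : n%:R != 0 :> F. Proof. by rewrite pnatr_eq0 -lt0n. Qed.

Lemma fierz_tr X Y :
  \sum_x \tr (e x *m X) * \tr (e x *m Y) = \tr X * \tr Y / n%:R - \tr (X *m Y).
Proof.
have -> : \sum_x \tr (e x *m X) * \tr (e x *m Y)
        = \tr ((\sum_x \tr (e x *m X) *: e x) *m Y).
  rewrite mulmx_suml raddf_sum; apply: eq_bigr => x _ /=.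
  by rewrite -scalemxAl linearZ.
by rewrite fierz mulmxBl mul_scalar_mx raddfB /= linearZ /= mulrAC.
Qed.

(** The completeness relation read entrywise, with the two factors of the frame exchanging their
    indices: it also contracts a matrix that stands between two frame elements. *)
Lemma fierz_sandwich X :
  \sum_x e x *m X *m e x = n%:R^-1 *: X - (\tr X)%:M.
Proof.
apply/matrixP => i j; rewrite summxE.
have E x : (e x *m X *m e x) i j = \sum_b \sum_a X a b * (\tr (e x *m delta_mx j b) *: e x) i a.
  rewrite !mxE; apply: eq_bigr => b _; rewrite !mxE mulr_suml.
  apply: eq_bigr => a _; rewrite !mxE.
  have -> : \tr (e x *m delta_mx j b) = e x b j.
    rewrite mxtrace_mulC /mxtrace (bigD1 j) //= big1 ?addr0 => [|k kj].
      rewrite !mxE (bigD1 b) //= big1 ?addr0 => [|l lb]; rewrite !mxE ?eqxx ?mul1r //.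
      by rewrite (negPf lb) andbF mul0r.
    by rewrite !mxE big1 // => l _; rewrite !mxE (negPf kj) mul0r.
  by ring.
under eq_bigr do rewrite E.
rewrite exchange_big /=.
under eq_bigr => b _.
  rewrite exchange_big /=.
  under eq_bigr => a _ do rewrite -mulr_sumr -summxE fierz.
over.
have T b : \tr (delta_mx j b : 'M[F]_n) = (j == b)%:R.
  rewrite /mxtrace (bigD1 b) //= big1 => [|k kb]; rewrite !mxE ?eqxx ?andbT ?addr0 1?eq_sym//.
  by rewrite (negPf kb) andbF.
under eq_bigr => b _ do under eq_bigr => a _ do rewrite !mxE T mulrBr.
under eq_bigr => b _ do rewrite sumrB.
rewrite sumrB !mxE; congr (_ - _).
  rewrite (bigD1 j) //= [X in _ + X]big1 ?addr0 => [|b bj]; last first.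
    by apply: big1 => a _; rewrite eq_sym (negPf bj) mul0r mul0rn mulr0.
  rewrite (bigD1 i) //= big1 ?addr0 => [|a ai]; last first.
    by rewrite eq_sym (negPf ai) mulr0n mulr0.
  by rewrite !eqxx mulr1n mul1r mulrC.
have [_|ij] := eqVneq i j.
  rewrite mulr1n; apply: eq_bigr => b _.
  rewrite (bigD1 b) //= big1 ?addr0 => [|a ab]; first by rewrite eqxx mulr1.
  by rewrite (negPf ab) mulr0.
rewrite big1 => [|b _]; first by rewrite mulr0n.
by rewrite big1 // => a _; rewrite mulr0.
Qed.

Lemma fierz_tr2 X Y :
  \sum_x \tr (e x *m X *m e x *m Y) = \tr (X *m Y) / n%:R - \tr X * \tr Y.
Proof.
rewrite -raddf_sum -mulmx_suml fierz_sandwich mulmxBl mul_scalar_mx raddfB /=.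
by rewrite -scalemxAl !linearZ /= mulrC.
Qed.

(** Contraction of a form with the associative product of the frame. It is minus the adjoint of
    kZ, so its traceless part measures the component of G along the forms kZ Z. *)
Definition cM (G : 'M[F]_N) : 'M[F]_n := \sum_x \sum_y G x y *: (e x *m e y).
Definition nest (G : 'M[F]_N) : 'M[F]_N :=
  \matrix_(u, v) \sum_x \sum_y G x y * \tr (e x *m e u *m e y *m e v).
(** For traceless Z, these anticommutator forms make up the copy of the adjoint representation in
    the symmetric square of su(n), which is zero for n = 2. *)
Definition Kmx (Z : 'M[F]_n) : 'M[F]_N :=
  \matrix_(x, y) \tr (Z *m (e x *m e y + e y *m e x)).
(** The matrix of ad e_x in the frame; the sign is that of orth_e. *)
Definition adm x : 'M[F]_N := \matrix_(i, j) - \tr (e i *m (e x *m e j - e j *m e x)).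
Local Notation Lam := (Lam adm).

Lemma KmxE Z x y : Kmx Z x y = \tr (Z *m e x *m e y) + \tr (Z *m e y *m e x).
Proof. by rewrite mxE mulmxDr raddfD /= !mulmxA. Qed.

Lemma admE x i j : adm x i j = - \tr (e i *m (e x *m e j - e j *m e x)).
Proof. by rewrite mxE. Qed.

Lemma nestE G u v :
  nest G u v = \sum_x \sum_y G x y * \tr (e x *m e u *m e y *m e v).
Proof. by rewrite mxE. Qed.

Lemma cM_tr G X :
  \tr (cM G *m X) = \sum_x \sum_y G x y * \tr (e x *m e y *m X).
Proof.
rewrite mulmx_suml raddf_sum; apply: eq_bigr => i _ /=.
rewrite mulmx_suml raddf_sum; apply: eq_bigr => j _ /=.
by rewrite -scalemxAl linearZ.
Qed.

Lemma Kmx_cM G u v : Kmx (cM G) u v =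
  \sum_x \sum_y G x y * \tr (e x *m e y *m e u *m e v)
  + \sum_x \sum_y G x y * \tr (e x *m e y *m e v *m e u).
Proof.
rewrite KmxE -!mulmxA !cM_tr.
by congr (_ + _); apply: eq_bigr => x _; apply: eq_bigr => y _; rewrite !mulmxA.
Qed.

Lemma tr_comm (A B : 'M[F]_n) : \tr (A *m B - B *m A) = 0.
Proof. by rewrite raddfB /= [X in X - _]mxtrace_mulC subrr. Qed.

(** Of the four products in the expansion of two commutators, two are contracted by cM and the
    other two interleave h with the indices, which is nest. *)
Lemma Lam1E h : h^T = h -> Lam 1%:M h = Kmx (cM h) - 2%:R *: nest h.
Proof.
move=> hs; apply/matrixP => x y.
rewrite LamE mulmx1 addmxE oppmxE scalemxE Kmx_cM nestE.
have admE' z i j : adm z i j = - \tr (e j *m (e i *m e z - e z *m e i)).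
  rewrite mxE; congr (- _); rewrite !mulmxBr !raddfB /=; congr (_ - _).
    by rewrite mxtrace_mulC -mulmxA mxtrace_mulC -mulmxA mxtrace_mulC -mulmxA.
  by rewrite mxtrace_mulC -mulmxA.
have adE i j : (adm x *m (adm y)^T) i j
   = - \tr ((e i *m e x - e x *m e i) *m (e j *m e y - e y *m e j)).
  rewrite mxE; under eq_bigr => k _ do rewrite [(adm y)^T _ _]mxE !admE' mulrNN.
  by rewrite fierz_tr !tr_comm !mul0r sub0r.
rewrite [X in X = _]/mxtrace.
under eq_bigr => i _ do rewrite mxE.
under eq_bigr => i _ do under eq_bigr => j _ do
  rewrite adE mulNr.
have E i j : \tr ((e i *m e x - e x *m e i) *m (e j *m e y - e y *m e j))
  = \tr (e i *m e x *m e j *m e y) + \tr (e j *m e x *m e i *m e y)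
   - \tr (e j *m e i *m e x *m e y) - \tr (e i *m e j *m e y *m e x).
  rewrite mulmxBl !mulmxBr !raddfB /= !mulmxA.
  have -> : \tr (e x *m e i *m e y *m e j) = \tr (e j *m e x *m e i *m e y).
    by rewrite mxtrace_mulC !mulmxA.
  have -> : \tr (e i *m e x *m e y *m e j) = \tr (e j *m e i *m e x *m e y).
    by rewrite mxtrace_mulC !mulmxA.
  have -> : \tr (e x *m e i *m e j *m e y) = \tr (e i *m e j *m e y *m e x).
    by rewrite -!mulmxA mxtrace_mulC !mulmxA.
  ring.
have hE i j : h j i = h i j by rewrite -{1}hs mxE.
have E' i j : - (\tr ((e i *m e x - e x *m e i) *m (e j *m e y - e y *m e j)) * h j i)
  = (h i j * \tr (e j *m e i *m e x *m e y) +
    h i j * \tr (e i *m e j *m e y *m e x)) - (h i j * \tr (e i *m e x *m e j *m e y) +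
    h i j * \tr (e j *m e x *m e i *m e y)) by rewrite E hE; ring.
under eq_bigr => i _ do under eq_bigr => j _ do rewrite E'.
under eq_bigr => i _ do rewrite sumrB !big_split /=.
rewrite sumrB !big_split /=.
congr (_ + _ - _).
  by rewrite exchange_big; apply: eq_bigr => i _; apply: eq_bigr => j _; rewrite hE.
rewrite mulr_natl mulr2n; congr (_ + _).
by rewrite exchange_big; apply: eq_bigr => i _; apply: eq_bigr => j _; rewrite hE.
Qed.

Lemma mat1E u v : (1%:M : 'M[F]_N) u v = - \tr (e u *m e v).
Proof. by rewrite orth_e opprK mxE. Qed.

Lemma nestD G H : nest (G + H) = nest G + nest H.
Proof.
apply/matrixP => u v; rewrite addmxE !nestE -big_split; apply: eq_bigr => x _ /=.
by rewrite -big_split; apply: eq_bigr => y _; rewrite addmxE mulrDl.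
Qed.

Lemma nestZ a G : nest (a *: G) = a *: nest G.
Proof.
apply/matrixP => u v; rewrite scalemxE !nestE mulr_sumr; apply: eq_bigr => x _ /=.
by rewrite mulr_sumr; apply: eq_bigr => y _; rewrite scalemxE mulrA.
Qed.

Lemma cMD G H : cM (G + H) = cM G + cM H.
Proof.
rewrite -big_split; apply: eq_bigr => x _ /=.
by rewrite -big_split; apply: eq_bigr => y _; rewrite addmxE scalerDl.
Qed.

Lemma cMZ a G : cM (a *: G) = a *: cM G.
Proof.
rewrite scaler_sumr; apply: eq_bigr => x _ /=.
by rewrite scaler_sumr; apply: eq_bigr => y _; rewrite scalemxE scalerA.
Qed.

Lemma KmxD Y Z : Kmx (Y + Z) = Kmx Y + Kmx Z.
Proof. by apply/matrixP => x y; rewrite !mxE mulmxDl raddfD. Qed.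

Lemma KmxZ a Z : Kmx (a *: Z) = a *: Kmx Z.
Proof. by apply/matrixP => x y; rewrite !mxE -scalemxAl linearZ. Qed.

Lemma Kmx1 : Kmx 1%:M = - 2%:R *: 1%:M.
Proof.
apply/matrixP => x y; rewrite scalemxE mat1E KmxE !mul1mx [in X in _ + X]mxtrace_mulC.
ring.
Qed.

(** The completeness relation removes the first summation as soon as the form is presented through
    traces against the frame; likewise in cM_form. *)
Lemma nest_form (G : 'M[F]_N) (A : 'I_N -> 'M[F]_n) u v :
  (forall x y, G x y = \tr (e x *m A y)) ->
  nest G u v = \sum_y (\tr (A y) * \tr (e u *m e y *m e v) / n%:R
                       - \tr (A y *m e u *m e y *m e v)).
Proof.
move=> GA; rewrite nestE exchange_big; apply: eq_bigr => y _ /=.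
under eq_bigr => x _ do rewrite GA -!mulmxA.
by rewrite fierz_tr !mulmxA.
Qed.

Lemma cM_form (G : 'M[F]_N) (A : 'I_N -> 'M[F]_n) :
  (forall x y, G x y = \tr (e x *m A y)) ->
  cM G = \sum_y ((\tr (A y) / n%:R) *: e y - A y *m e y).
Proof.
move=> GA; rewrite /cM exchange_big; apply: eq_bigr => y _ /=.
under eq_bigr => x _ do rewrite GA scalemxAl.
by rewrite -mulmx_suml fierz mulmxBl mul_scalar_mx.
Qed.

Lemma nest_pair a b u v :
  \sum_x \sum_y \tr (a *m e x *m b *m e y) * \tr (e x *m u *m e y *m v)
  = \tr (a *m b) * \tr (v *m u) / n%:R ^+ 2 - \tr (a *m b *m v *m u) / n%:R
    - \tr (a *m u *m v *m b) / n%:R + \tr (a *m u) * \tr (v *m b).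
Proof.
rewrite exchange_big /=.
have E y : \sum_x \tr (a *m e x *m b *m e y) * \tr (e x *m u *m e y *m v)
  = \tr (e y *m (a *m b)) * \tr (e y *m (v *m u)) / n%:R
    - \tr (e y *m (a *m u) *m e y *m (v *m b)).
  have E' x : \tr (a *m e x *m b *m e y) = \tr (e x *m (b *m e y *m a)).
    by rewrite -!mulmxA mxtrace_mulC !mulmxA.
  under eq_bigr => x _ do rewrite E' -!mulmxA.
  rewrite fierz_tr; congr (_ * _ / _ - _).
  - by rewrite mxtrace_mulC -!mulmxA.
  - by rewrite mxtrace_mulC -!mulmxA.
  - by rewrite -!mulmxA mxtrace_mulC -!mulmxA.
under eq_bigr => y _ do rewrite E.
rewrite sumrB -mulr_suml fierz_tr fierz_tr2 !mulmxA; field.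
exact: nF.
Qed.

(** Up to the image of Kmx and the scalars, nest is an involution of the symmetric forms. By Lam1E
    this makes Lam 1 satisfy a quadratic equation there, which is how resolvent inverts it. *)
Lemma nest_nest h : h^T = h ->
  nest (nest h) = h - n%:R^-1 *: Kmx (cM h) - (\tr (cM h) / n%:R ^+ 2) *: 1%:M.
Proof.
move=> hs; apply/matrixP => u v.
have hE i j : h j i = h i j by rewrite -{1}hs mxE.
rewrite !(addmxE, oppmxE, scalemxE) Kmx_cM nestE.
under eq_bigr => x _ do under eq_bigr => y _ do
  rewrite nestE mulr_suml.
transitivity (\sum_i \sum_j h i j * (\sum_x \sum_y
   \tr (e i *m e x *m e j *m e y) * \tr (e x *m e u *m e y *m e v))).
  rewrite [LHS](eq_bigr (fun x => \sum_i \sum_y \sum_j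
    h i j * \tr (e i *m e x *m e j *m e y) * \tr (e x *m e u *m e y *m e v))); last first.
    move=> x _; rewrite exchange_big /=; apply: eq_bigr => i _; apply: eq_bigr => j _.
    by rewrite mulr_suml.
  rewrite exchange_big /=; apply: eq_bigr => i _.
  under eq_bigr => x _ do rewrite exchange_big /=.
  rewrite exchange_big /=; apply: eq_bigr => j _.
  rewrite mulr_sumr; apply: eq_bigr => x _; rewrite mulr_sumr; apply: eq_bigr => y _.
  by rewrite mulrA.
have E i j : h i j * (\sum_x \sum_y
   \tr (e i *m e x *m e j *m e y) * \tr (e x *m e u *m e y *m e v)) =
  h i j * (i == u)%:R * (j == v)%:R - n%:R^-1 * (h i j * \tr (e i *m e j *m e v *m e u))
  - n%:R^-1 * (h j i * \tr (e j *m e i *m e u *m e v))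
  + (h i j * \tr (e i *m e j)) * (\tr (e u *m e v) / n%:R ^+ 2).
  rewrite nest_pair hE !orth_e [v == j]eq_sym.
  have -> : \tr (e i *m e u *m e v *m e j) = \tr (e j *m e i *m e u *m e v).
    by rewrite mxtrace_mulC !mulmxA.
  rewrite [v == u]eq_sym.  ring.
under eq_bigr => i _ do under eq_bigr => j _ do rewrite E.
under eq_bigr => i _ do rewrite big_split /= !sumrB -!mulr_sumr -mulr_suml.
rewrite big_split /= !sumrB -!mulr_sumr -mulr_suml.
have -> : \tr (cM h) = \sum_x \sum_y h x y * \tr (e x *m e y).
  by rewrite -[cM h]mulmx1 cM_tr; apply: eq_bigr => x _; apply: eq_bigr => y _; rewrite mulmx1.
rewrite mat1E [in X in _ - X + _]exchange_big /=.
have -> : \sum_i \sum_j h i j * (i == u)%:R * (j == v)%:R = h u v.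
  rewrite (bigD1 u) //= [X in _ + X]big1 ?addr0 => [|i iu]; last first.
    by apply: big1 => j _; rewrite (negPf iu) mulr0 mul0r.
  rewrite (bigD1 v) //= big1 ?addr0 => [|j jv]; last by rewrite (negPf jv) mulr0.
  by rewrite !eqxx !mulr1.
ring.
Qed.

Lemma KmxT Z : (Kmx Z)^T = Kmx Z.
Proof. by apply/matrixP => x y; rewrite !mxE addrC. Qed.

Lemma nest_K Z : nest (Kmx Z) =
  - (2%:R / n%:R) *: Kmx Z - (2%:R * \tr Z / n%:R ^+ 2) *: 1%:M.
Proof.
apply/matrixP => u v; rewrite addmxE oppmxE !scalemxE mat1E KmxE.
rewrite (@nest_form _ (fun y => e y *m Z + Z *m e y)); last first.
  move=> x y; rewrite KmxE mulmxDr raddfD /= mulmxA; congr (_ + _).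
    by rewrite -mulmxA mxtrace_mulC.
  by rewrite -mulmxA [RHS]mxtrace_mulC mulmxA.
have E y : \tr (e y *m Z + Z *m e y) * \tr (e u *m e y *m e v) / n%:R
     - \tr ((e y *m Z + Z *m e y) *m e u *m e y *m e v)
  = 2%:R / n%:R * (\tr (e y *m Z) * \tr (e y *m (e v *m e u)))
    - \tr (e y *m (Z *m e u) *m e y *m e v) - \tr (e y *m e u *m e y *m (e v *m Z)).
  rewrite !mulmxDl !raddfD /= [\tr (Z *m e y)]mxtrace_mulC !mulmxA.
  have -> : \tr (e u *m e y *m e v) = \tr (e y *m e v *m e u) by trace_rot.
  have -> : \tr (Z *m e y *m e u *m e y *m e v)
          = \tr (e y *m e u *m e y *m e v *m Z) by trace_rot.
  ring.
under eq_bigr => y _ do rewrite E.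
rewrite !sumrB -mulr_sumr fierz_tr !fierz_tr2 !tr_e.
have -> : \tr (Z *m (e v *m e u)) = \tr (Z *m e v *m e u) by rewrite mulmxA.
have -> : \tr (e u *m (e v *m Z)) = \tr (Z *m e u *m e v) by trace_rot.
have -> : \tr (e v *m e u) = \tr (e u *m e v) by trace_rot.
field; exact: nF.
Qed.

(** If h nearly solves the linearized equation, then g is small and h is nearly the form Kmx (cM h)
    up to a factor. The factor n ^ 2 - 4 is where n = 2 drops out. *)
Lemma resolvent h : h^T = h ->
  let g := n%:R *: h - Lam 1%:M h in
  (n%:R ^+ 2 - 4%:R) *: h = n%:R *: Kmx (cM h) + n%:R *: g - 2%:R *: nest g.
Proof.
move=> hs g; have gE : g = n%:R *: h + (- Kmx (cM h)) + 2%:R *: nest h.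
  by rewrite /g Lam1E // opprB addrA addrAC.
rewrite gE !(nestD, nestZ) -(scaleN1r (Kmx _)) !(nestZ, nest_K) nest_nest //.
apply/matrixP => u v; rewrite !(addmxE, oppmxE, scalemxE).
field; exact: nF.
Qed.

(** The infinitesimal Einstein deformations of the bi-invariant metric, see LamK1. *)
Definition kZ Z := - (2%:R^-1) *: Kmx Z.

Lemma cM_K Z : cM (Kmx Z) =
  (n%:R - 4%:R / n%:R) *: Z + ((2%:R / n%:R ^+ 2 + 1) * \tr Z)%:M.
Proof.
rewrite (@cM_form _ (fun y => e y *m Z + Z *m e y)); last first.
  move=> x y; rewrite KmxE mulmxDr raddfD /=; congr (_ + _); trace_rot.
have E y : (\tr (e y *m Z + Z *m e y) / n%:R) *: e y - (e y *m Z + Z *m e y) *m e y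
  = (2%:R / n%:R) *: (\tr (e y *m Z) *: e y) - e y *m Z *m e y
   - Z *m (e y *m 1%:M *m e y).
  rewrite raddfD /= [\tr (Z *m e y)]mxtrace_mulC mulmxDl mulmx1 mulmxA.
  apply/matrixP => u v; rewrite !(addmxE, oppmxE, scalemxE); ring.
under eq_bigr => y _ do rewrite E.
rewrite !sumrB -scaler_sumr fierz fierz_sandwich -mulmx_sumr fierz_sandwich.
rewrite mxtrace1 mulmxBr -scalemxAr mulmx1 mul_mx_scalar.
apply/matrixP => u v; rewrite !mxE; case: (u == v); rewrite ?mulr1n ?mulr0n; field; exact: nF.
Qed.

Lemma cM_nest r : r^T = r ->
  cM (nest r) = (\tr (cM r) / n%:R ^+ 2)%:M - (2%:R / n%:R) *: cM r.
Proof.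
move=> rs; have rE i j : r j i = r i j by rewrite -{1}rs mxE.
rewrite (@cM_form _ (fun y => \sum_i \sum_j r i j *: (e j *m e y *m e i))); last first.
  move=> x y; rewrite nestE mulmx_sumr raddf_sum; apply: eq_bigr => i _ /=.
  rewrite mulmx_sumr raddf_sum; apply: eq_bigr => j _ /=.
  rewrite -scalemxAr linearZ /=; congr (_ * _); trace_rot.
rewrite big_split sumrN /=.
have -> : \sum_i (\tr (\sum_i1 \sum_j r i1 j *: (e j *m e i *m e i1)) / n%:R) *: e i
   = n%:R^-1 *: ((\tr (cM r) / n%:R)%:M - cM r).
  rewrite -fierz scaler_sumr; apply: eq_bigr => y _.
  rewrite scalerA [n%:R^-1 * _]mulrC.
  congr (_ * _ *: _); rewrite [RHS]mxtrace_mulC cM_tr raddf_sum; apply: eq_bigr => i _ /=.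
  rewrite raddf_sum; apply: eq_bigr => j _ /=.
  rewrite linearZ /=; congr (_ * _); trace_rot.
have -> : \sum_y (\sum_i \sum_j r i j *: (e j *m e y *m e i)) *m e y
   = n%:R^-1 *: cM r.
  under eq_bigr => y _ do rewrite mulmx_suml.
  rewrite exchange_big /= /cM [in RHS]exchange_big scaler_sumr; apply: eq_bigr => i _.
  under eq_bigr => y _ do rewrite mulmx_suml.
  rewrite exchange_big /= scaler_sumr; apply: eq_bigr => j _.
  have E y : r i j *: (e j *m e y *m e i) *m e y = r i j *: (e j *m (e y *m e i *m e y)).
    by rewrite -scalemxAl !mulmxA.
  under eq_bigr => y _ do rewrite E.
  rewrite -scaler_sumr -mulmx_sumr fierz_sandwich tr_e raddf0 subr0 -scalemxAr.
  by rewrite rE !scalerA mulrC.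
apply/matrixP => u v; rewrite !mxE; case: (u == v); rewrite ?mulr1n ?mulr0n; field; exact: nF.
Qed.

Lemma LamK1 Z : \tr Z = 0 -> Lam 1%:M (kZ Z) = n%:R *: kZ Z.
Proof.
move=> Z0; rewrite Lam1E; last by rewrite linearZ /= KmxT.
rewrite cMZ cM_K nestZ nest_K Z0 !(mulr0, mul0r) scale0r raddf0 addr0 subr0 !KmxZ /kZ.
apply/matrixP => u v; rewrite !(addmxE, oppmxE, scalemxE); field; exact: nF.
Qed.

Definition traceless (X : 'M[F]_n) := X - (\tr X / n%:R)%:M.

Lemma tracelessD X Y : traceless (X + Y) = traceless X + traceless Y.
Proof. by rewrite /traceless raddfD /= mulrDl raddfD /= opprD addrACA. Qed.
Lemma tracelessZ a X : traceless (a *: X) = a *: traceless X.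
Proof. by rewrite /traceless linearZ /= -mulrA scalerBr scale_scalar_mx. Qed.
Lemma traceless_scalar a : traceless a%:M = 0.
Proof. by rewrite /traceless mxtrace_scalar -(mulr_natr a) mulfK ?nF // subrr. Qed.

(** The linearization is self-adjoint and annihilates every kZ Z with Z traceless, so its image has
    no component along these forms. *)
Lemma traceless_cM_ker r : r^T = r -> traceless (cM (n%:R *: r - Lam 1%:M r)) = 0.
Proof.
move=> rs; rewrite Lam1E // opprB -!scaleN1r !(cMD, cMZ, cM_K, cM_nest) //.
rewrite !(tracelessD, tracelessZ, traceless_scalar) -(scaleN1r (_ *: cM r)).
rewrite !(tracelessD, tracelessZ, traceless_scalar).
apply/matrixP => u v; rewrite !(addmxE, oppmxE, scalemxE) mxE.
field; exact: nF.
Qed.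

Lemma kZE Z x y : kZ Z x y = - (2%:R^-1) * \tr (e x *m (Z *m e y + e y *m Z)).
Proof.
rewrite /kZ scalemxE KmxE mulmxDr raddfD /= addrC; congr (_ * (_ + _)); trace_rot.
Qed.

Lemma kZT Z : (kZ Z)^T = kZ Z.
Proof. by rewrite linearZ /= KmxT. Qed.

Lemma kZ_sqr Z x y : (kZ Z *m kZ Z) x y =
  \tr (e x *m Z) * \tr (e y *m Z) / n%:R - 2%:R^-1 * \tr (e x *m Z *m e y *m Z)
  - 4%:R^-1 * Kmx (Z *m Z) x y.
Proof.
rewrite mxE.
have E w : kZ Z x w * kZ Z w y
   = 4%:R^-1 * (\tr (e w *m (Z *m e x + e x *m Z)) * \tr (e w *m (Z *m e y + e y *m Z))).
  by rewrite -{1}kZT mxE !kZE; field.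
under eq_bigr => w _ do rewrite E.
rewrite -mulr_sumr fierz_tr KmxE mulmxDl !mulmxDr !raddfD /= !mulmxA.
have -> : \tr (Z *m e x) = \tr (e x *m Z) by trace_rot.
have -> : \tr (Z *m e y) = \tr (e y *m Z) by trace_rot.
have -> : \tr (Z *m e x *m Z *m e y) = \tr (e x *m Z *m e y *m Z) by trace_rot.
have -> : \tr (Z *m e x *m e y *m Z) = \tr (Z *m Z *m e x *m e y) by trace_rot.
have -> : \tr (e x *m Z *m Z *m e y) = \tr (Z *m Z *m e y *m e x) by trace_rot.
field; exact: nF.
Qed.

Lemma fierz_tr4 (A B C D : 'M[F]_n) :
  \sum_x \tr (A *m e x *m B *m (C *m e x *m D)) =
  \tr (B *m C *m D *m A) / n%:R - \tr (B *m C) * \tr (D *m A).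
Proof.
have E x : \tr (A *m e x *m B *m (C *m e x *m D)) = \tr (e x *m (B *m C) *m e x *m (D *m A)).
  trace_rot.
by under eq_bigr => x _ do rewrite E; rewrite fierz_tr2 !mulmxA.
Qed.

(** The quadratic part of the Ricci tensor on the infinitesimal deformations: the commutators expand
    into sixteen traces, each of which is contracted by fierz_tr4. *)
Lemma Lam_kk Z x y : \tr Z = 0 -> Lam (kZ Z) (kZ Z) x y =
  - (2%:R^-1) * (n%:R * \tr (e x *m Z *m e y *m Z)
   - 2%:R * (\tr (e x *m Z) * \tr (e y *m Z)) + \tr (e x *m e y) * \tr (Z *m Z)).
Proof.
move=> Z0; rewrite LamE -mulmxA.
have trN (X : 'M[F]_n) : \tr (- X) = - \tr X by exact: raddfN.
have admk v i j : (adm v *m kZ Z) i j =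
  - (2%:R^-1) * \tr (e i *m ((e v *m (Z *m e j + e j *m Z)) - (Z *m e j + e j *m Z) *m e v)).
  rewrite mxE.
  have E w : adm v i w * kZ Z w j = 2%:R^-1 *
      (\tr (e w *m (e i *m e v - e v *m e i)) * \tr (e w *m (Z *m e j + e j *m Z))).
    rewrite mxE kZE.
    have -> : \tr (e i *m (e v *m e w - e w *m e v)) = \tr (e w *m (e i *m e v - e v *m e i)).
      rewrite !mulmxBr !raddfB /=; congr (_ - _); trace_rot.
    ring.
  under eq_bigr => w _ do rewrite E.
  rewrite -mulr_sumr fierz_tr tr_comm mul0r mul0r sub0r mulrN mulNr.
  congr (- (_ * _)); rewrite mulmxBl mulmxBr !raddfB /=; congr (_ - _).
    by rewrite mulmxA.
  trace_rot.
have admT v : (adm v)^T = - adm v.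
  apply/matrixP => i j; rewrite mxE oppmxE !admE; congr (- _).
  rewrite !mulmxBr !raddfB /= opprK [RHS]addrC; congr (_ - _); trace_rot.
rewrite admT mulNmx mulmxN raddfN /= [X in - X]/mxtrace.
under eq_bigr => i _ do rewrite mxE.
rewrite exchange_big /=.
have E j i : (adm x *m kZ Z) i j * (adm y *m kZ Z) j i = 4%:R^-1 *
   (\tr (e i *m ((e x *m (Z *m e j + e j *m Z)) - (Z *m e j + e j *m Z) *m e x))
    * \tr (e i *m (Z *m (e j *m e y - e y *m e j) + (e j *m e y - e y *m e j) *m Z))).
  rewrite !admk.
  have -> : \tr (e j *m (e y *m (Z *m e i + e i *m Z) - (Z *m e i + e i *m Z) *m e y))
    = \tr (e i *m (Z *m (e j *m e y - e y *m e j) + (e j *m e y - e y *m e j) *m Z)).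
    rewrite !(mulmxDl, mulNmx) !(mulmxDr, mulmxN) !(mxtraceD, trN).
    rewrite !mulmxA.
    have -> : \tr (e j *m e y *m Z *m e i) = \tr (e i *m e j *m e y *m Z) by trace_rot.
    have -> : \tr (e j *m e y *m e i *m Z) = \tr (e i *m Z *m e j *m e y) by trace_rot.
    have -> : \tr (e j *m Z *m e i *m e y) = \tr (e i *m e y *m e j *m Z) by trace_rot.
    have -> : \tr (e j *m e i *m Z *m e y) = \tr (e i *m Z *m e y *m e j) by trace_rot.
    ring.
  by field.
under eq_bigr => j _ do under eq_bigr => i _ do rewrite E.
under eq_bigr => j _ do rewrite -mulr_sumr fierz_tr tr_comm !mul0r sub0r mulrN.
rewrite sumrN opprK -mulr_sumr.
have E2 j : \tr ((e x *m (Z *m e j + e j *m Z) - (Z *m e j + e j *m Z) *m e x) *m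
          (Z *m (e j *m e y - e y *m e j) + (e j *m e y - e y *m e j) *m Z))
  = \tr (((e x *m Z) *m e j *m 1%:M + e x *m e j *m Z - Z *m e j *m e x - 1%:M *m e j *m (Z *m e x))
     *m (Z *m e j *m e y - Z *m e y *m e j *m 1%:M
         + (1%:M *m e j *m (e y *m Z)) - (e y *m e j *m Z))).
  rewrite !mulmx1 !mul1mx; congr (\tr (_ *m _)).
    by rewrite mulmxDl mulmxDr !mulmxA opprD !addrA.
  by rewrite mulmxBl mulmxBr !mulmxA !addrA.
have tr_prod (p1 p2 p3 p4 q1 q2 q3 q4 : 'M[F]_n) :
    \tr ((p1 + p2 - p3 - p4) *m (q1 - q2 + q3 - q4)) =
    (\tr (p1 *m q1) - \tr (p1 *m q2) + \tr (p1 *m q3) - \tr (p1 *m q4))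
    + (\tr (p2 *m q1) - \tr (p2 *m q2) + \tr (p2 *m q3) - \tr (p2 *m q4))
    - (\tr (p3 *m q1) - \tr (p3 *m q2) + \tr (p3 *m q3) - \tr (p3 *m q4))
    - (\tr (p4 *m q1) - \tr (p4 *m q2) + \tr (p4 *m q3) - \tr (p4 *m q4)).
  by rewrite !(mulmxDl, mulNmx) !(mulmxDr, mulmxN) !(mxtraceD, trN); ring.
under eq_bigr => j _ do rewrite E2 tr_prod.
rewrite !(big_split, sumrN, fierz_tr4) /= !(mulmx1, mul1mx, mulmxA) !(tr_e, Z0, mul0r, mulr0).
rewrite mxtrace1.
have -> : \tr (Z *m e x) = \tr (e x *m Z) by trace_rot.
have -> : \tr (Z *m e y) = \tr (e y *m Z) by trace_rot.
have -> : \tr (e y *m e x) = \tr (e x *m e y) by trace_rot.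
have -> : \tr (e y *m Z *m e x *m Z) = \tr (e x *m Z *m e y *m Z) by trace_rot.
have -> : \tr (Z *m e x *m Z *m e y) = \tr (e x *m Z *m e y *m Z) by trace_rot.
field; exact: nF.
Qed.

End TraceAlgebra.

(** * The obstruction to integrating a deformation *)

Section Obstruction.
Variables (F : numFieldType) (n N : nat) (e : 'I_N -> 'M[F]_n).
Hypothesis n_gt0 : (0 < n)%N.
Hypothesis tr_e : forall x, \tr (e x) = 0.
Hypothesis fierz : forall X, \sum_x \tr (e x *m X) *: e x = (\tr X / n%:R)%:M - X.
Hypothesis orth_e : forall x y, \tr (e x *m e y) = - (x == y)%:R.

Local Notation Lam := (Lam (adm e)).
Local Notation cM := (cM e).
Local Notation nest := (nest e).
Local Notation Kmx := (Kmx e).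
Local Notation kZ := (kZ e).
Let nF : n%:R != 0 :> F. Proof. by rewrite pnatr_eq0 -lt0n. Qed.

Lemma kZD X Y : kZ (X + Y) = kZ X + kZ Y.
Proof. by rewrite /kZ KmxD scalerDr. Qed.

Lemma kZZ k X : kZ (k *: X) = k *: kZ X.
Proof. by rewrite /kZ KmxZ !scalerA mulrC. Qed.

Lemma traceless_cM_tr A (B := \matrix_(x, y) \tr (e x *m A *m e y *m A)) : \tr A = 0 ->
  traceless (cM B) = - (2%:R / n%:R) *: traceless (A *m A).
Proof.
move=> A0; rewrite (cM_form fierz (A := fun y => A *m e y *m A)); last first.
  by move=> x y; rewrite mxE !mulmxA.
have E y : (\tr (A *m e y *m A) / n%:R) *: e y - A *m e y *m A *m e y
   = n%:R^-1 *: (\tr (e y *m (A *m A)) *: e y) - A *m (e y *m A *m e y).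
  rewrite scalerA mulrC !mulmxA; congr (_ * _ *: _ - _); trace_rot.
under eq_bigr => y _ do rewrite E.
rewrite sumrB -scaler_sumr fierz -mulmx_sumr (fierz_sandwich fierz) A0 raddf0 subr0.
rewrite -scalemxAr -!scaleN1r !(tracelessD, tracelessZ, traceless_scalar) //.
apply/matrixP => u v; rewrite !mxE; field; exact: nF.
Qed.

Lemma traceless_cM_rank1 A (B := \matrix_(x, y) (\tr (e x *m A) * \tr (e y *m A))) : \tr A = 0 ->
  traceless (cM B) = traceless (A *m A).
Proof.
move=> A0; rewrite (cM_form fierz (A := fun y => \tr (e y *m A) *: A)); last first.
  by move=> x y; rewrite mxE -scalemxAr linearZ /= mulrC.
have E y : (\tr (\tr (e y *m A) *: A) / n%:R) *: e y - (\tr (e y *m A) *: A) *m e y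
  = - (A *m (\tr (e y *m A) *: e y)).
  by rewrite linearZ /= A0 mulr0 mul0r scale0r sub0r -scalemxAl -scalemxAr.
under eq_bigr => y _ do rewrite E.
rewrite sumrN -mulmx_sumr fierz A0 mul0r raddf0 sub0r.
by rewrite (linearN (mulmx A)) opprK.
Qed.

Lemma traceless_cM1 : traceless (cM 1%:M) = 0.
Proof.
rewrite (cM_form fierz (A := fun y => - e y)); last first.
  by move=> x y; rewrite mulmxN raddfN /= orth_e opprK mxE.
have E y : (\tr (- e y) / n%:R) *: e y - - e y *m e y = e y *m 1%:M *m e y.
  by rewrite raddfN /= tr_e oppr0 mul0r scale0r sub0r mulNmx opprK mulmx1.
under eq_bigr => y _ do rewrite E.
rewrite (fierz_sandwich fierz) -scaleN1r tracelessD !tracelessZ !traceless_scalar //.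
by rewrite !scaler0 addr0.
Qed.

(** The quadratic part of the Einstein equation, projected to the forms kZ, is the traceless part of
    the square: a deformation that can be continued to second order has scalar Z ^ 2. *)
Lemma traceless_cM_obstruction Z : \tr Z = 0 ->
  traceless (cM (3%:R *: Lam (kZ Z) (kZ Z) - (2%:R * n%:R) *: (kZ Z *m kZ Z)))
  = (n%:R ^+ 2 / 2%:R) *: traceless (Z *m Z).
Proof.
move=> Z0.
pose A1 := \matrix_(x, y) \tr (e x *m Z *m e y *m Z).
pose A2 := \matrix_(x, y) (\tr (e x *m Z) * \tr (e y *m Z)).
have LE : Lam (kZ Z) (kZ Z) = - (n%:R / 2%:R) *: A1 + A2 + (\tr (Z *m Z) / 2%:R) *: 1%:M.
  apply/matrixP => x y; rewrite (Lam_kk n_gt0) // !addmxE !scalemxE (mat1E orth_e).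
  rewrite [A1 _ _]mxE [A2 _ _]mxE; by field.
have kE : kZ Z *m kZ Z = n%:R^-1 *: A2 + - (2%:R^-1) *: A1 + - (4%:R^-1) *: Kmx (Z *m Z).
  apply/matrixP => x y; rewrite (kZ_sqr n_gt0) // !addmxE !scalemxE.
  rewrite [A1 _ _]mxE [A2 _ _]mxE; field; exact: nF.
rewrite LE kE -scaleN1r !(cMD, cMZ) !(tracelessD, tracelessZ).
rewrite traceless_cM_tr // traceless_cM_rank1 // traceless_cM1.
rewrite (cM_K n_gt0) // tracelessD tracelessZ traceless_scalar //.
apply/matrixP => x y; rewrite !(addmxE, scalemxE) !mxE; field; exact: nF.
Qed.

Lemma frame_card : N%:R = n%:R ^+ 2 - 1 :> F.
Proof.
rewrite -[LHS](mxtrace1 F N) /mxtrace.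
have E x : (1%:M : 'M[F]_N) x x = - \tr (e x *m 1%:M *m e x *m 1%:M).
  by rewrite (mat1E orth_e) !mulmx1.
under eq_bigr => x _ do rewrite E.
by rewrite sumrN (fierz_tr2 fierz) mulmx1 mxtrace1 divff // opprB expr2.
Qed.

(** The Killing form is 2 n times the trace form; this fixes the Einstein constant at the
    identity. *)
Lemma Lam_11 : Lam 1%:M 1%:M = (2%:R * n%:R) *: 1%:M.
Proof.
rewrite (Lam1E fierz) ?trmx1 //.
have -> : cM 1%:M = (n%:R^-1 - n%:R) *: 1%:M.
  rewrite (cM_form fierz (A := fun y => - e y)); last first.
    by move=> x y; rewrite mulmxN raddfN /= orth_e opprK mxE.
  have E y : (\tr (- e y) / n%:R) *: e y - - e y *m e y = e y *m 1%:M *m e y.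
    by rewrite raddfN /= tr_e oppr0 mul0r scale0r sub0r mulNmx opprK mulmx1.
  under eq_bigr => y _ do rewrite E.
  by rewrite (fierz_sandwich fierz) mxtrace1 -[(n%:R)%:M]scalemx1 -scalerBl.
rewrite KmxZ Kmx1 //; apply/matrixP => u v.
rewrite !(addmxE, oppmxE, scalemxE) (mat1E orth_e).
rewrite (nest_form fierz (A := fun y => - e y)); last first.
  by move=> x y; rewrite mulmxN raddfN /= orth_e opprK mxE.
have E y : \tr (- e y) * \tr (e u *m e y *m e v) / n%:R - \tr (- e y *m e u *m e y *m e v)
   = \tr (e y *m e u *m e y *m e v).
  by rewrite raddfN /= tr_e oppr0 !mul0r sub0r !mulNmx raddfN opprK.
under eq_bigr => y _ do rewrite E.
rewrite (fierz_tr2 fierz) tr_e mul0r subr0.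
by field; exact: nF.
Qed.

(** A deformation with scalar square is a multiple of kZ J for a traceless involution J. The forms
    1, DJ and UJ span a commutative algebra that Lam 1 preserves, and (kZ J) ^ 2 lies in it. *)
Section Involution.
Variable J : 'M[F]_n.
Hypothesis JJ : J *m J = 1%:M.
Hypothesis trJ : \tr J = 0.

(** DJ is the conjugation by J in the frame. UJ is the square of the functional X |-> tr (X J), with
    the sign that makes it positive when J is hermitian and the frame skew-hermitian. *)
Definition DJ : 'M[F]_N := \matrix_(x, y) - \tr (e x *m J *m e y *m J).
Definition UJ : 'M[F]_N := \matrix_(x, y) - (\tr (e x *m J) * \tr (e y *m J)).

Lemma DJE x y : DJ x y = - \tr (e x *m J *m e y *m J). Proof. by rewrite mxE. Qed.
Lemma UJE x y : UJ x y = - (\tr (e x *m J) * \tr (e y *m J)). Proof. by rewrite mxE. Qed.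

Lemma DJT : DJ^T = DJ.
Proof. by apply/matrixP => x y; rewrite mxE !DJE; congr (- _); trace_rot. Qed.
Lemma UJT : UJ^T = UJ.
Proof. by apply/matrixP => x y; rewrite mxE !UJE mulrC. Qed.

Lemma tr_conjJ X : \tr (J *m X *m J) = \tr X.
Proof. by rewrite mxtrace_mulC mulmxA JJ mul1mx. Qed.

Lemma DJ_sqr : DJ *m DJ = 1%:M.
Proof.
apply/matrixP => x y; rewrite mxE (mat1E orth_e).
have E w : DJ x w * DJ w y = \tr (e w *m (J *m e x *m J)) * \tr (e w *m (J *m e y *m J)).
  by rewrite -{1}DJT mxE !DJE mulrNN !mulmxA.
under eq_bigr => w _ do rewrite E.
rewrite fierz_tr // !tr_conjJ !tr_e !mul0r sub0r; congr (- _).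
have -> : J *m e x *m J *m (J *m e y *m J) = J *m (e x *m e y) *m J.
  by rewrite !mulmxA -[J *m e x *m J *m J]mulmxA JJ mulmx1.
by rewrite tr_conjJ.
Qed.

Lemma DJUJ : DJ *m UJ = UJ.
Proof.
apply/matrixP => x y; rewrite mxE UJE.
have E w : DJ x w * UJ w y
   = (\tr (e w *m (J *m e x *m J)) * \tr (e w *m J)) * \tr (e y *m J).
  by rewrite -{1}DJT mxE !DJE UJE mulrNN !mulmxA mulrA.
under eq_bigr => w _ do rewrite E.
rewrite -mulr_suml fierz_tr // trJ mulr0 mul0r sub0r mulNr; congr (- (_ * _)).
by rewrite -mulmxA JJ mulmx1 mxtrace_mulC.
Qed.

Lemma UJDJ : UJ *m DJ = UJ.
Proof. by rewrite -[in LHS]UJT -[in LHS]DJT -trmx_mul DJUJ UJT. Qed.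

Lemma UJ_sqr : UJ *m UJ = n%:R *: UJ.
Proof.
apply/matrixP => x y; rewrite mxE scalemxE UJE.
have E w : UJ x w * UJ w y = (\tr (e x *m J) * \tr (e y *m J)) *
   (\tr (e w *m J) * \tr (e w *m J)).
  by rewrite !UJE; ring.
under eq_bigr => w _ do rewrite E.
rewrite -mulr_sumr fierz_tr // trJ JJ mxtrace1; ring.
Qed.

(** The right-hand side is the orthogonal projection onto the elements that commute with J and are
    orthogonal to it; see Theta_sqr. *)
Lemma kJ_sqr : kZ J *m kZ J = 2%:R^-1 *: (1%:M + DJ) - n%:R^-1 *: UJ.
Proof.
apply/matrixP => x y; rewrite (kZ_sqr n_gt0) // JJ Kmx1 //.
rewrite !(addmxE, oppmxE, scalemxE) DJE UJE; field; exact: nF.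
Qed.

Lemma Lam_kJ : Lam (kZ J) (kZ J) = n%:R *: (kZ J *m kZ J).
Proof.
apply/matrixP => x y; rewrite (Lam_kk n_gt0) // kJ_sqr JJ mxtrace1.
rewrite !(addmxE, oppmxE, scalemxE) DJE UJE (mat1E orth_e); field; exact: nF.
Qed.

Lemma Lam_DJ : Lam 1%:M DJ = - 2%:R *: UJ.
Proof.
rewrite (Lam1E fierz DJT).
have -> : cM DJ = n%:R^-1 *: 1%:M.
  rewrite (cM_form fierz (A := fun y => - (J *m e y *m J))); last first.
    by move=> x y; rewrite DJE mulmxN raddfN /= !mulmxA.
  have E y : (\tr (- (J *m e y *m J)) / n%:R) *: e y - - (J *m e y *m J) *m e y
     = J *m (e y *m J *m e y).
    rewrite raddfN /= tr_conjJ tr_e oppr0 mul0r scale0r sub0r.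
    by rewrite mulNmx opprK !mulmxA.
  under eq_bigr => y _ do rewrite E.
  by rewrite -mulmx_sumr (fierz_sandwich fierz) trJ raddf0 subr0 -scalemxAr JJ.
rewrite KmxZ Kmx1 //; apply/matrixP => u v.
rewrite !(addmxE, oppmxE, scalemxE) UJE (mat1E orth_e).
rewrite (nest_form fierz (A := fun y => - (J *m e y *m J))); last first.
  by move=> x y; rewrite DJE mulmxN raddfN /= !mulmxA.
have E y : \tr (- (J *m e y *m J)) * \tr (e u *m e y *m e v) / n%:R -
     \tr (- (J *m e y *m J) *m e u *m e y *m e v)
  = \tr (e y *m (J *m e u) *m e y *m (e v *m J)).
  rewrite raddfN /= tr_conjJ tr_e oppr0 !mul0r.
  rewrite sub0r !mulNmx raddfN /= opprK; trace_rot.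
under eq_bigr => y _ do rewrite E.
rewrite fierz_tr2 //.
have -> : \tr (J *m e u *m (e v *m J)) = \tr (e u *m e v).
  by rewrite mulmxA mxtrace_mulC !mulmxA JJ mul1mx.
rewrite [\tr (J *m e u)]mxtrace_mulC; field; exact: nF.
Qed.

Lemma Lam_UJ : Lam 1%:M UJ = 2%:R *: (1%:M - DJ).
Proof.
rewrite (Lam1E fierz UJT).
have -> : cM UJ = - 1%:M.
  rewrite (cM_form fierz (A := fun y => - (\tr (e y *m J) *: J))); last first.
    by move=> x y; rewrite UJE mulmxN raddfN /= -scalemxAr linearZ /= mulrC.
  have E y : (\tr (- (\tr (e y *m J) *: J)) / n%:R) *: e y - - (\tr (e y *m J) *: J) *m e y
     = J *m (\tr (e y *m J) *: e y).
    rewrite raddfN /= mxtraceZ trJ mulr0 oppr0 mul0r scale0r sub0r mulNmx opprK.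
    by rewrite -scalemxAl -scalemxAr.
  under eq_bigr => y _ do rewrite E.
  by rewrite -mulmx_sumr fierz trJ mul0r raddf0 sub0r (linearN (mulmx J)) /= JJ.
rewrite -scaleN1r KmxZ Kmx1 //; apply/matrixP => u v.
rewrite !(addmxE, oppmxE, scalemxE) DJE (mat1E orth_e).
rewrite (nest_form fierz (A := fun y => - (\tr (e y *m J) *: J))); last first.
  by move=> x y; rewrite UJE mulmxN raddfN /= -scalemxAr linearZ /= mulrC.
have E y : \tr (- (\tr (e y *m J) *: J)) * \tr (e u *m e y *m e v) / n%:R -
     \tr (- (\tr (e y *m J) *: J) *m e u *m e y *m e v)
  = \tr (e y *m J) * \tr (e y *m (e v *m J *m e u)).
  rewrite raddfN /= mxtraceZ trJ mulr0 oppr0 !mul0r sub0r !mulNmx raddfN /= opprK.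
  rewrite -!scalemxAl linearZ /=; congr (_ * _); trace_rot.
under eq_bigr => y _ do rewrite E.
rewrite fierz_tr // trJ !mul0r.
have -> : \tr (J *m (e v *m J *m e u)) = \tr (e u *m J *m e v *m J) by trace_rot.
ring.
Qed.

Lemma trDJ : \tr DJ = -1.
Proof.
rewrite /mxtrace; under eq_bigr => x _ do rewrite DJE.
by rewrite sumrN (fierz_tr2 fierz) JJ trJ mxtrace1 mulr0 subr0 divff.
Qed.

Lemma trUJ : \tr UJ = n%:R.
Proof.
rewrite /mxtrace; under eq_bigr => x _ do rewrite UJE.
by rewrite sumrN (fierz_tr fierz) JJ trJ mxtrace1 mulr0 mul0r sub0r opprK.
Qed.

Local Notation Theta := (kZ J *m kZ J).

Lemma trmx_Theta : Theta^T = Theta.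
Proof. by rewrite trmx_mul kZT. Qed.

Lemma DJ_Theta : DJ *m Theta = Theta.
Proof.
rewrite kJ_sqr mulmxBr -!scalemxAr mulmxDr mulmx1 DJ_sqr DJUJ [DJ + _]addrC.
by [].
Qed.

Lemma UJ_Theta : UJ *m Theta = 0.
Proof.
rewrite kJ_sqr mulmxBr -!scalemxAr mulmxDr mulmx1 UJDJ UJ_sqr.
apply/matrixP => u v; rewrite !(addmxE, oppmxE, scalemxE) [RHS]mxE; field; exact: nF.
Qed.

Lemma Theta_sqr : Theta *m Theta = Theta.
Proof.
move: kJ_sqr DJ_Theta UJ_Theta; move: Theta => T TE DT UT.
rewrite {1}TE mulmxBl -!scalemxAl mulmxDl mul1mx DT UT.
apply/matrixP => u v.
rewrite !(addmxE, oppmxE, scalemxE) [X in _ - _ * X]mxE; field; exact: nF.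
Qed.

Lemma Lam_Theta_mul : \tr (Theta *m Lam 1%:M Theta) = n%:R * \tr Theta.
Proof.
move: kJ_sqr DJ_Theta UJ_Theta; move: Theta => T TE DT UT.
have LE : Lam 1%:M T = (n%:R - 2%:R / n%:R) *: 1%:M - UJ + (2%:R / n%:R) *: DJ.
  rewrite TE -(scaleNr _ UJ) LamDr !LamZr LamDr Lam_11 // Lam_DJ Lam_UJ.
  apply/matrixP => u v; rewrite !(addmxE, oppmxE, scalemxE); field; exact: nF.
rewrite [in LHS]mxtrace_mulC LE mulmxDl mulmxBl -!scalemxAl mul1mx DT UT.
by rewrite subr0 mxtraceD !mxtraceZ; field; exact: nF.
Qed.

(** The solution of Lam_WJ in the span of 1, DJ and UJ. Testing the second-order equation against it
    gives the trace of (kZ J) ^ 2 B, although that equation does not determine B. *)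
Definition WJ : 'M[F]_N := ((n%:R ^+ 2 + 4%:R) / 2%:R) *: (1%:M - DJ)
  + (2%:R * n%:R) *: UJ - 8%:R *: 1%:M.

Lemma WJT : WJ^T = WJ.
Proof. by rewrite /WJ raddfB raddfD /= !linearZ /= raddfB /= trmx1 DJT UJT. Qed.

Lemma Lam_WJ : n%:R *: WJ - Lam 1%:M WJ = (- (n%:R ^+ 2 - 4%:R) * n%:R) *: Theta.
Proof.
have L1D : Lam 1%:M (1%:M - DJ) = (2%:R * n%:R) *: 1%:M + 2%:R *: UJ.
  by rewrite -scaleN1r LamDr LamZr Lam_11 // Lam_DJ scalerA mulN1r opprK.
rewrite /WJ -(scaleNr _ 1%:M) !LamDr !LamZr L1D Lam_11 // Lam_UJ kJ_sqr.
apply/matrixP => u v; rewrite !(addmxE, oppmxE, scalemxE); field; exact: nF.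
Qed.

Lemma tr_WJ_Theta : \tr (WJ *m Theta) = - 8%:R * \tr Theta.
Proof.
move: DJ_Theta UJ_Theta; move: Theta => T DT UT.
rewrite /WJ mulmxBl mulmxDl -!scalemxAl mulmxBl mul1mx DT UT subrr.
by rewrite !scaler0 addr0 sub0r -scaleNr mxtraceZ.
Qed.

Lemma tr_Theta : \tr Theta = (n%:R ^+ 2 - 4%:R) / 2%:R.
Proof.
rewrite kJ_sqr raddfB /= !mxtraceZ mxtraceD mxtrace1 frame_card trDJ trUJ.
field; exact: nF.
Qed.

(** The trace of (kZ J) ^ 3 pairs kZ J with its own square, that is, J with the contraction of that
    square; the contraction is scalar because the second-order obstruction vanishes at J. *)
Lemma tr_kJ_Theta : \tr (kZ J *m Theta) = 0.
Proof.
have := traceless_cM_obstruction trJ; rewrite Lam_kJ JJ traceless_scalar // scaler0.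
have TE x y : Theta y x = Theta x y by rewrite -{1}trmx_Theta mxE.
move: TE; move: Theta => T TE.
have -> : 3%:R *: (n%:R *: T) - (2%:R * n%:R) *: T = n%:R *: T.
  by rewrite scalerA -scalerBl; congr (_ *: _); ring.
rewrite cMZ tracelessZ => /eqP; rewrite scaler_eq0 (negPf nF) /= => /eqP pt0.
have cT : cM T = (\tr (cM T) / n%:R)%:M by apply/eqP; rewrite -subr_eq0; exact/eqP.
have -> : \tr (kZ J *m T) = - \tr (J *m cM T).
  rewrite [X in _ = - X]mxtrace_mulC cM_tr; set A := \sum_x _.
  have A' : A = \sum_x \sum_y T x y * \tr (J *m e y *m e x).
    rewrite /A exchange_big /=; apply: eq_bigr => x _; apply: eq_bigr => y _.
    by rewrite TE; congr (_ * _); trace_rot.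
  have E x y : kZ J x y * T y x =
      - (2%:R^-1) * (T x y * \tr (e x *m e y *m J)) + - (2%:R^-1) * (T x y * \tr (J *m e y *m e x)).
    rewrite /kZ scalemxE KmxE TE.
    have -> : \tr (J *m e x *m e y) = \tr (e x *m e y *m J) by trace_rot.
    ring.
  rewrite [LHS]/mxtrace.
  under eq_bigr => x _ do rewrite mxE.
  under eq_bigr => x _ do under eq_bigr => y _ do rewrite E.
  under eq_bigr => x _ do rewrite big_split /= -!mulr_sumr.
  by rewrite big_split /= -!mulr_sumr -A' -/A; field.
by rewrite cT mul_mx_scalar mxtraceZ trJ mulr0 oppr0.
Qed.

End Involution.

Lemma killing_trace X Y : \tr X = 0 -> \tr Y = 0 ->
  \sum_x \tr ((X *m (Y *m e x - e x *m Y) - (Y *m e x - e x *m Y) *m X) *m e x)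
  = - (2%:R * n%:R) * \tr (X *m Y).
Proof.
move=> X0 Y0.
have E x : \tr ((X *m (Y *m e x - e x *m Y) - (Y *m e x - e x *m Y) *m X) *m e x)
  = \tr (e x *m 1%:M *m e x *m (X *m Y)) - \tr (e x *m Y *m e x *m X)
   - \tr (e x *m X *m e x *m Y) + \tr (e x *m (Y *m X) *m e x *m 1%:M).
  rewrite !mulmx1 !(mulmxBl, mulmxBr) !raddfB /= !mulmxA.
  have -> : \tr (X *m Y *m e x *m e x) = \tr (e x *m e x *m X *m Y) by trace_rot.
  have -> : \tr (X *m e x *m Y *m e x) = \tr (e x *m Y *m e x *m X) by trace_rot.
  have -> : \tr (Y *m e x *m X *m e x) = \tr (e x *m X *m e x *m Y) by trace_rot.
  ring.
under eq_bigr => x _ do rewrite E.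
rewrite big_split /= !sumrB !(fierz_tr2 fierz) !mul1mx mulmx1 mxtrace1 X0 Y0.
by rewrite [\tr (Y *m X)]mxtrace_mulC; field; exact: nF.
Qed.

(** The resolvent identity as a distance estimate: the right-hand side is small when h nearly solves
    the linearized equation, since the trace of cM h is then small as well. *)
Lemma kernel_defect h (q := n%:R ^+ 2 - 4%:R) (g := n%:R *: h - Lam 1%:M h) :
  h^T = h -> q != 0 ->
  h - kZ (- (2%:R * n%:R / q) *: traceless (cM h)) =
  q^-1 *: ((- 2%:R * \tr (cM h)) *: 1%:M + n%:R *: g + - 2%:R *: nest g).
Proof.
move=> hs q0; have res := resolvent n_gt0 tr_e fierz orth_e hs.
have KE : Kmx (cM h) = Kmx (traceless (cM h)) + (\tr (cM h) / n%:R * - 2%:R) *: 1%:M.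
  by rewrite -scalerA -(Kmx1 orth_e) -KmxZ -KmxD scalemx1 subrK.
apply: (scalerI q0); rewrite scalerBr {1}/q res -/g KE /kZ KmxZ.
apply/matrixP => u v; rewrite !(addmxE, oppmxE, scalemxE).
by field; rewrite q0 nF.
Qed.

Lemma adm_anti x i j : adm e x i j = - adm e i x j.
Proof.
rewrite !admE opprK !mulmxBr !raddfB /=.
have -> : \tr (e i *m (e x *m e j)) = \tr (e x *m (e j *m e i)) by trace_rot.
have -> : \tr (e i *m (e j *m e x)) = \tr (e x *m (e i *m e j)) by trace_rot.
ring.
Qed.

Lemma adm_skew x : (adm e x)^T = - adm e x.
Proof.
apply/matrixP => i j; rewrite mxE oppmxE !admE opprK !mulmxBr !raddfB /=.
have -> : \tr (e i *m (e x *m e j)) = \tr (e j *m (e i *m e x)) by trace_rot.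
have -> : \tr (e i *m (e j *m e x)) = \tr (e j *m (e x *m e i)) by trace_rot.
ring.
Qed.

End Obstruction.

(** * The entrywise norm *)

Section SumNorm.
Variables (R : numDomainType) (N : nat).
Implicit Types A B : 'M[R]_N.

(** This norm is submultiplicative, and one definition serves real and complex matrices. *)
Definition nrm A : R := \sum_i \sum_j `|A i j|.

Lemma nrm_ge0 A : 0 <= nrm A.
Proof. by apply: sumr_ge0 => i _; apply: sumr_ge0. Qed.

Lemma ler_entry_nrm A i j : `|A i j| <= nrm A.
Proof.
rewrite /nrm (bigD1 i) //= (bigD1 j) //= -addrA lerDl addr_ge0 //.
  by apply: sumr_ge0.
by apply: sumr_ge0 => k _; apply: sumr_ge0.
Qed.

Lemma nrm0_eq0 A : nrm A = 0 -> A = 0.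
Proof.
move=> A0; apply/matrixP => i j; rewrite mxE; apply/eqP.
by rewrite -normr_eq0 eq_le normr_ge0 andbT -A0 ler_entry_nrm.
Qed.

Lemma nrmD A B : nrm (A + B) <= nrm A + nrm B.
Proof.
rewrite -big_split; apply: ler_sum => i _ /=; rewrite -big_split.
by apply: ler_sum => j _ /=; rewrite addmxE ler_normD.
Qed.

Lemma nrmZ a A : nrm (a *: A) = `|a| * nrm A.
Proof.
rewrite mulr_sumr; apply: eq_bigr => i _; rewrite mulr_sumr.
by apply: eq_bigr => j _; rewrite scalemxE normrM.
Qed.

Lemma nrmN A : nrm (- A) = nrm A.
Proof. by rewrite -scaleN1r nrmZ normrN1 mul1r. Qed.

Lemma nrmM A B : nrm (A *m B) <= nrm A * nrm B.
Proof.
rewrite mulr_suml; apply: ler_sum => i _.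
rewrite mulr_suml; apply: le_trans (_ : \sum_k \sum_j `|A i j * B j k| <= _).
  by apply: ler_sum => k _; rewrite mxE ler_norm_sum.
rewrite exchange_big; apply: ler_sum => j _ /=.
under eq_bigr do rewrite normrM.
rewrite -mulr_sumr ler_wpM2l // /nrm [leRHS](bigD1 j) //= lerDl.
by apply: sumr_ge0 => l _; apply: sumr_ge0.
Qed.

Lemma nrm_tr A : `|\tr A| <= nrm A.
Proof.
apply: le_trans (ler_norm_sum _ _ _) _; apply: ler_sum => i _.
by rewrite (bigD1 i) //= lerDl sumr_ge0.
Qed.

Variable a : 'I_N -> 'M[R]_N.
Definition LamC : R := \sum_x \sum_y nrm (a x) * nrm (a y)^T.

Lemma LamC_ge0 : 0 <= LamC.
Proof. by apply: sumr_ge0 => x _; apply: sumr_ge0 => y _; rewrite mulr_ge0 ?nrm_ge0. Qed.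

Lemma nrm_Lam U V : nrm (Lam a U V) <= LamC * (nrm U * nrm V).
Proof.
rewrite mulr_suml; apply: ler_sum => x _.
rewrite mulr_suml; apply: ler_sum => y _.
rewrite LamE; apply: le_trans (nrm_tr _) _.
apply: le_trans (nrmM _ _) _.
have -> : nrm (a x) * nrm (a y)^T * (nrm U * nrm V)
        = nrm (a x) * nrm U * nrm (a y)^T * nrm V by ring.
rewrite ler_wpM2r ?nrm_ge0 //.
apply: le_trans (nrmM _ _) _; rewrite ler_wpM2r ?nrm_ge0 //; exact: nrmM.
Qed.

End SumNorm.

(** * Taylor expansions with uniform remainder *)

(** Third-order expansions in ep of families of matrices, uniform in a parameter i with D i: all
    coefficients may depend on i but are bounded, and so is the remainder. The uniformity replaces
    a compactness argument. *)
Section Jets.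
Variables (R : realFieldType) (N : nat) (I : Type) (D : I -> Prop) (ep : I -> R).
Hypothesis ep01 : forall i, D i -> 0 <= ep i <= 1.
Implicit Types f g : I -> 'M[R]_N.

Definition bnd f := exists C, forall i, D i -> nrm (f i) <= C.

Lemma bnd_cst M : bnd (fun=> M).
Proof. by exists (nrm M). Qed.

Lemma bndD f g : bnd f -> bnd g -> bnd (fun i => f i + g i).
Proof.
move=> [C hC] [K hK]; exists (C + K) => i Di.
by apply: le_trans (nrmD _ _) _; apply: lerD; [exact: hC|exact: hK].
Qed.

Lemma bndZ k f : bnd f -> bnd (fun i => k *: f i).
Proof.
by move=> [C hC]; exists (`|k| * C) => i Di; rewrite nrmZ ler_wpM2l // hC.
Qed.

Lemma bnd_ep f : bnd f -> bnd (fun i => ep i *: f i).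
Proof.
move=> [C hC]; exists C => i Di; have /andP[e0 e1] := ep01 Di.
by rewrite nrmZ ger0_norm //; apply: le_trans (hC i Di); rewrite ler_piMl ?nrm_ge0.
Qed.

Record jet f c0 c1 c2 c3 : Prop := Jet {
  jet_c0 : bnd c0; jet_c1 : bnd c1; jet_c2 : bnd c2; jet_c3 : bnd c3;
  jet_rem : exists2 r, bnd r & forall i, D i ->
    f i = c0 i + ep i *: c1 i + ep i ^+ 2 *: c2 i + ep i ^+ 3 *: c3 i
          + ep i ^+ 4 *: r i }.

Lemma jet_ext f c0 c1 c2 c3 d0 d1 d2 d3 : jet f c0 c1 c2 c3 ->
  (forall i, D i -> [/\ c0 i = d0 i, c1 i = d1 i, c2 i = d2 i & c3 i = d3 i]) ->
  jet f d0 d1 d2 d3.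
Proof.
move=> [[C0 h0] [C1 h1] [C2 h2] [C3 h3] [r br fr]] cd; split.
- by exists C0 => i Di; have [<- _ _ _] := cd i Di; apply: h0.
- by exists C1 => i Di; have [_ <- _ _] := cd i Di; apply: h1.
- by exists C2 => i Di; have [_ _ <- _] := cd i Di; apply: h2.
- by exists C3 => i Di; have [_ _ _ <-] := cd i Di; apply: h3.
by exists r => // i Di; have [<- <- <- <-] := cd i Di; apply: fr.
Qed.

Lemma jet_eq f g c0 c1 c2 c3 : jet f c0 c1 c2 c3 -> (forall i, D i -> f i = g i) ->
  jet g c0 c1 c2 c3.
Proof.
move=> [h0 h1 h2 h3 [r br fr]] fg; split=> //.
by exists r => // i Di; rewrite -fg // fr.
Qed.

Lemma jetD f g c0 c1 c2 c3 d0 d1 d2 d3 : jet f c0 c1 c2 c3 -> jet g d0 d1 d2 d3 ->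
  jet (fun i => f i + g i) (fun i => c0 i + d0 i) (fun i => c1 i + d1 i)
    (fun i => c2 i + d2 i) (fun i => c3 i + d3 i).
Proof.
move=> [h0 h1 h2 h3 [r br fr]] [k0 k1 k2 k3 [s bs gs]]; split; try exact: bndD.
exists (fun i => r i + s i) => [|i Di]; first exact: bndD.
rewrite fr // gs //; apply/matrixP => u v; rewrite !(addmxE, scalemxE); ring.
Qed.

Lemma jetZ k f c0 c1 c2 c3 : jet f c0 c1 c2 c3 ->
  jet (fun i => k *: f i) (fun i => k *: c0 i) (fun i => k *: c1 i)
    (fun i => k *: c2 i) (fun i => k *: c3 i).
Proof.
move=> [h0 h1 h2 h3 [r br fr]]; split; try exact: bndZ.
exists (fun i => k *: r i) => [|i Di]; first exact: bndZ.
rewrite fr //; apply/matrixP => u v; rewrite !(addmxE, scalemxE); ring.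
Qed.

Lemma jet_poly c0 c1 c2 : bnd c0 -> bnd c1 -> bnd c2 ->
  jet (fun i => c0 i + ep i *: c1 i + ep i ^+ 2 *: c2 i) c0 c1 c2 (fun=> 0).
Proof.
move=> h0 h1 h2; split=> //; first exact: bnd_cst.
by exists (fun=> 0) => [|i _]; [exact: bnd_cst | rewrite !scaler0 !addr0].
Qed.

Section Bilinear.
Variables (b : 'M[R]_N -> 'M[R]_N -> 'M[R]_N) (K : R).
Hypothesis bDl : forall U V W, b (U + V) W = b U W + b V W.
Hypothesis bDr : forall U V W, b U (V + W) = b U V + b U W.
Hypothesis bZl : forall k U V, b (k *: U) V = k *: b U V.
Hypothesis bZr : forall k U V, b U (k *: V) = k *: b U V.
Hypothesis bK : forall U V, nrm (b U V) <= K * (nrm U * nrm V).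
Hypothesis K0 : 0 <= K.

Lemma bnd_bil f g : bnd f -> bnd g -> bnd (fun i => b (f i) (g i)).
Proof.
move=> [C hC] [E hE]; exists (K * (C * E)) => i Di.
apply: le_trans (bK _ _) _; rewrite ler_wpM2l //.
by apply: ler_pM; rewrite ?nrm_ge0 ?hC ?hE.
Qed.

(** In the remainder, the terms of order five and more carry additional factors ep, which are at
    most one. *)
Lemma jet_bil f g c0 c1 c2 c3 d0 d1 d2 d3 :
  jet f c0 c1 c2 c3 -> jet g d0 d1 d2 d3 ->
  jet (fun i => b (f i) (g i))
    (fun i => b (c0 i) (d0 i))
    (fun i => b (c0 i) (d1 i) + b (c1 i) (d0 i))
    (fun i => b (c0 i) (d2 i) + b (c1 i) (d1 i) + b (c2 i) (d0 i))
    (fun i => b (c0 i) (d3 i) + b (c1 i) (d2 i) + b (c2 i) (d1 i) + b (c3 i) (d0 i)).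
Proof.
move=> [h0 h1 h2 h3 [r br fr]] [k0 k1 k2 k3 [s bs gs]].
split; do ?[apply: bndD | apply: bnd_bil] => //.
exists (fun i =>
  (b (c0 i) (s i) + b (c1 i) (d3 i) + b (c2 i) (d2 i) + b (c3 i) (d1 i) + b (r i) (d0 i))
  + ep i *: ((b (c1 i) (s i) + b (c2 i) (d3 i) + b (c3 i) (d2 i) + b (r i) (d1 i))
  + ep i *: ((b (c2 i) (s i) + b (c3 i) (d3 i) + b (r i) (d2 i))
  + ep i *: ((b (c3 i) (s i) + b (r i) (d3 i)) + ep i *: b (r i) (s i))))) => [|i Di].
  do ?[apply: bndD | apply: bnd_ep | apply: bnd_bil] => //.
rewrite fr // gs // !(bDl, bDr, bZl, bZr).
apply/matrixP => u v; rewrite !(addmxE, scalemxE); ring.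
Qed.

End Bilinear.

Lemma jet_mul f g c0 c1 c2 c3 d0 d1 d2 d3 :
  jet f c0 c1 c2 c3 -> jet g d0 d1 d2 d3 ->
  jet (fun i => f i *m g i)
    (fun i => c0 i *m d0 i)
    (fun i => c0 i *m d1 i + c1 i *m d0 i)
    (fun i => c0 i *m d2 i + c1 i *m d1 i + c2 i *m d0 i)
    (fun i => c0 i *m d3 i + c1 i *m d2 i + c2 i *m d1 i + c3 i *m d0 i).
Proof.
apply: (@jet_bil _ 1) => [U V W|U V W|k U V|k U V|U V|//].
- exact: mulmxDl.
- exact: mulmxDr.
- by rewrite scalemxAl.
- by rewrite scalemxAr.
by rewrite mul1r nrmM.
Qed.

Lemma jet_Lam a f g c0 c1 c2 c3 d0 d1 d2 d3 :
  jet f c0 c1 c2 c3 -> jet g d0 d1 d2 d3 ->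
  jet (fun i => Lam a (f i) (g i))
    (fun i => Lam a (c0 i) (d0 i))
    (fun i => Lam a (c0 i) (d1 i) + Lam a (c1 i) (d0 i))
    (fun i => Lam a (c0 i) (d2 i) + Lam a (c1 i) (d1 i) + Lam a (c2 i) (d0 i))
    (fun i => Lam a (c0 i) (d3 i) + Lam a (c1 i) (d2 i) + Lam a (c2 i) (d1 i)
              + Lam a (c3 i) (d0 i)).
Proof.
apply: (@jet_bil _ (LamC a)) => [U V W|U V W|k U V|k U V|U V|].
- exact: LamDl.
- exact: LamDr.
- exact: LamZl.
- exact: LamZr.
- exact: nrm_Lam.
exact: LamC_ge0.
Qed.

End Jets.

(** * The Einstein equation along a curve of metrics *)

Section Expansion.
Variables (R : realFieldType) (N : nat) (a : 'I_N -> 'M[R]_N) (m : R).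
Hypothesis a_anti : forall x i j, a x i j = - a i x j.
Hypothesis a_skew : forall x, (a x)^T = - a x.
Hypothesis Lam11 : Lam a 1%:M 1%:M = (2%:R * m) *: 1%:M.
Local Notation Lam := (Lam a).

Lemma Lam_sym U V : U^T = U -> V^T = V -> Lam U V = Lam V U.
Proof.
move=> US VS; apply/matrixP => x y; rewrite !LamE !a_skew !(mulmxN, mulNmx) !raddfN /=.
rewrite -[in LHS]mxtrace_tr !trmx_mul US VS !a_skew !(mulmxN, mulNmx) opprK; congr (- _); trace_rot.
Qed.

(** Four times the Ricci tensor minus 2 m times the metric with Gram matrix A, when P is its inverse
    (ricci_formula and Lam11); the factor 2 m makes A = 1 a solution. *)
Definition einstein_op A P : 'M[R]_N :=
  (4%:R * m) *: 1%:M - 2%:R *: Lam P A + A *m Lam P P *m A - (2%:R * m) *: A.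

(** The coefficients of t, t ^ 2 and t ^ 3 in einstein_op at A = 1 + t S + t ^ 2 B. *)
Definition ein1 S := 2%:R *: (m *: S - Lam 1%:M S).
Definition ein2 S B := ein1 B + 3%:R *: Lam S S + (2%:R * m) *: (S *m S)
  - 2%:R *: (S *m Lam 1%:M S + Lam 1%:M S *m S).
Definition ein3 S B (Q := S *m S - B) :=
  2%:R *: Lam S B - 4%:R *: Lam S Q
  + (S *m (2%:R *: Lam 1%:M Q + Lam S S) + (2%:R *: Lam 1%:M Q + Lam S S) *m S)
  - 2%:R *: (B *m Lam 1%:M S + Lam 1%:M S *m B)
  - 2%:R *: (S *m Lam 1%:M S *m S)
  + (2%:R * m) *: (S *m B + B *m S).

Section Family.
Variables (I : Type) (D : I -> Prop) (ep : I -> R) (S B P : I -> 'M[R]_N).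
Hypothesis ep01 : forall i, D i -> 0 <= ep i <= 1.
Hypothesis SS : forall i, D i -> (S i)^T = S i.
Hypothesis BS : forall i, D i -> (B i)^T = B i.
Hypothesis bS : bnd D S.
Hypothesis bB : bnd D B.
Hypothesis bP : bnd D P.
Let A i := 1%:M + ep i *: S i + ep i ^+ 2 *: B i.
Hypothesis AP : forall i, D i -> A i *m P i = 1%:M.

Local Notation jet := (jet D ep).

(** With H = A - 1, the exact identity P = 1 - H + H ^ 2 - H ^ 3 + H ^ 4 P ends the Neumann series
    with a remainder that is bounded because P is. *)
Lemma jet_inv : jet P (fun=> 1%:M) (fun i => - S i) (fun i => S i *m S i - B i)
  (fun i => S i *m B i + B i *m S i - S i *m S i *m S i).
Proof.
pose z0 := fun _ : I => 0 : 'M[R]_N; pose z1 := fun _ : I => 1%:M : 'M[R]_N.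
have b0 : bnd D z0 by exact: bnd_cst.
have b1 : bnd D z1 by exact: bnd_cst.
pose H i := z0 i + ep i *: S i + ep i ^+ 2 *: B i.
have jH : jet H z0 S B z0 by exact: jet_poly.
have jP : jet (fun i => P i + ep i *: z0 i + ep i ^+ 2 *: z0 i) P z0 z0 z0.
  exact: jet_poly.
have j1 : jet (fun i => z1 i + ep i *: z0 i + ep i ^+ 2 *: z0 i) z1 z0 z0 z0.
  exact: jet_poly.
have PH i : D i -> P i = 1%:M - H i *m P i.
  move=> Di; have := AP Di; rewrite /A /H /z0 add0r -addrA mulmxDl mul1mx => <-.
  by rewrite addrK.
have H2 := jet_mul ep01 jH jH.
have H3 := jet_mul ep01 H2 jH.
have H4 := jet_mul ep01 H3 jH.
have HP := jet_mul ep01 H4 jP.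
have J := jetD (jetD (jetD (jetD j1 (jetZ (-1) jH)) H2) (jetZ (-1) H3)) HP.
have /jet_ext := J; move/(_ (fun=> 1%:M) (fun i => - S i) (fun i => S i *m S i - B i)
  (fun i => S i *m B i + B i *m S i - S i *m S i *m S i)) => J'.
apply: (jet_eq (f := fun i => z1 i + ep i *: z0 i + ep i ^+ 2 *: z0 i + -1 *: H i +
  H i *m H i + -1 *: (H i *m H i *m H i) + H i *m H i *m H i *m H i *m
  (P i + ep i *: z0 i + ep i ^+ 2 *: z0 i))).
  apply: J' => i Di; rewrite /z0 /z1.
  rewrite !(mul0mx, mulmx0, addr0, add0r, scaler0, scaleN1r, oppr0).
  by split=> //; rewrite addrC.
move=> i Di; rewrite /z0 !scaler0 !addr0 /z1 !scaleN1r.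
have HPE : H i *m P i = 1%:M - P i by rewrite {2}(PH i Di) opprB addrC subrK.
rewrite -!mulmxA !(HPE, mulmxBr, mulmx1).
apply/matrixP => u v; rewrite !(addmxE, oppmxE); ring.
Qed.

Lemma einstein_jet : exists2 r,
  [/\ bnd D (fun i => ein2 (S i) (B i)), bnd D (fun i => ein3 (S i) (B i)) & bnd D r] &
  forall i, D i -> einstein_op (A i) (P i) =
    ep i *: ein1 (S i) + ep i ^+ 2 *: ein2 (S i) (B i)
    + ep i ^+ 3 *: ein3 (S i) (B i) + ep i ^+ 4 *: r i.
Proof.
pose z0 := fun _ : I => 0 : 'M[R]_N; pose z1 := fun _ : I => 1%:M : 'M[R]_N.
have b0 : bnd D z0 by exact: bnd_cst.
have b1 : bnd D z1 by exact: bnd_cst.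
have jA : jet A z1 S B z0 by exact: jet_poly.
have j1 : jet (fun i => z1 i + ep i *: z0 i + ep i ^+ 2 *: z0 i) z1 z0 z0 z0.
  exact: jet_poly.
have jP := jet_inv.
have jE := jetD (jetD (jetD (jetZ (4%:R * m) j1) (jetZ (-2%:R) (jet_Lam ep01 a jP jA)))
  (jet_mul ep01 (jet_mul ep01 jA (jet_Lam ep01 a jP jP)) jA)) (jetZ (- (2%:R * m)) jA).
pose c1 i := ein1 (S i); pose c2 i := ein2 (S i) (B i); pose c3 i := ein3 (S i) (B i).
have /(_ z0 c1 c2 c3) jE' := jet_ext jE.
case: jE' => [i Di|_ _ bc2 bc3 [r br fr]].
  rewrite /z0 /z1 /c1 /c2 /c3.
  have L0r U : Lam U 0 = 0 by have := LamZr a 0 U 0; rewrite !scale0r.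
  have L0l U : Lam 0 U = 0 by have := LamZl a 0 0 U; rewrite !scale0r.
  have LN U V : Lam (- U) V = - Lam U V by rewrite -scaleN1r LamZl scaleN1r.
  have LNr U V : Lam U (- V) = - Lam U V by rewrite -scaleN1r LamZr scaleN1r.
  have S1 : Lam (S i) 1%:M = Lam 1%:M (S i) by rewrite Lam_sym ?SS ?trmx1.
  have Q1 : Lam (S i *m S i) 1%:M = Lam 1%:M (S i *m S i).
    by rewrite Lam_sym ?trmx1 // trmx_mul SS.
  have B1 : Lam (B i) 1%:M = Lam 1%:M (B i) by rewrite Lam_sym ?BS ?trmx1.
  have Q2 : Lam (S i *m S i) (S i) = Lam (S i) (S i *m S i).
    by rewrite Lam_sym ?SS // trmx_mul SS.
  have Q3 : Lam (B i) (S i) = Lam (S i) (B i) by rewrite Lam_sym ?SS ?BS.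
  have T1 : Lam (S i *m B i) 1%:M + Lam (B i *m S i) 1%:M
      = Lam 1%:M (S i *m B i) + Lam 1%:M (B i *m S i).
    by rewrite -LamDl Lam_sym ?trmx1 ?LamDr // raddfD /= !trmx_mul SS // BS // addrC.
  have T2 : Lam (S i *m S i *m S i) 1%:M = Lam 1%:M (S i *m S i *m S i).
    by rewrite Lam_sym ?trmx1 // !trmx_mul SS // mulmxA.
  rewrite !(mul0mx, mulmx0, addr0, add0r, scaler0, L0r, L0l, oppr0, mul1mx, mulmx1).
  rewrite /ein1 /ein2 /ein3.
  split.
  - rewrite Lam11; apply/matrixP => u v; rewrite !(addmxE, oppmxE, scalemxE) [RHS]mxE; ring.
  - rewrite !LN !LNr Lam11 S1 -scalemxAl -scalemxAr mulmx1 mul1mx.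
    apply/matrixP => u v; rewrite !(addmxE, oppmxE, scalemxE); ring.
  - rewrite !(LN, LNr, LamDl, LamDr) Q1 B1 S1 Lam11 -!(scalemxAl, scalemxAr).
    rewrite !(mulmxDr, mulmxDl, mulmxN, mulNmx, mulmx1, mul1mx) -!(scalemxAl, scalemxAr).
    apply/matrixP => u v; rewrite !(addmxE, oppmxE, scalemxE). ring.
  - have T1' : Lam (S i *m B i) 1%:M =
        Lam 1%:M (S i *m B i) + Lam 1%:M (B i *m S i) - Lam (B i *m S i) 1%:M.
      by rewrite -T1 addrK.
    rewrite !(LN, LNr, LamDl, LamDr) T2 T1' Q1 Q2 Q3 B1 S1 Lam11.
    rewrite !(mulmxDr, mulmxDl, mulmxN, mulNmx) -!(scalemxAl, scalemxAr).
    rewrite !(mulmxDr, mulmxDl, mulmxN, mulNmx, mulmx1, mul1mx, mulmxA).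
    rewrite -?scalemxAl ?mul1mx -?scalemxAl.
    apply/matrixP => u v; rewrite !(addmxE, oppmxE, scalemxE). ring.
exists r => [|i Di]; first by split.
rewrite /einstein_op.
have := fr i Di; rewrite /z0 /z1 /c1 /c2 /c3 !scaler0 !addr0 add0r.
by rewrite !scaleNr.
Qed.

End Family.

(** The jets are taken over all admissible quadruples (t, S, B, P) at once, so that de and K depend
    only on C. *)
Lemma einstein_expansion (C : R) : 0 <= C -> exists de K, [/\ 0 < de, 0 <= K &
  forall (t : R) S B P, 0 < t <= de -> S^T = S -> B^T = B -> nrm S <= C -> nrm B <= C ->
    (1%:M + t *: S + t ^+ 2 *: B) *m P = 1%:M ->
    einstein_op (1%:M + t *: S + t ^+ 2 *: B) P = 0 ->
  exists r, [/\ nrm r <= K, nrm (ein2 S B) <= K, nrm (ein3 S B) <= K &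
    ein1 S + t *: ein2 S B + t ^+ 2 *: ein3 S B + t ^+ 3 *: r = 0]].
Proof.
move=> C0.
pose I := (R * 'M[R]_N * 'M[R]_N * 'M[R]_N)%type.
pose ep (i : I) := i.1.1.1; pose S (i : I) := i.1.1.2.
pose B (i : I) := i.1.2; pose P (i : I) := i.2.
(* For t <= de the norm of t S + t ^ 2 B is at most 1/2, which bounds the inverse P. *)
pose de := (4%:R * C + 1)^-1.
have de0 : 0 < de by rewrite invr_gt0; lra.
have de1 : de <= 1 by rewrite invf_le1; lra.
have deC : C * de <= 4%:R^-1.
  rewrite /de ler_pdivrMr; lra.
pose D i := [/\ 0 < ep i <= de, (S i)^T = S i /\ (B i)^T = B i, nrm (S i) <= C /\ nrm (B i) <= C &
   (1%:M + ep i *: S i + ep i ^+ 2 *: B i) *m P i = 1%:M].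
have ep01 i : D i -> 0 <= ep i <= 1.
  by case=> /andP[e0 e1] _ _ _; rewrite ltW //= (le_trans e1).
have bS : bnd D S by exists C => i [_ _ []].
have bB : bnd D B by exists C => i [_ _ []].
have bP : bnd D P.
  exists (2%:R * nrm (1%:M : 'M[R]_N)) => i [/andP[e0 e1] _ [sC bC] AP].
  set p := nrm (P i).
  have PE : P i = 1%:M - (ep i *: S i + ep i ^+ 2 *: B i) *m P i.
    by rewrite -AP -addrA mulmxDl mul1mx addrK.
  have H : nrm (ep i *: S i + ep i ^+ 2 *: B i) <= 2%:R^-1.
    apply: le_trans (nrmD _ _) _; rewrite !nrmZ !ger0_norm ?exprn_ge0 ?(ltW e0) //.
    have h1 : ep i * nrm (S i) <= de * C by apply: ler_pM; rewrite ?nrm_ge0 ?(ltW e0).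
    have h2 : ep i ^+ 2 * nrm (B i) <= de * C.
      apply: ler_pM; rewrite ?nrm_ge0 ?exprn_ge0 ?(ltW e0) //.
      have e11 : ep i <= 1 by exact: le_trans e1 de1.
      by rewrite expr2; apply: le_trans e1; apply: ler_piMl; first exact: ltW.
    move: deC; rewrite mulrC => deC; lra.
  have : p <= nrm (1%:M : 'M[R]_N) + 2%:R^-1 * p.
    rewrite {1}/p PE; apply: le_trans (nrmD _ _) _; rewrite lerD2l nrmN.
    by apply: le_trans (nrmM _ _) _; rewrite ler_wpM2r ?nrm_ge0.
  lra.
have [|||r [[K2 b2] [K3 b3] [K br]] E] := @einstein_jet I D ep S B P ep01 _ _ bS bB bP.
- by move=> i [_ []].
- by move=> i [_ []].
- by move=> i [].
pose K' := `|K2| + `|K3| + `|K|.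
exists de, K'; split=> //; first by rewrite !addr_ge0.
move=> t S' B' P' tde S's B's S'C B'C AP Ein.
pose i : I := (t, S', B', P').
have Di : D i by [].
exists (r i); split.
- apply: le_trans (br i Di) _; apply: le_trans (ler_norm _) _.
  by rewrite /K' lerDr addr_ge0.
- apply: le_trans (b2 i Di) _; apply: le_trans (ler_norm _) _.
  by rewrite /K' -addrA lerDl addr_ge0.
- apply: le_trans (b3 i Di) _; apply: le_trans (ler_norm _) _.
  by rewrite /K' addrAC lerDr addr_ge0.
have := E i Di; rewrite Ein /ep /S /B /P /= => /esym E'.
have t0 : t != 0 by case/andP: tde => /lt0r_neq0.
apply: (scalerI t0); rewrite scaler0 -[RHS]E'.
apply/matrixP => u v; rewrite !(addmxE, scalemxE); ring.
Qed.

Lemma tr_Lam U V W : \tr (U *m Lam V W) = \tr (W *m Lam V U).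
Proof. exact: Lam_swap. Qed.

(** The hypotheses on S, Q and W are those of kZ J, its square and WJ. The second-order coefficient
    2 (m B - Lam 1 B) + m Q is O(t). Its trace against W is an affine function of tr (Q B), which is
    thereby determined up to O(t). Its trace against S is zero whatever B is, so the trace of the
    third-order coefficient against S is also O(t). But up to O(t) the latter trace is
    2 m (tr (Q B) - tr Q), a nonzero constant. *)
Lemma third_order_obstruction (C : R) : 0 <= C -> 3%:R <= m -> exists de, 0 < de /\
  forall (t : R) S B P W (Q := S *m S), 0 < t <= de -> S^T = S -> B^T = B ->
    nrm S <= C -> nrm B <= C -> nrm W <= C ->
    (1%:M + t *: S + t ^+ 2 *: B) *m P = 1%:M ->
    einstein_op (1%:M + t *: S + t ^+ 2 *: B) P = 0 ->
    Lam 1%:M S = m *: S -> Lam S S = m *: Q -> \tr (S *m Q) = 0 ->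
    \tr (Q *m Q) = \tr Q -> \tr Q = (m ^+ 2 - 4%:R) / 2%:R ->
    \tr (Q *m Lam 1%:M Q) = m * \tr Q ->
    W^T = W -> m *: W - Lam 1%:M W = (- (m ^+ 2 - 4%:R) * m) *: Q ->
    \tr (W *m Q) = - 8%:R * \tr Q -> False.
Proof.
move=> C0 m3; have [de [K [de0 K0 H]]] := einstein_expansion C0.
(* t Z bounds the left-hand side of the identity key below. *)
pose Z := (m ^+ 2 - 4%:R) * (C * K + 4%:R * (C * C) * K) + 2%:R * C * K.
have Z0 : 0 <= Z.
  have : 0 <= m ^+ 2 - 4%:R by nra.
  by move=> ?; rewrite /Z !addr_ge0 ?mulr_ge0 // addr_ge0 ?mulr_ge0.
exists (Num.min de (Num.min 1 (Z + 1)^-1)); split.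
  by rewrite !lt_min de0 ltr01 invr_gt0 /=; lra.
move=> t S B P W Q /andP[t0]; rewrite !le_min => /and3P[tde t1 tZ] SS BS SC BC WC AP Ein L1 L2.
move=> tr0 trQQ trQ trQL WS WL trWQ.
have [|r [rK e2K e3K E]] := H t S B P _ SS BS SC BC AP Ein; first by rewrite t0.
have e10 : ein1 S = 0 by rewrite /ein1 L1 subrr scaler0.
rewrite e10 add0r in E.
have {}E : ein2 S B + t *: ein3 S B + t ^+ 2 *: r = 0.
  apply: (scalerI (lt0r_neq0 t0)); rewrite scaler0 -[RHS]E.
  apply/matrixP => u v; rewrite !(addmxE, scalemxE); ring.
have QS : Q^T = Q by rewrite trmx_mul SS.
have e2E : ein2 S B = 2%:R *: (m *: B - Lam 1%:M B) + m *: Q.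
  rewrite /ein2 /ein1 L2 L1 -scalemxAl -scalemxAr -/Q.
  apply/matrixP => u v; rewrite !(addmxE, oppmxE, scalemxE); ring.
pose G := 2%:R *: Lam 1%:M (Q - B) + m *: Q.
have e3E : ein3 S B = 2%:R *: Lam S B - 4%:R *: Lam S (Q - B) + (S *m G + G *m S)
   - (2%:R * m) *: (S *m Q).
  rewrite /ein3 L1 L2 -/Q -/G -!scalemxAl -!scalemxAr -scalemxAl -mulmxA -/Q.
  apply/matrixP => u v; rewrite !(addmxE, oppmxE, scalemxE); ring.
have trE X : \tr (X *m ein2 S B) + t * \tr (X *m ein3 S B) + t ^+ 2 * \tr (X *m r) = 0.
  have L Y1 Y2 Y3 : \tr (X *m (Y1 + t *: Y2 + t ^+ 2 *: Y3)) =
      \tr (X *m Y1) + t * \tr (X *m Y2) + t ^+ 2 * \tr (X *m Y3).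
    by rewrite !mulmxDr -!scalemxAr !mxtraceD !mxtraceZ.
  by rewrite -L E mulmx0 mxtrace0.
have trBnd X Y c k : nrm X <= c -> nrm Y <= k -> `|\tr (X *m Y)| <= c * k.
  move=> Xc Yk; apply: le_trans (nrm_tr _) _; apply: le_trans (nrmM _ _) _.
  by apply: ler_pM; rewrite ?nrm_ge0.
have tr2S : \tr (S *m ein2 S B) = 0.
  rewrite e2E mulmxDr -!scalemxAr mxtraceD !mxtraceZ mulmxBr raddfB /= -scalemxAr mxtraceZ.
  rewrite tr_Lam L1 -scalemxAr mxtraceZ tr0 [\tr (B *m S)]mxtrace_mulC subrr !mulr0 addr0.
  by [].
pose b := \tr (Q *m B).
have idA : \tr (S *m ein3 S B) = 2%:R * \tr (Q *m ein2 S B) + 2%:R * m * b - 2%:R * m * \tr Q.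
  have tr1 : \tr (S *m Lam S B) = m * b.
    by rewrite tr_Lam L2 -scalemxAr mxtraceZ [in LHS]mxtrace_mulC.
  have tr2 : \tr (S *m Lam S (Q - B)) = m * (\tr Q - b).
    by rewrite tr_Lam L2 -scalemxAr mxtraceZ [in LHS]mxtrace_mulC mulmxBr raddfB /= trQQ.
  have tr3 : \tr (Q *m G) = 2%:R * (m * \tr Q - \tr (Q *m Lam 1%:M B)) + m * \tr Q.
    have LB : Lam 1%:M (Q - B) = Lam 1%:M Q - Lam 1%:M B.
      by rewrite -scaleN1r LamDr LamZr scaleN1r.
    rewrite /G LB mulmxDr -!scalemxAr mxtraceD !mxtraceZ mulmxBr raddfB /=.
    by rewrite trQL trQQ.
  have tr4 : \tr (Q *m ein2 S B) = 2%:R * (m * b - \tr (Q *m Lam 1%:M B)) + m * \tr Q.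
    rewrite e2E mulmxDr -!scalemxAr mxtraceD !mxtraceZ mulmxBr raddfB /=.
    by rewrite -scalemxAr mxtraceZ trQQ.
  rewrite tr4 e3E mulmxBr mulmxDr mulmxBr -!scalemxAr raddfB /= mxtraceD raddfB /=.
  rewrite !mxtraceZ tr1 tr2 mulmxDr mxtraceD.
  have -> : \tr (S *m (G *m S)) = \tr (Q *m G) by rewrite mulmxA mxtrace_mulC mulmxA.
  by rewrite (mulmxA S S G) (mulmxA S S Q) -/Q tr3 trQQ; ring.
have idB : \tr (W *m ein2 S B) = - 2%:R * m * (m ^+ 2 - 4%:R) * b - 8%:R * m * \tr Q.
  have : \tr ((m *: W - Lam 1%:M W) *m B) = - (m ^+ 2 - 4%:R) * m * b.
    by rewrite WL -scalemxAl mxtraceZ.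
  rewrite mulmxBl -scalemxAl raddfB /= mxtraceZ.
  rewrite [\tr (Lam _ _ *m B)]mxtrace_mulC tr_Lam.
  move=> h; rewrite e2E mulmxDr -!scalemxAr mxtraceD !mxtraceZ mulmxBr raddfB /=.
  by rewrite -scalemxAr mxtraceZ h trWQ; ring.
have hX : `|\tr (S *m ein3 S B)| <= t * (C * K).
  have := trE S; rewrite tr2S add0r => h.
  have -> : \tr (S *m ein3 S B) = - (t * \tr (S *m r)).
    by apply: (mulfI (lt0r_neq0 t0)); move: h; lra.
  by rewrite normrN normrM gtr0_norm // ler_wpM2l ?(ltW t0) // trBnd.
have h2 X c : nrm X <= c -> `|\tr (X *m ein2 S B)| <= 2%:R * t * (c * K).
  move=> Xc; have h := trE X.
  have -> : \tr (X *m ein2 S B) = - (t * (\tr (X *m ein3 S B) + t * \tr (X *m r))).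
    by move: h; lra.
  rewrite normrN normrM gtr0_norm // -mulrA mulrCA ler_wpM2l ?(ltW t0) //.
  apply: le_trans (ler_normD _ _) _; rewrite mulr2n mulrDl mul1r lerD ?trBnd //.
  rewrite normrM gtr0_norm //; apply: le_trans (_ : 1 * `|\tr (X *m r)| <= _).
    by rewrite ler_wpM2r.
  by rewrite mul1r trBnd.
have QC : nrm Q <= C * C by apply: le_trans (nrmM _ _) _; apply: ler_pM; rewrite ?nrm_ge0.
have hY := h2 _ _ QC; have hV := h2 _ _ WC.
(* The unknown b cancels in this combination, and the left-hand side is O(t). *)
have key : (m ^+ 2 - 4%:R) * (\tr (S *m ein3 S B) - 2%:R * \tr (Q *m ein2 S B))
   + \tr (W *m ein2 S B) = - m ^+ 3 * (m ^+ 2 - 4%:R).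
  by rewrite idA idB trQ; field.
have tZ1 : t * Z < 1.
  have : t * (Z + 1) <= 1 by rewrite -ler_pdivlMr ?div1r //; lra.
  lra.
move: hX hY hV; rewrite !ler_norml => /andP[x1 x2] /andP[y1 y2] /andP[v1 v2].
have m24 : 5%:R <= m ^+ 2 - 4%:R by nra.
set X := \tr (S *m _) in x1 x2 key; set Y := \tr (Q *m _) in y1 y2 key.
set V := \tr (W *m _) in v1 v2 key.
have : (m ^+ 2 - 4%:R) * (- (t * (C * K)) - 2%:R * (2%:R * t * (C * C * K)))
   <= (m ^+ 2 - 4%:R) * (X - 2%:R * Y).
  by rewrite ler_wpM2l; lra.
have m31 : 1 <= m ^+ 3 by rewrite exprn_ege1 //; lra.
have : 1 <= m ^+ 3 * (m ^+ 2 - 4%:R) by rewrite mulr_ege1 //; lra.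
move: tZ1; rewrite /Z; lra.
Qed.

End Expansion.

(** * Real metrics and complex trace identities *)

Section NormBounds.
Variables (F : numFieldType) (n N : nat) (e : 'I_N -> 'M[F]_n).

Lemma nrm_sum k (I : finType) (f : I -> 'M[F]_k) : nrm (\sum_i f i) <= \sum_i nrm (f i).
Proof.
elim/big_ind2: _ => [|X1 x X2 y h1 h2|//].
  by rewrite /nrm big1 // => i _; rewrite big1 // => j _; rewrite mxE normr0.
by apply: le_trans (nrmD _ _) _; exact: lerD.
Qed.

Lemma nrm_cM G : nrm (cM e G) <= (\sum_x \sum_y nrm (e x *m e y)) * nrm G.
Proof.
apply: le_trans (nrm_sum _) _; rewrite mulr_suml; apply: ler_sum => x _.
apply: le_trans (nrm_sum _) _; rewrite mulr_suml; apply: ler_sum => y _.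
by rewrite nrmZ mulrC ler_wpM2l ?nrm_ge0 ?ler_entry_nrm.
Qed.

Lemma nrm_nest G :
  nrm (nest e G) <= (\sum_u \sum_v \sum_x \sum_y `|\tr (e x *m e u *m e y *m e v)|) * nrm G.
Proof.
rewrite mulr_suml; apply: ler_sum => u _; rewrite mulr_suml; apply: ler_sum => v _.
rewrite nestE; apply: le_trans (ler_norm_sum _ _ _) _.
rewrite mulr_suml; apply: ler_sum => x _; apply: le_trans (ler_norm_sum _ _ _) _.
rewrite mulr_suml; apply: ler_sum => y _; rewrite normrM mulrC.
by rewrite ler_wpM2l ?ler_entry_nrm.
Qed.

Lemma nrm_traceless (X : 'M[F]_n) : nrm (traceless X) <= (1 + nrm (1%:M : 'M[F]_n)) * nrm X.
Proof.
rewrite /traceless; apply: le_trans (nrmD _ _) _; rewrite nrmN mulrDl mul1r lerD2l.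
rewrite -scalemx1 nrmZ mulrC ler_wpM2l ?nrm_ge0 //.
rewrite normrM; apply: le_trans (_ : `|\tr X| * 1 <= _); last by rewrite mulr1 nrm_tr.
rewrite ler_wpM2l // normfV normr_nat.
have [->|n0] := posnP n; first by rewrite invr0 ler01.
by rewrite invf_le1 ?ltr0n // ler1n.
Qed.

Lemma nrm_kZ Z : nrm (kZ e Z) <= (\sum_x \sum_y nrm (e x *m e y + e y *m e x)) * nrm Z.
Proof.
rewrite mulr_suml; apply: ler_sum => x _; rewrite mulr_suml; apply: ler_sum => y _.
rewrite /kZ scalemxE normrM mxE mulrC.
apply: le_trans (_ : `|\tr (Z *m (e x *m e y + e y *m e x))| * 1 <= _).
  by rewrite ler_wpM2l // normrN ger0_norm ?invr_ge0 // invf_le1 // ler1n.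
rewrite mulr1 [leRHS]mulrC; apply: le_trans (nrm_tr _) _; exact: nrmM.
Qed.

End NormBounds.

Section RealForms.
Variable R : rcfType.
Local Notation rc := (real_complex R).

Lemma normc_real (x : R) : `|x|%:C = `|x%:C|.
Proof. by rewrite normc_def /= expr0n addr0 sqrtr_sqr. Qed.

Lemma nrm_rc N (M : 'M[R]_N) : nrm (map_mx rc M) = (nrm M)%:C.
Proof.
rewrite /nrm rmorph_sum; apply: eq_bigr => i _; rewrite rmorph_sum.
apply: eq_bigr => j _; rewrite mxE normc_def /= expr0n addr0.
by rewrite sqrtr_sqr.
Qed.

Lemma map_Lam N (a : 'I_N -> 'M[R]_N) U V :
  map_mx rc (Lam a U V) = Lam (fun x => map_mx rc (a x)) (map_mx rc U) (map_mx rc V).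
Proof.
by apply/matrixP => x y; rewrite mxE !LamE map_trmx -!map_mxM trace_map_mx.
Qed.

Lemma eq_Lam (F : comPzRingType) N (a b : 'I_N -> 'M[F]_N) U V :
  (forall x, a x = b x) -> Lam a U V = Lam b U V.
Proof. by move=> ab; apply/matrixP => x y; rewrite !LamE (ab x) (ab y). Qed.

Lemma tr_conj n (X : 'M[R[i]]_n) : (\tr X)^* = \tr (X^t*).
Proof. by rewrite rmorph_sum; apply: eq_bigr => i _; rewrite !mxE. Qed.

Lemma adjM n (X Y : 'M[R[i]]_n) : (X *m Y)^t* = Y^t* *m X^t*.
Proof. by rewrite trmx_mul map_mxM. Qed.

Lemma adjD n (X Y : 'M[R[i]]_n) : (X + Y)^t* = X^t* + Y^t*.
Proof. by rewrite raddfD /= map_mxD. Qed.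

Lemma adjN n (X : 'M[R[i]]_n) : (- X)^t* = - X^t*.
Proof. by rewrite raddfN /= map_mxN. Qed.

Lemma adjZ n k (X : 'M[R[i]]_n) : (k *: X)^t* = k^* *: X^t*.
Proof. by rewrite linearZ /= map_mxZ. Qed.

Lemma adj_sum n (I : finType) (f : I -> 'M[R[i]]_n) :
  (\sum_k f k)^t* = \sum_k (f k)^t*.
Proof.
apply/matrixP => i j; rewrite !mxE !summxE rmorph_sum.
by apply: eq_bigr => k _; rewrite !mxE.
Qed.

(** Metrics are real matrices, whereas the trace identities hold over R[i]. Hermitian data give
    forms with real entries, so re_mx loses nothing on them (re_mxK). *)
Definition re_mx N (X : 'M[R[i]]_N) : 'M[R]_N := map_mx (@complex.Re R) X.

Lemma re_mxK N (X : 'M[R[i]]_N) : (forall x y, (X x y)^* = X x y) ->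
  map_mx rc (re_mx X) = X.
Proof.
move=> XR; apply/matrixP => x y; rewrite !mxE; apply: RRe_real.
by apply/CrealP; exact: XR.
Qed.

Lemma rcK N (M : 'M[R]_N) : re_mx (map_mx rc M) = M.
Proof. by apply/matrixP => x y; rewrite !mxE. Qed.

Lemma re_mxD N (X Y : 'M[R[i]]_N) : re_mx (X + Y) = re_mx X + re_mx Y.
Proof. by apply/matrixP => x y; rewrite !mxE raddfD. Qed.

Lemma re_mxZ N k (X : 'M[R[i]]_N) : re_mx (k%:C *: X) = k *: re_mx X.
Proof.
apply/matrixP => x y; rewrite !mxE.
by case: (X x y) => u v /=; rewrite mul0r subr0.
Qed.

Lemma nrm_re_mx N (X : 'M[R[i]]_N) : (nrm (re_mx X))%:C <= nrm X.
Proof.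
rewrite /nrm rmorph_sum; apply: ler_sum => i _; rewrite rmorph_sum.
by apply: ler_sum => j _; rewrite mxE; exact: normc_ge_Re.
Qed.

End RealForms.

Lemma real_bound (R : rcfType) (c : R[i]) : 0 <= c -> exists2 K : R, 0 <= K & c = K%:C.
Proof.
move=> c0; have cE : (complex.Re c)%:C = c by rewrite RRe_real // ger0_real.
by exists (complex.Re c); rewrite // -(ler0c (complex.Re c)) cE.
Qed.

Section Frame.
Variables (R : rcfType) (n N : nat) (e : 'I_N -> 'M[R[i]]_n) (a : 'I_N -> 'M[R]_N).
Hypothesis n3 : (3 <= n)%N.
Hypothesis tr_e : forall x, \tr (e x) = 0.
Hypothesis fierz : forall X, \sum_x \tr (e x *m X) *: e x = (\tr X / n%:R)%:M - X.
Hypothesis orth_e : forall x y, \tr (e x *m e y) = - (x == y)%:R.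
Hypothesis e_skew : forall x, (e x)^t* = - e x.
Local Notation rc := (real_complex R).
Hypothesis aE : forall x, map_mx rc (a x) = adm e x.
Local Notation m := (n%:R : R).

Let n_gt0 : (0 < n)%N. Proof. exact: leq_trans n3. Qed.
Let m3 : 3%:R <= m. Proof. by rewrite ler_nat. Qed.
Let nC : (n%:R : R[i]) = m%:C. Proof. by rewrite rmorph_nat. Qed.

Lemma rc_inj N' : injective (map_mx rc : 'M[R]_N' -> 'M[R[i]]_N').
Proof. by move=> X Y /(congr1 (@re_mx R N')); rewrite !rcK. Qed.

Lemma rc_Lam U V : map_mx rc (Lam a U V) = Lam (adm e) (map_mx rc U) (map_mx rc V).
Proof. by rewrite map_Lam; exact: eq_Lam. Qed.

Lemma a_adm x i j : (a x i j)%:C = adm e x i j.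
Proof. by rewrite -aE mxE. Qed.

Lemma a_anti x i j : a x i j = - a i x j.
Proof.
have h1 := a_adm x i j.
have h2 := a_adm i x j.
apply: (@complexI R).
rewrite [LHS]h1.
rewrite [LHS](adm_anti e).
rewrite rmorphN /=.
by rewrite -h2.
Qed.

Lemma a_skew x : (a x)^T = - a x.
Proof. by apply: (@rc_inj N); rewrite -map_trmx map_mxN aE adm_skew. Qed.

Lemma Lam11 : Lam a 1%:M 1%:M = (2%:R * m) *: 1%:M.
Proof.
apply: (@rc_inj N); rewrite rc_Lam map_mxZ map_mx1 Lam_11 //.
by rewrite rmorphM /= !rmorph_nat.
Qed.

Definition kR Z : 'M[R]_N := re_mx (kZ e Z).

Lemma rc_kR Z : Z^t* = Z -> map_mx rc (kR Z) = kZ e Z.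
Proof.
move=> ZH; apply: re_mxK => x y; rewrite kZE rmorphM rmorphN fmorphV rmorph_nat.
congr (_ * _); rewrite [LHS]tr_conj adjM adjD !adjM ZH !e_skew.
rewrite !(mulmxN, mulNmx) -opprD mulNmx opprK.
rewrite !mulmxDl !mulmxDr !raddfD /= addrC.
by congr (_ + _); trace_rot.
Qed.

Lemma kR_sym Z : (kR Z)^T = kR Z.
Proof. by rewrite /kR /re_mx map_trmx kZT. Qed.

Lemma Lam_kR Z : Z^t* = Z -> \tr Z = 0 -> Lam a 1%:M (kR Z) = m *: kR Z.
Proof.
move=> ZH Z0; apply: (@rc_inj N); rewrite rc_Lam map_mxZ map_mx1 rc_kR //.
by rewrite (LamK1 n_gt0) // nC.
Qed.

Lemma nrm_cM_bound : exists2 K : R, 0 <= K & forall G, nrm (cM e G) <= K%:C * nrm G.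
Proof.
have [|K K0 KE] := @real_bound R (\sum_x \sum_y nrm (e x *m e y)).
  by apply: sumr_ge0 => x _; apply: sumr_ge0 => y _; exact: nrm_ge0.
by exists K => // G; rewrite -KE nrm_cM.
Qed.

Lemma nrm_nest_bound : exists2 K : R, 0 <= K & forall G, nrm (nest e G) <= K%:C * nrm G.
Proof.
have [|K K0 KE] := @real_bound R (\sum_u \sum_v \sum_x \sum_y
    `|\tr (e x *m e u *m e y *m e v)|).
  by do 4![apply: sumr_ge0 => ? _].
by exists K => // G; rewrite -KE nrm_nest.
Qed.

Lemma nrm_traceless_bound : exists2 K : R, 0 <= K &
  forall X : 'M[R[i]]_n, nrm (traceless X) <= K%:C * nrm X.
Proof.
have [|K K0 KE] := @real_bound R (1 + nrm (1%:M : 'M[R[i]]_n)).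
  by rewrite addr_ge0 ?nrm_ge0.
by exists K => // X; rewrite -KE nrm_traceless.
Qed.

Lemma nrm_kR_bound : exists2 K : R, 0 <= K &
  forall Z, (nrm (kR Z))%:C <= K%:C * nrm Z.
Proof.
have [|K K0 KE] := @real_bound R (\sum_x \sum_y nrm (e x *m e y + e y *m e x)).
  by apply: sumr_ge0 => x _; apply: sumr_ge0 => y _; exact: nrm_ge0.
exists K => // Z; rewrite -KE; apply: le_trans (nrm_re_mx _) _; exact: nrm_kZ.
Qed.

Lemma tr_cM G : \tr (cM e G) = - \tr G.
Proof.
rewrite -[cM e G]mulmx1 cM_tr /mxtrace -sumrN; apply: eq_bigr => x _.
rewrite (bigD1 x) //= [X in _ + X]big1 ?addr0 => [|y yx].
  by rewrite mulmx1 -/(mxtrace _) orth_e eqxx mulrN1.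
by rewrite mulmx1 -/(mxtrace _) orth_e eq_sym (negPf yx) oppr0 mulr0.
Qed.

Lemma cM_herm (S : 'M[R]_N) : S^T = S -> (cM e (map_mx rc S))^t* = cM e (map_mx rc S).
Proof.
move=> SS; have SE x y : S y x = S x y by rewrite -{1}SS mxE.
rewrite /cM adj_sum exchange_big /=; apply: eq_bigr => x _.
rewrite adj_sum; apply: eq_bigr => y _.
rewrite adjZ adjM !e_skew mulmxN mulNmx opprK !mxE SE.
by congr (_ *: _); exact: conjc_real.
Qed.

Local Notation ein1 := (ein1 a m).

(** The first-order step: S is as close to a form kR Z as the linear term of the equation at S is
    small. The matrix Z is the one that kernel_defect provides. *)
Lemma linear_normal_form : exists2 K : R, 0 <= K & forall S : 'M[R]_N, S^T = S ->
  exists Z, [/\ Z^t* = Z, \tr Z = 0, nrm (S - kR Z) <= K * nrm (ein1 S)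
               & nrm Z <= (K * nrm S)%:C].
Proof.
have [K1 K10 H1] := nrm_cM_bound; have [K2 K20 H2] := nrm_nest_bound.
have [K3 K30 H3] := nrm_traceless_bound.
set q := m ^+ 2 - 4%:R; have q1 : 1 <= q by rewrite /q; have := m3; nra.
pose K := K3 * K1 * (2%:R * m) + nrm (1%:M : 'M[R]_N) * 2%:R + m + K2 * 2%:R.
have m0 : 0 <= m by exact: ler0n.
have K0 : 0 <= K by rewrite /K !addr_ge0 ?mulr_ge0 ?nrm_ge0.
exists K => // S SS; pose M := cM e (map_mx rc S).
pose Z := (- (2%:R * m / q))%:C *: traceless M.
have MH : M^t* = M by exact: cM_herm.
have qE : (n%:R ^+ 2 - 4%:R : R[i]) = q%:C by rewrite /q rmorphB rmorphXn !rmorph_nat.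
have ZE : Z = - (2%:R * n%:R / (n%:R ^+ 2 - 4%:R)) *: traceless M.
  by rewrite qE /Z rmorphN rmorphM fmorphV rmorphM !rmorph_nat.
pose G := m *: S - Lam a 1%:M S.
have e1G : ein1 S = 2%:R *: G by [].
have rcG : map_mx rc G = n%:R *: map_mx rc S - Lam (adm e) 1%:M (map_mx rc S).
  by rewrite map_mxB map_mxZ rc_Lam map_mx1 rmorph_nat.
(* Lam 1 1 is scalar, so the trace of the linearized equation controls the trace of S. *)
have trS : \tr (ein1 S) = - (2%:R * m) * \tr S.
  rewrite mxtraceZ raddfB /= mxtraceZ.
  have -> : \tr (Lam a 1%:M S) = 2%:R * m * \tr S.
    rewrite -[Lam a _ _]mul1mx (tr_Lam a_anti) Lam11 -scalemxAr mulmx1.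
    by rewrite mxtraceZ.
  ring.
have trMS : \tr M = - (\tr S)%:C by rewrite tr_cM trace_map_mx.
have ZH : Z^t* = Z.
  rewrite adjZ; congr (_ *: _); first exact: conjc_real.
  rewrite /traceless adjD adjN MH; congr (_ - _).
  rewrite tr_scalar_mx map_scalar_mx /= trMS; congr (_%:M).
  rewrite nC -rmorphN -fmorphV -rmorphM /=; exact: conjc_real.
have Z0 : \tr Z = 0.
  rewrite mxtraceZ /traceless raddfB /= mxtrace_scalar -[(_ / _) *+ n]mulr_natr.
  rewrite divfK ?subrr ?mulr0 //.
  by rewrite pnatr_eq0 -lt0n.
exists Z; split=> //.
- have q0 : n%:R ^+ 2 - 4%:R != 0 :> R[i] by rewrite qE fmorph_eq0 gt_eqF // (lt_le_trans ltr01).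
  have SH : (map_mx rc S)^T = map_mx rc S by rewrite map_trmx SS.
  have := kernel_defect n_gt0 tr_e fierz orth_e SH q0.
  rewrite -rcG -/M -ZE -(rc_kR ZH) -map_mxB => DE.
  have g0 := nrm_ge0 (ein1 S).
  have gG : nrm G <= nrm (ein1 S) by rewrite e1G nrmZ ger0_norm // ler_peMl ?nrm_ge0 // ler1n.
  have tS : `|\tr S| <= nrm (ein1 S).
    have m20 : 0 <= 2%:R * m by rewrite mulr_ge0.
    have := nrm_tr (ein1 S); rewrite trS normrM normrN (ger0_norm m20).
    move=> h; apply: le_trans h; rewrite ler_peMl //.
    by have := m3; lra.
  have n1 := nrm_ge0 (1%:M : 'M[R]_N).
  have nC1 : nrm (1%:M : 'M[R[i]]_N) = (nrm (1%:M : 'M[R]_N))%:C.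
    by rewrite -nrm_rc map_mx1.
  pose X := (- 2%:R * \tr M) *: 1%:M + n%:R *: map_mx rc G + - 2%:R *: nest e (map_mx rc G).
  have hX : nrm X <= (2%:R * `|\tr S| * nrm (1%:M : 'M[R]_N) + m * nrm G + 2%:R * (K2 * nrm G))%:C.
    rewrite !rmorphD /=; apply: le_trans (nrmD _ _) _; apply: lerD.
      apply: le_trans (nrmD _ _) _; rewrite !nrmZ; apply: lerD.
        rewrite nC1 trMS mulrNN normrM normr_nat rmorphM rmorphM rmorph_nat.
        by rewrite -(normc_real (\tr S)).
      by rewrite nrm_rc normr_nat rmorphM rmorph_nat.
    rewrite nrmZ normrN normr_nat rmorphM rmorph_nat ler_wpM2l //.
    by rewrite rmorphM /= -nrm_rc; exact: H2.
  have qX : (nrm (S - kR Z))%:C <= nrm X.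
    rewrite -nrm_rc DE nrmZ ler_piMl ?nrm_ge0 // qE normfV normc_def /= expr0n addr0 sqrtr_sqr.
    rewrite -fmorphV lecR invf_le1 ?normr_gt0 ?gt_eqF ?(lt_le_trans ltr01) //.
    by rewrite ger0_norm // (le_trans ler01).
  rewrite -lecR; apply: le_trans qX _; apply: le_trans hX _; rewrite lecR /K.
  have : `|\tr S| * nrm (1%:M : 'M[R]_N) <= nrm (ein1 S) * nrm (1%:M : 'M[R]_N).
    by rewrite ler_wpM2r.
  have : m * nrm G <= m * nrm (ein1 S) by rewrite ler_wpM2l.
  have : K2 * nrm G <= K2 * nrm (ein1 S) by rewrite ler_wpM2l.
  have : 0 <= K3 * K1 * (2%:R * m) * nrm (ein1 S) by rewrite !mulr_ge0.
  lra.
rewrite /Z nrmZ.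
apply: le_trans (_ : (2%:R * m)%:C * nrm (traceless M) <= _).
  rewrite ler_wpM2r ?nrm_ge0 // normc_def /= expr0n addr0 sqrtr_sqr lecR normrN.
  rewrite normrM (ger0_norm (_ : 0 <= 2%:R * m)) ?mulr_ge0 // ler_piMr ?mulr_ge0 //.
  by rewrite normfV ger0_norm ?(le_trans ler01) // invf_le1 // (lt_le_trans ltr01).
apply: le_trans (_ : (2%:R * m)%:C * (K3%:C * (K1%:C * nrm (map_mx rc S))) <= _).
  rewrite ler_wpM2l ?ler0c ?mulr_ge0 //; apply: le_trans (H3 _) _.
  by rewrite ler_wpM2l ?ler0c //; exact: H1.
rewrite nrm_rc -!rmorphM lecR /K.
have nS := nrm_ge0 S.
have : 0 <= nrm (1%:M : 'M[R]_N) * nrm S by rewrite mulr_ge0 ?nrm_ge0.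
have : 0 <= m * nrm S by rewrite mulr_ge0.
have : 0 <= K2 * nrm S by rewrite mulr_ge0.
lra.
Qed.

End Frame.

(** * Spectral calculus and rounding to an involution *)

Section SpectralCalculus.
Variables (R : rcfType) (n : nat) (U : 'M[R[i]]_n).
Local Notation rc := (real_complex R).
Hypothesis UU : U *m U^t* = 1%:M.
Let UUt : U^t* *m U = 1%:M. Proof. exact: mulmx1C. Qed.
Implicit Types d : 'rV[R]_n.

(** The hermitian matrix with eigenvalues d in the eigenbasis given by U; for fixed U this is a
    morphism of algebras in d, and nrm_spc and spc_entry compare its norm with that of d. *)
Definition spc d : 'M[R[i]]_n := U^t* *m diag_mx (map_mx rc d) *m U.

Lemma spcD d d' : spc (d + d') = spc d + spc d'.
Proof. by rewrite /spc map_mxD raddfD /= mulmxDr mulmxDl. Qed.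

Lemma spcZ k d : spc (k *: d) = k%:C *: spc d.
Proof. by rewrite /spc map_mxZ linearZ /= -scalemxAr -scalemxAl. Qed.

Lemma spcM d d' : spc d *m spc d' = spc (\row_l (d 0 l * d' 0 l)).
Proof.
rewrite /spc; set D := diag_mx _; set D' := diag_mx (map_mx _ d').
have -> : U^t* *m D *m U *m (U^t* *m D' *m U) = U^t* *m (D *m D') *m U.
  by rewrite !mulmxA -(mulmxA (U^t* *m D) U) UU mulmx1.
have -> // : D *m D' = diag_mx (map_mx rc (\row_l (d 0 l * d' 0 l))).
rewrite mulmx_diag; congr diag_mx.
by apply/rowP => l; rewrite !mxE rmorphM.
Qed.

Lemma spc_cst k : spc (const_mx k) = (k%:C)%:M.
Proof.
rewrite /spc map_const_mx diag_const_mx -scalemx1 -scalemxAr mulmx1 -scalemxAl UUt.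
by rewrite scalemx1.
Qed.

Lemma tr_spc d : \tr (spc d) = (\sum_l d 0 l)%:C.
Proof.
rewrite /spc mxtrace_mulC mulmxA UU mul1mx mxtrace_diag rmorph_sum.
by apply: eq_bigr => l _; rewrite mxE.
Qed.

Lemma spc_herm d : (spc d)^t* = spc d.
Proof.
rewrite /spc !adjM mulmxA.
have -> : (U^t*)^t* = U by apply/matrixP => i j; rewrite !mxE conjCK.
have -> // : (diag_mx (map_mx rc d))^t* = diag_mx (map_mx rc d).
rewrite tr_diag_mx map_diag_mx; congr diag_mx.
by apply/rowP => l; rewrite !mxE; exact: conjc_real.
Qed.

Lemma unitary_entry i j : `|U i j| <= 1.
Proof.
have h : `|U i j| ^+ 2 <= 1.
  have /matrixP/(_ i i) := UU; rewrite !mxE eqxx mulr1n => <-.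
  rewrite (bigD1 j) //= !mxE -normCK lerDl.
  by apply: sumr_ge0 => k _; rewrite !mxE -normCK exprn_ge0.
by rewrite -(@expr_le1 _ 2).
Qed.

Lemma nrm_unitary : nrm U <= (n%:R ^+ 2)%:C.
Proof.
apply: le_trans (_ : \sum_(i < n) \sum_(j < n) 1 <= _).
  by apply: ler_sum => i _; apply: ler_sum => j _; exact: unitary_entry.
by rewrite !sumr_const card_ord -mulrnA rmorphXn /= rmorph_nat -natrX mulnn.
Qed.

Lemma nrm_unitary_adj : nrm (U^t*) <= (n%:R ^+ 2)%:C.
Proof.
have -> : nrm (U^t*) = nrm U.
  rewrite /nrm exchange_big; apply: eq_bigr => i _; apply: eq_bigr => j _.
  by rewrite !mxE norm_conjC.
exact: nrm_unitary.
Qed.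

Lemma nrm_diag d : nrm (diag_mx (map_mx rc d)) = (\sum_l `|d 0 l|)%:C.
Proof.
rewrite rmorph_sum; apply: eq_bigr => i _.
rewrite (bigD1 i) //= big1 ?addr0 => [|j ji]; rewrite !mxE ?eqxx ?mulr1n.
  by rewrite normc_real.
by rewrite eq_sym (negPf ji) mulr0n normr0.
Qed.

Lemma nrm_conj (V W X : 'M[R[i]]_n) : nrm V <= (n%:R ^+ 2)%:C -> nrm W <= (n%:R ^+ 2)%:C ->
  nrm (V *m X *m W) <= (n%:R ^+ 4)%:C * nrm X.
Proof.
move=> hV hW; apply: le_trans (nrmM _ _) _.
have -> : (n%:R ^+ 4)%:C * nrm X = (n%:R ^+ 2)%:C * nrm X * (n%:R ^+ 2)%:C.
  by rewrite mulrAC -rmorphM -exprD.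
apply: ler_pM; rewrite ?nrm_ge0 //.
apply: le_trans (nrmM _ _) _; apply: ler_pM; rewrite ?nrm_ge0 //.
Qed.

Lemma nrm_spc d : nrm (spc d) <= (n%:R ^+ 4 * \sum_l `|d 0 l|)%:C.
Proof.
rewrite rmorphM /= -nrm_diag; apply: nrm_conj; [exact: nrm_unitary_adj | exact: nrm_unitary].
Qed.

Lemma spc_entry d l : `|d 0 l|%:C <= (n%:R ^+ 4)%:C * nrm (spc d).
Proof.
have -> : `|d 0 l|%:C = `|diag_mx (map_mx rc d) l l| by rewrite !mxE eqxx mulr1n normc_real.
apply: le_trans (ler_entry_nrm _ _ _) _.
have {1}-> : diag_mx (map_mx rc d) = U *m spc d *m U^t*.
  by rewrite /spc !mulmxA UU mul1mx -mulmxA UU mulmx1.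
by apply: nrm_conj; [exact: nrm_unitary | exact: nrm_unitary_adj].
Qed.

End SpectralCalculus.

Lemma hermitian_spectral (R : rcfType) n (Z : 'M[R[i]]_n) : Z^t* = Z ->
  exists U, U *m U^t* = 1%:M /\ exists d, Z = spc U d.
Proof.
move=> ZH; have hZ : Z \is hermsymmx.
  by apply/is_hermitianmxP; rewrite expr0 scale1r ZH.
have /orthomx_spectralP ZE := hermitian_normalmx hZ.
have uU := spectral_unitarymx Z.
exists (spectralmx Z); split; first exact/unitarymxP.
exists (map_mx (@complex.Re R) (spectral_diag Z)).
rewrite /spc.
have -> : map_mx (real_complex R) (map_mx (@complex.Re R) (spectral_diag Z)) = spectral_diag Z.
  apply/rowP => l; rewrite !mxE; apply: RRe_real.
  by have /mxOverP := hermitian_spectral_diag_real hZ; apply.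
by rewrite -invmx_unitary.
Qed.

Section SignRounding.
Variables (R : rcfType) (n : nat).
Definition sgv (d : 'rV[R]_n) : 'rV[R]_n := \row_l (if 0 <= d 0 l then 1 else -1).

Lemma sgv_sqr d l : sgv d 0 l * sgv d 0 l = 1.
Proof. by rewrite mxE; case: ifP => _; rewrite ?mulr1 ?mulrNN ?mulr1. Qed.

(** In terms of the sign of d, the factors of d ^ 2 - s are d - sign * sqrt s and d + sign * sqrt s;
    the second one has absolute value at least sqrt s. *)
Lemma sgv_approx (d : 'rV[R]_n) s de l : 0 < s -> `|d 0 l ^+ 2 - s| <= de ->
  `|d 0 l - Num.sqrt s * sgv d 0 l| <= de / Num.sqrt s.
Proof.
move=> s0 h; have q0 : 0 < Num.sqrt s by rewrite sqrtr_gt0.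
rewrite ler_pdivlMr //; apply: le_trans h.
have sE : s = Num.sqrt s ^+ 2 by rewrite sqr_sqrtr // ltW.
rewrite {3}sE subr_sqr normrM mxE.
case: ifP => d0.
  rewrite mulr1 ler_wpM2l // ger0_norm; lra.
move/negbT: d0; rewrite -ltNge => d0; rewrite mulrN1 opprK mulrC ler_wpM2r //.
rewrite ltr0_norm; lra.
Qed.

(** The sum of the signs is an integer, and it is close to the sum of the d l / sqrt s, which is
    zero. *)
Lemma sgv_sum0 (d : 'rV[R]_n) s de : 0 < s -> (forall l, `|d 0 l ^+ 2 - s| <= de) ->
  \sum_l d 0 l = 0 -> n%:R * de < s -> \sum_l sgv d 0 l = 0.
Proof.
move=> s0 h d0 des; have q0 : 0 < Num.sqrt s by rewrite sqrtr_gt0.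
pose z l : int := if 0 <= d 0 l then 1 else -1.
have zE : \sum_l sgv d 0 l = (\sum_l z l)%:~R.
  rewrite rmorph_sum; apply: eq_bigr => l _; rewrite mxE /z.
  by case: ifP.
have : `|Num.sqrt s * \sum_l sgv d 0 l| < Num.sqrt s.
  have -> : Num.sqrt s * \sum_l sgv d 0 l = - \sum_l (d 0 l - Num.sqrt s * sgv d 0 l).
    by rewrite sumrB d0 sub0r opprK mulr_sumr.
  rewrite normrN; apply: le_lt_trans (ler_norm_sum _ _ _) _.
  apply: le_lt_trans (_ : \sum_(l < n) (de / Num.sqrt s) < _).
    by apply: ler_sum => l _; apply: sgv_approx.
  rewrite sumr_const card_ord -mulr_natl mulrA ltr_pdivrMr //.
  by rewrite -expr2 sqr_sqrtr // ltW.
rewrite normrM gtr0_norm // gtr_pMr // zE -intr_norm -[1]/(1%:~R) ltr_int.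
have int0 (k : int) : `|k| < 1 -> k = 0 by case: k => [[|k]|k].
by move/int0 => ->.
Qed.
End SignRounding.

(** * Isolation of the identity matrix *)

Section Isolation.
Variables (R : rcfType) (n N : nat) (e : 'I_N -> 'M[R[i]]_n) (a : 'I_N -> 'M[R]_N).
Hypothesis n3 : (3 <= n)%N.
Hypothesis tr_e : forall x, \tr (e x) = 0.
Hypothesis fierz : forall X, \sum_x \tr (e x *m X) *: e x = (\tr X / n%:R)%:M - X.
Hypothesis orth_e : forall x y, \tr (e x *m e y) = - (x == y)%:R.
Hypothesis e_skew : forall x, (e x)^t* = - e x.
Local Notation rc := (real_complex R).
Hypothesis aE : forall x, map_mx rc (a x) = adm e x.
Local Notation m := (n%:R : R).
Local Notation kR := (kR e).
Local Notation einstein_op := (einstein_op a m).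
Local Notation ein1 := (ein1 a m).
Local Notation ein2 := (ein2 a m).
Local Notation ein3 := (ein3 a m).

Let n_gt0 : (0 < n)%N. Proof. exact: leq_trans n3. Qed.
Let m3 : 3%:R <= m. Proof. by rewrite ler_nat. Qed.
Let skew := a_skew aE.
Let L11 := Lam11 n3 tr_e fierz orth_e aE.

Lemma kRD X Y : kR (X + Y) = kR X + kR Y.
Proof. by rewrite /kR kZD re_mxD. Qed.

Lemma kRZ k X : kR (k%:C *: X) = k *: kR X.
Proof. by rewrite /kR kZZ re_mxZ. Qed.

Lemma ein1_kR Z : Z^t* = Z -> \tr Z = 0 -> ein1 (kR Z) = 0.
Proof. by move=> ZH Z0; rewrite /ein1 (Lam_kR n3) // subrr scaler0. Qed.

(** The second-order step: by traceless_cM_ker the contraction of ein2 does not see the unknown r,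
    and what is left is a multiple of the traceless part of Z ^ 2. *)
Lemma quadratic_obstruction : exists2 K : R, 0 <= K & forall Z r,
  Z^t* = Z -> \tr Z = 0 -> r^T = r ->
  nrm (traceless (Z *m Z)) <= (K * nrm (ein2 (kR Z) r))%:C.
Proof.
have [K1 K10 H1] := nrm_cM_bound e.
have [K3 K30 H3] := nrm_traceless_bound R n.
exists (K3 * K1); first exact: mulr_ge0.
move=> Z r ZH Z0 rS; pose G := ein2 (kR Z) r.
have GE : G = 2%:R *: (m *: r - Lam a 1%:M r)
    + (3%:R *: Lam a (kR Z) (kR Z) - (2%:R * m) *: (kR Z *m kR Z)).
  rewrite /G /ein2 /ein1 (Lam_kR n3) // -!scalemxAl -!scalemxAr.
  apply/matrixP => u v; rewrite !(addmxE, oppmxE, scalemxE); ring.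
pose X := m *: r - Lam a 1%:M r.
pose Y := Lam a (kR Z) (kR Z); pose T := kR Z *m kR Z.
have rcG : map_mx rc G = 2%:R *: (n%:R *: map_mx rc r - Lam (adm e) 1%:M (map_mx rc r))
   + (3%:R *: Lam (adm e) (kZ e Z) (kZ e Z) - (2%:R * n%:R) *: (kZ e Z *m kZ e Z)).
  have -> : G = 2%:R *: X + (3%:R *: Y - (2%:R * m) *: T) by [].
  rewrite map_mxD map_mxB 3!map_mxZ rmorphM !rmorph_nat.
  rewrite /X map_mxB map_mxZ rmorph_nat (rc_Lam aE) map_mx1.
  by rewrite /Y (rc_Lam aE) /T map_mxM rc_kR.
have rS' : (map_mx rc r)^T = map_mx rc r by rewrite map_trmx rS.
have ptE : traceless (cM e (map_mx rc G)) = (n%:R ^+ 2 / 2%:R) *: traceless (Z *m Z).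
  rewrite rcG cMD cMZ tracelessD tracelessZ (traceless_cM_ker n_gt0) // scaler0 add0r.
  by rewrite traceless_cM_obstruction.
apply: le_trans (_ : nrm (traceless (cM e (map_mx rc G))) <= _).
  rewrite ptE nrmZ ler_peMl ?nrm_ge0 //.
  have -> : n%:R ^+ 2 / 2%:R = (m ^+ 2 / 2%:R)%:C :> R[i].
    by rewrite rmorphM fmorphV rmorphXn !rmorph_nat.
  rewrite -normc_real -[1]/(1%:C) lecR ger0_norm; have := m3; nra.
apply: le_trans (H3 _) _; rewrite -mulrA rmorphM /= ler_wpM2l ?ler0c //.
by apply: le_trans (H1 _) _; rewrite nrm_rc -rmorphM.
Qed.

(** The first coefficient is O(t) for any solution, and the second one is if the first vanishes. *)
Lemma expansion_bounds (C : R) : 0 <= C -> exists de K, [/\ 0 < de, 0 <= K &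
  forall (t : R) S B P, 0 < t <= de -> S^T = S -> B^T = B -> nrm S <= C -> nrm B <= C ->
    (1%:M + t *: S + t ^+ 2 *: B) *m P = 1%:M ->
    einstein_op (1%:M + t *: S + t ^+ 2 *: B) P = 0 ->
    nrm (ein1 S) <= K * t /\ (ein1 S = 0 -> nrm (ein2 S B) <= K * t)].
Proof.
move=> C0; have [de [K [de0 K0 H]]] := einstein_expansion skew L11 C0.
exists (Num.min de 1), (3%:R * K); split.
- by rewrite lt_min de0 ltr01.
- by rewrite mulr_ge0.
move=> t S B P /andP[t0]; rewrite le_min => /andP[tde t1] SS BS SC BC AP Ein.
have [|r [rK e2K e3K E]] := H t S B P _ SS BS SC BC AP Ein; first by rewrite t0.
have t00 := ltW t0.
have b1 (X : 'M[R]_N) : nrm X <= K -> nrm (t *: X) <= K * t.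
  by move=> h; rewrite nrmZ ger0_norm // mulrC ler_wpM2r.
have b2 (X : 'M[R]_N) : nrm X <= K -> nrm (t ^+ 2 *: X) <= K * t.
  move=> /b1 h; rewrite expr2 -scalerA nrmZ ger0_norm // [K * t]mulrC ler_wpM2l //.
  by apply: le_trans h _; rewrite ler_piMr.
have b3 (X : 'M[R]_N) : nrm X <= K -> nrm (t ^+ 3 *: X) <= K * t.
  move=> /b2 h; rewrite exprS -scalerA nrmZ ger0_norm // [K * t]mulrC ler_wpM2l //.
  by apply: le_trans h _; rewrite ler_piMr.
split.
  have -> : ein1 S = - (t *: ein2 S B + t ^+ 2 *: ein3 S B + t ^+ 3 *: r).
    by apply/eqP; rewrite -subr_eq0 opprK !addrA E.
  rewrite nrmN; apply: le_trans (nrmD _ _) _.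
  have := nrmD (t *: ein2 S B) (t ^+ 2 *: ein3 S B).
  have := b1 _ e2K; have := b2 _ e3K; have := b3 _ rK; lra.
move=> e10; rewrite e10 add0r in E.
have {}E : ein2 S B = - (t *: ein3 S B + t ^+ 2 *: r).
  apply: (scalerI (lt0r_neq0 t0)); apply/eqP; rewrite -subr_eq0; apply/eqP; apply: etrans E.
  apply/matrixP => u v; rewrite !(addmxE, oppmxE, scalemxE); ring.
rewrite E nrmN; apply: le_trans (nrmD _ _) _.
have := b1 _ e3K; have := b2 _ rK; have : 0 <= K * t by rewrite mulr_ge0.
lra.
Qed.

(** Every solution near the identity lies within O(t ^ 2) of the ray through kR J, for a traceless
    hermitian involution J: the first two coefficients of the expansion give Z with S - kR Z = O(h)
    and Z ^ 2 - s = O(h) for a scalar s, and rounding the eigenvalues of Z to plus or minus sqrt s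
    gives J. The estimates need a lower bound for s, which comes from nrm S = 1. *)
Lemma cone_normal_form : exists de K, [/\ 0 < de, 0 <= K &
  forall (h : R) S P, 0 < h <= de -> S^T = S -> nrm S = 1 ->
    (1%:M + h *: S) *m P = 1%:M -> einstein_op (1%:M + h *: S) P = 0 ->
  exists (t : R) J B, [/\ 0 < t <= K * h, [/\ J^t* = J, J *m J = 1%:M & \tr J = 0],
    B^T = B, [/\ nrm B <= K, nrm (kR J) <= K & nrm J <= K%:C] &
    h *: S = t *: kR J + t ^+ 2 *: B]].
Proof.
have [d1 [K1 [d10 K10 H1]]] := expansion_bounds (ler01 : 0 <= 1 :> R).
have [K2 K20 H2] := linear_normal_form n3 tr_e fierz orth_e e_skew aE.
have [Kk Kk0 Hk] := nrm_kR_bound e.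
have [K4 K40 H4] := quadratic_obstruction.
pose C2 := K2 * K1.
have C20 : 0 <= C2 by rewrite mulr_ge0.
have C30 : 0 <= C2 + Kk * K2 by rewrite addr_ge0 ?mulr_ge0.
have [d3 [K3 [d30 K30 H3]]] := expansion_bounds C30.
have m0 : 0 <= m by exact: ler0n.
pose n4 := m ^+ 4.
have n40 : 0 <= n4 by rewrite exprn_ge0.
pose K5 := n4 * (K4 * K3).
have K50 : 0 <= K5 by rewrite !mulr_ge0.
(* c bounds the sum of the absolute values of the eigenvalues of Z from below, and then s0 is a
   lower bound for their mean square s. *)
pose c := (2%:R * (Kk * n4 + 1))^-1.
have Kn : 0 <= Kk * n4 by rewrite mulr_ge0.
have c0 : 0 < c by rewrite invr_gt0; lra.
pose s0 := c ^+ 2 / m ^+ 2.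
have s00 : 0 < s0 by rewrite divr_gt0 ?exprn_gt0 // (lt_le_trans _ m3).
have qs0 : 0 < Num.sqrt s0 by rewrite sqrtr_gt0.
pose Kz := m * K5 / Num.sqrt s0.
have Kz0 : 0 <= Kz by rewrite !mulr_ge0 ?invr_ge0 // ltW.
pose KB := s0^-1 * (C2 + Kk * (n4 * Kz)).
have KB0 : 0 <= KB.
  apply: mulr_ge0; first by rewrite invr_ge0 ltW.
  by apply: addr_ge0 => //; apply: mulr_ge0 => //; exact: mulr_ge0.
pose KJ := n4 * m.
have KJ0 : 0 <= KJ by rewrite mulr_ge0.
pose Kt := n4 * K2.
have Kt0 : 0 <= Kt by rewrite mulr_ge0.
(* The third bound puts S at distance at most 1/2 from kR Z, so that Z cannot be small; the last
   one makes the deviation of the squared eigenvalues from s small enough for sgv_sum0. *)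
pose de := Num.min (Num.min d1 d3) (Num.min (2%:R * (C2 + 1))^-1 (s0 / (m * K5 + 1))).
have de0 : 0 < de.
  rewrite !lt_min d10 d30 invr_gt0 divr_gt0 //=; first by rewrite andbT; lra.
  have : 0 <= m * K5 by rewrite mulr_ge0.
  by lra.
exists de, (Kt + KB + KJ + Kk * KJ); split=> //.
  by rewrite !addr_ge0 // mulr_ge0.
move=> h S P /andP[h0]; rewrite !le_min => /andP[/andP[hd1 hd3] /andP[hC hs]] SS S1 AP Ein.
have h00 := ltW h0.
have hC2 : h * C2 <= 2%:R^-1.
  have C21 : 0 < 2%:R * (C2 + 1) by lra.
  have : h * (2%:R * (C2 + 1)) <= 1 by rewrite -ler_pdivlMr // div1r.
  lra.
have hs5 : m * (K5 * h) < s0.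
  have mK5 : 0 <= m * K5 by rewrite mulr_ge0.
  have mK51 : 0 < m * K5 + 1 by lra.
  have : h * (m * K5 + 1) <= s0 by rewrite -ler_pdivlMr.
  lra.
have A0 : 1%:M + h *: S = 1%:M + h *: S + h ^+ 2 *: 0 by rewrite scaler0 addr0.
have nrm0 : nrm (0 : 'M[R]_N) <= 1.
  by rewrite -(scale0r (0 : 'M[R]_N)) nrmZ normr0 mul0r ler01.
have [e1b _] : nrm (ein1 S) <= K1 * h /\ (ein1 S = 0 -> nrm (ein2 S 0) <= K1 * h).
  apply: (H1 h S 0 P) => //; rewrite ?h0 ?trmx0 ?S1 // -?A0 //.
have [Z [ZH Z0 SZ nZ]] := H2 S SS.
have {}SZ : nrm (S - kR Z) <= C2 * h.
  by apply: le_trans SZ _; rewrite -mulrA ler_wpM2l.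
rewrite S1 mulr1 in nZ.
pose r := h^-1 *: (S - kR Z).
have hr : h *: r = S - kR Z by rewrite scalerA mulfV ?scale1r // gt_eqF.
have rS : r^T = r by rewrite linearZ /= raddfB /= SS kR_sym.
have nr : nrm r <= C2.
  rewrite nrmZ ger0_norm ?invr_ge0 // mulrC ler_pdivrMr //.
have nkZ : nrm (kR Z) <= Kk * K2.
  rewrite -lecR; apply: le_trans (Hk Z) _; rewrite rmorphM ler_wpM2l ?ler0c //.
have AE : 1%:M + h *: S = 1%:M + h *: kR Z + h ^+ 2 *: r.
  by rewrite expr2 -scalerA hr -addrA -scalerDr [kR Z + _]addrC subrK.
have [_ e2b] : nrm (ein1 (kR Z)) <= K3 * h /\ (ein1 (kR Z) = 0 -> nrm (ein2 (kR Z) r) <= K3 * h).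
  apply: (H3 h (kR Z) r P) => //; rewrite ?h0 ?kR_sym -?AE //.
  - by apply: le_trans nkZ _; rewrite lerDr.
  - by apply: le_trans nr _; rewrite lerDl mulr_ge0.
have {}e2b := e2b (ein1_kR ZH Z0).
have ptb : nrm (traceless (Z *m Z)) <= (K4 * (K3 * h))%:C.
  by apply: le_trans (H4 Z r ZH Z0 rS) _; rewrite lecR ler_wpM2l.
have [U [UU [d ZE]]] := hermitian_spectral ZH.
have sd : \sum_l d 0 l = 0.
  by apply: (@complexI R); rewrite -(tr_spc UU) -ZE Z0.
pose s := (\sum_l d 0 l ^+ 2) / m.
have mn0 : m != 0 by rewrite gt_eqF // (lt_le_trans _ m3).
have ptE : traceless (Z *m Z) = spc U (\row_l (d 0 l ^+ 2 - s)).
  have -> : \row_l (d 0 l ^+ 2 - s) = \row_l (d 0 l * d 0 l) + (-1) *: const_mx s.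
    by apply/rowP => l; rewrite !mxE mulN1r expr2.
  rewrite spcD spcZ (spc_cst UU) -(spcM UU) -ZE /traceless.
  rewrite {3 4}ZE (spcM UU) (tr_spc UU); congr (_ + _).
  rewrite rmorphN rmorph1 scaleN1r; congr (- _%:M).
  rewrite /s rmorphM fmorphV rmorph_nat; congr (_%:C / _).
  by apply: eq_bigr => l _; rewrite mxE expr2.
have dsb l : `|d 0 l ^+ 2 - s| <= K5 * h.
  rewrite -lecR; have := spc_entry UU (\row_l (d 0 l ^+ 2 - s)) l.
  rewrite -ptE mxE => /le_trans; apply.
  have -> : (K5 * h)%:C = n4%:C * (K4 * (K3 * h))%:C :> R[i] by rewrite -rmorphM /K5 !mulrA.
  by rewrite ler_wpM2l // ler0c.
have dub l : `|d 0 l| <= Kt.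
  rewrite -lecR; apply: le_trans (spc_entry UU d l) _.
  have -> : Kt%:C = n4%:C * K2%:C :> R[i] by rewrite -rmorphM.
  by rewrite -ZE ler_wpM2l // ler0c.
have nkR x : nrm (kR (spc U x)) <= Kk * (n4 * \sum_l `|x 0 l|).
  rewrite -lecR; apply: le_trans (Hk _) _; rewrite rmorphM /= ler_wpM2l ?ler0c //.
  exact: nrm_spc.
have sumd : c <= \sum_l `|d 0 l|.
  have := nkR d; rewrite -ZE => nkRZ.
  have := nrmD (S - kR Z) (kR Z); rewrite subrK S1 => tri.
  have : 2%:R^-1 <= (Kk * n4 + 1) * \sum_l `|d 0 l|.
    apply: le_trans (_ : Kk * n4 * \sum_l `|d 0 l| <= _).
      by move: SZ hC2 tri nkRZ; rewrite mulrA [C2 * h]mulrC; lra.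
    by rewrite mulrDl mul1r lerDl sumr_ge0.
  have p0 : 0 < Kk * n4 + 1 by rewrite ltr_wpDl.
  by move=> p1; rewrite /c invfM ler_pdivrMr // mulrC.
have s0s : s0 <= s.
  (* The mean square is bounded below by the mean of the absolute values. *)
have amgm l : c / m * `|d 0 l| <= 2%:R^-1 * d 0 l ^+ 2 + 2%:R^-1 * (c / m) ^+ 2.
    have := sqr_ge0 (`|d 0 l| - c / m); rewrite sqrrB real_normK ?num_real //; lra.
  have : c / m * \sum_l `|d 0 l| <= \sum_l (2%:R^-1 * d 0 l ^+ 2 + 2%:R^-1 * (c / m) ^+ 2).
    by rewrite mulr_sumr ler_sum.
  rewrite big_split /= -mulr_sumr sumr_const card_ord -(mulr_natr (_ * _) n).
  have cm0 : 0 <= c / m by rewrite divr_ge0 // ltW.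
  have -> : \sum_l d 0 l ^+ 2 = s * m by rewrite divfK.
  have := ler_wpM2l cm0 sumd.
  have -> : c / m * c = s0 * m by rewrite /s0; field.
  have -> : (c / m) ^+ 2 = s0 by rewrite /s0 expr_div_n.
  move=> h1 h2; have : s0 * m <= s * m by move: h1 h2; lra.
  by rewrite ler_pM2r // (lt_le_trans _ m3).
have s_gt0 : 0 < s by exact: lt_le_trans s0s.
pose sg := sgv d.
have sg0 : \sum_l sg 0 l = 0.
  apply: (sgv_sum0 s_gt0 dsb sd); exact: lt_le_trans hs5 s0s.
pose q := Num.sqrt s.
have q0 : 0 < q by rewrite sqrtr_gt0.
have qq : q ^+ 2 = s by rewrite sqr_sqrtr // ltW.
have qKt : q <= Kt.
  rewrite -(@ler_pXn2r _ 2) ?nnegrE ?(ltW q0) // qq /s ler_pdivrMr ?(lt_le_trans _ m3) //.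
  apply: le_trans (_ : \sum_(l < n) Kt ^+ 2 <= _).
    apply: ler_sum => l _; rewrite -(@real_normK _ (d 0 l)) ?num_real //.
    by rewrite ler_pXn2r ?nnegrE.
  by rewrite sumr_const card_ord mulr_natr.
pose J := spc U sg.
pose d' := h^-1 *: (d - q *: sg).
have d'b l : `|d' 0 l| <= K5 / Num.sqrt s0.
  have -> : d' 0 l = h^-1 * (d 0 l - q * sg 0 l) by rewrite !mxE.
  rewrite normrM gtr0_norm ?invr_gt0 // mulrC ler_pdivrMr //.
  apply: le_trans (sgv_approx s_gt0 (dsb l)) _.
  rewrite [leRHS]mulrAC ler_wpM2l ?mulr_ge0 //.
  by rewrite lef_pV2 ?posrE // ler_wsqrtr.
have ZJ : Z = q%:C *: J + h%:C *: spc U d'.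
  have dE : d = q *: sg + h *: d' by rewrite scalerA mulfV ?gt_eqF // scale1r addrC subrK.
  have spcL k l x y : spc U (k *: x + l *: y) = k%:C *: spc U x + l%:C *: spc U y.
    by rewrite spcD !spcZ.
  by rewrite ZE [in LHS]dE spcL.
have kRL k l X Y : kR (k%:C *: X + l%:C *: Y) = k *: kR X + l *: kR Y by rewrite kRD !kRZ.
have kRE : kR Z = q *: kR J + h *: kR (spc U d') by rewrite ZJ kRL.
exists (h * q), J, (s^-1 *: (r + kR (spc U d'))); split.
- rewrite mulr_gt0 //= mulrC ler_wpM2r //; apply: le_trans qKt _.
  by rewrite -!addrA lerDl !addr_ge0 // mulr_ge0.
- split.
  + exact: spc_herm.
  + rewrite (spcM UU) (_ : \row_l _ = const_mx 1) ?(spc_cst UU) ?rmorph1 //.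
    by apply/rowP => l; rewrite mxE sgv_sqr mxE.
  + by rewrite (tr_spc UU) sg0.
- by rewrite linearZ /= raddfD /= rS kR_sym.
- have nJ : nrm J <= KJ%:C.
    apply: le_trans (nrm_spc UU _) _; rewrite lecR /KJ ler_wpM2l //.
    apply: le_trans (_ : \sum_(l < n) 1 <= _); last by rewrite sumr_const card_ord.
    by apply: ler_sum => l _; rewrite mxE; case: ifP; rewrite ?normrN normr1.
  have KkKJ : 0 <= Kk * KJ by rewrite mulr_ge0.
  split.
  + apply: le_trans (_ : KB <= _); last first.
      by rewrite -!addrA addrCA lerDl !addr_ge0.
    rewrite nrmZ gtr0_norm ?invr_gt0 //; apply: ler_pM; rewrite ?nrm_ge0 //.
    * by rewrite invr_ge0 ltW.
    * by rewrite lef_pV2 ?posrE.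
    apply: le_trans (nrmD _ _) _; apply: lerD => //.
    apply: le_trans (nkR _) _; rewrite !ler_wpM2l //.
    apply: le_trans (_ : \sum_(l < n) (K5 / Num.sqrt s0) <= _).
      by apply: ler_sum => l _; exact: d'b.
    by rewrite sumr_const card_ord -mulr_natl mulrA.
  + apply: le_trans (_ : Kk * KJ <= _); last by rewrite lerDr !addr_ge0.
    rewrite -lecR; apply: le_trans (Hk _) _; rewrite rmorphM /= ler_wpM2l ?ler0c //.
  + apply: le_trans nJ _; rewrite lecR -addrA addrC -addrA lerDl.
    by rewrite addr_ge0 // addr_ge0.
have -> : S = kR Z + h *: r by rewrite hr addrC subrK.
have sX (X : 'M[R]_N) : (h ^+ 2 * s) *: (s^-1 *: X) = h ^+ 2 *: X.
  by rewrite scalerA mulfK ?gt_eqF.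
rewrite kRE exprMn qq sX.
have alg (X1 X2 X3 : 'M[R]_N) :
  h *: (q *: X1 + h *: X2 + h *: X3) = (h * q) *: X1 + h ^+ 2 *: (X3 + X2).
  apply/matrixP => u v; rewrite !(addmxE, scalemxE); ring.
exact: alg.
Qed.

End Isolation.

Lemma nrm_DJ (F : numFieldType) n N (e : 'I_N -> 'M[F]_n) J :
  nrm (DJ e J) <= (\sum_x \sum_y nrm (e x) * nrm (e y)) * nrm J ^+ 2.
Proof.
rewrite mulr_suml; apply: ler_sum => x _; rewrite mulr_suml; apply: ler_sum => y _.
rewrite DJE normrN; apply: le_trans (nrm_tr _) _.
have -> : nrm (e x) * nrm (e y) * nrm J ^+ 2 = nrm (e x) * nrm J * nrm (e y) * nrm J by ring.
do 3!(apply: le_trans (nrmM _ _) _; rewrite ler_wpM2r ?nrm_ge0 //).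
Qed.

Lemma nrm_UJ (F : numFieldType) n N (e : 'I_N -> 'M[F]_n) J :
  nrm (UJ e J) <= (\sum_x \sum_y nrm (e x) * nrm (e y)) * nrm J ^+ 2.
Proof.
rewrite mulr_suml; apply: ler_sum => x _; rewrite mulr_suml; apply: ler_sum => y _.
rewrite UJE normrN normrM.
have -> : nrm (e x) * nrm (e y) * nrm J ^+ 2 = (nrm (e x) * nrm J) * (nrm (e y) * nrm J) by ring.
by apply: ler_pM => //; apply: le_trans (nrm_tr _) _; exact: nrmM.
Qed.

Section Isolation2.
Variables (R : rcfType) (n N : nat) (e : 'I_N -> 'M[R[i]]_n) (a : 'I_N -> 'M[R]_N).
Hypothesis n3 : (3 <= n)%N.
Hypothesis tr_e : forall x, \tr (e x) = 0.
Hypothesis fierz : forall X, \sum_x \tr (e x *m X) *: e x = (\tr X / n%:R)%:M - X.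
Hypothesis orth_e : forall x y, \tr (e x *m e y) = - (x == y)%:R.
Hypothesis e_skew : forall x, (e x)^t* = - e x.
Local Notation rc := (real_complex R).
Hypothesis aE : forall x, map_mx rc (a x) = adm e x.
Local Notation m := (n%:R : R).
Local Notation kR := (kR e).
Local Notation einstein_op := (einstein_op a m).

Let n_gt0 : (0 < n)%N. Proof. exact: leq_trans n3. Qed.
Let m3 : 3%:R <= m. Proof. by rewrite ler_nat. Qed.
Let skew := a_skew aE.
Let anti := a_anti aE.
Let L11 := Lam11 n3 tr_e fierz orth_e aE.

Section J.
Variable J : 'M[R[i]]_n.
Hypothesis JH : J^t* = J.

Definition DR : 'M[R]_N := re_mx (DJ e J).
Definition UR : 'M[R]_N := re_mx (UJ e J).
Definition WR : 'M[R]_N := ((m ^+ 2 + 4%:R) / 2%:R) *: (1%:M - DR)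
  + (2%:R * m) *: UR - 8%:R *: 1%:M.

Lemma rc_DR : map_mx rc DR = DJ e J.
Proof.
apply: re_mxK => x y; rewrite DJE rmorphN; congr (- _).
rewrite [LHS]tr_conj !adjM JH !e_skew !(mulmxN, mulNmx) opprK; trace_rot.
Qed.

Lemma rc_UR : map_mx rc UR = UJ e J.
Proof.
apply: re_mxK => x y; rewrite UJE rmorphN rmorphM; congr (- _).
have E z : (\tr (e z *m J))^* = - \tr (e z *m J).
  by rewrite [LHS]tr_conj adjM JH e_skew mulmxN raddfN /= mxtrace_mulC.
by rewrite [X in X * _](E x) [X in _ * X](E y) mulrNN.
Qed.

Lemma rc_WR : map_mx rc WR = WJ e J.
Proof.
rewrite /WR map_mxB map_mxD !map_mxZ map_mxB rc_DR rc_UR !map_mx1.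
by rewrite !rmorphM fmorphV rmorphD rmorphXn !rmorph_nat.
Qed.
End J.

Lemma nrm_WR_bound (C : R) : 0 <= C -> exists2 K : R, 0 <= K & forall J : 'M[R[i]]_n,
  nrm J <= C%:C -> nrm (WR J) <= K.
Proof.
move=> C0; have [|K1 K10 KE] := @real_bound R (\sum_x \sum_y nrm (e x) * nrm (e y)).
  by apply: sumr_ge0 => x _; apply: sumr_ge0 => y _; rewrite mulr_ge0 ?nrm_ge0.
pose n1 := nrm (1%:M : 'M[R]_N).
have n10 : 0 <= n1 by exact: nrm_ge0.
have k1 : 0 <= (m ^+ 2 + 4%:R) / 2%:R by rewrite divr_ge0 // addr_ge0 ?exprn_ge0.
have k2 : 0 <= 2%:R * m by rewrite mulr_ge0.
pose B := K1 * C ^+ 2.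
have B0 : 0 <= B by rewrite mulr_ge0 ?exprn_ge0.
exists ((m ^+ 2 + 4%:R) / 2%:R * (n1 + B) + 2%:R * m * B + 8%:R * n1).
  by rewrite !addr_ge0 // mulr_ge0 // addr_ge0.
move=> J JC.
have J2 : nrm J ^+ 2 <= (C ^+ 2)%:C.
  by rewrite rmorphXn /= ler_pXn2r ?nnegrE ?nrm_ge0 ?ler0c.
have dB : nrm (DR J) <= B.
  rewrite -lecR; apply: le_trans (nrm_re_mx _) _; apply: le_trans (nrm_DJ _ _) _.
  by rewrite KE /B rmorphM /= ler_wpM2l ?ler0c.
have uB : nrm (UR J) <= B.
  rewrite -lecR; apply: le_trans (nrm_re_mx _) _; apply: le_trans (nrm_UJ _ _) _.
  by rewrite KE /B rmorphM /= ler_wpM2l ?ler0c.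
rewrite /WR; apply: le_trans (nrmD _ _) _; apply: lerD; last first.
  by rewrite nrmN nrmZ ger0_norm.
apply: le_trans (nrmD _ _) _; apply: lerD; rewrite nrmZ ger0_norm // ler_wpM2l //.
by apply: le_trans (nrmD _ _) _; rewrite nrmN lerD2l.
Qed.

(** A solution other than the identity is put on the ray of a traceless involution by
    cone_normal_form, and third_order_obstruction excludes it there. *)
Lemma isolated_identity : exists2 de : R, 0 < de & forall A P : 'M[R]_N,
  A^T = A -> A *m P = 1%:M -> einstein_op A P = 0 -> nrm (A - 1%:M) < de -> A = 1%:M.
Proof.
have [d1 [K1 [d10 K10 H1]]] := cone_normal_form n3 tr_e fierz orth_e e_skew aE.
have [K2 K20 H2] := nrm_WR_bound K10.
have [d3 [d30 H3]] := third_order_obstruction anti skew L11 (addr_ge0 K10 K20) m3.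
have K11 : 0 < K1 + 1 by rewrite ltr_wpDl.
exists (Num.min d1 (d3 / (K1 + 1))); first by rewrite lt_min d10 divr_gt0.
move=> A P AS AP Ein; rewrite lt_min => /andP[hd1 hd3].
apply/eqP; rewrite -subr_eq0; apply/negPn/negP => A1.
pose h := nrm (A - 1%:M).
have h0 : 0 < h.
  rewrite lt_neqAle nrm_ge0 andbT eq_sym; apply/eqP => /nrm0_eq0 /eqP.
  by rewrite (negPf A1).
pose S := h^-1 *: (A - 1%:M).
have hS : h *: S = A - 1%:M by rewrite scalerA mulfV ?gt_eqF // scale1r.
have AE : 1%:M + h *: S = A by rewrite hS addrC subrK.
have SS : S^T = S by rewrite linearZ /= raddfB /= AS trmx1.
have S1 : nrm S = 1 by rewrite nrmZ gtr0_norm ?invr_gt0 // mulVf // gt_eqF.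
have [|||t [J [B [/andP[t0 tK] [JH JJ trJ] BS [BK kK JK] E]]]] := H1 h S P _ SS S1.
- by rewrite h0 ltW.
- by rewrite AE.
- by rewrite AE.
have td3 : t <= d3.
  apply: le_trans tK _; move: hd3; rewrite -/h ltr_pdivlMr // => hh.
  by apply: le_trans (ltW hh); rewrite mulrC ler_wpM2l ?(ltW h0) // lerDl.
have AE' : 1%:M + t *: kR J + t ^+ 2 *: B = A by rewrite -addrA -E AE.
have rk := rc_kR e_skew JH.
have rQ : map_mx rc (kR J *m kR J) = kZ e J *m kZ e J by rewrite map_mxM rk.
have trC (X : 'M[R]_N) Y : map_mx rc X = Y -> (\tr X)%:C = \tr Y by move=> <-; rewrite trace_map_mx.
have inj := @rc_inj R N.
apply: (H3 t (kR J) B P (WR J)).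
- by rewrite t0 td3.
- exact: kR_sym.
- exact: BS.
- by apply: le_trans kK _; rewrite lerDl.
- by apply: le_trans BK _; rewrite lerDl.
- by apply: le_trans (H2 J JK) _; rewrite lerDr.
- by rewrite AE'.
- by rewrite AE'.
- exact: (Lam_kR n3).
- apply: inj; rewrite (rc_Lam aE) map_mxZ rQ rk Lam_kJ // rmorph_nat //.
- apply: (@complexI R); rewrite (trC _ (kZ e J *m (kZ e J *m kZ e J))).
    by rewrite tr_kJ_Theta.
  by rewrite map_mxM rQ rk.
- apply: (@complexI R); rewrite (trC _ _ rQ) (trC _ ((kZ e J *m kZ e J) *m (kZ e J *m kZ e J))).
    by rewrite Theta_sqr.
  by rewrite map_mxM rQ.
- apply: (@complexI R); rewrite (trC _ _ rQ) tr_Theta //.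
  by rewrite rmorphM fmorphV rmorphB rmorphXn !rmorph_nat.
- apply: (@complexI R); rewrite rmorphM /= (trC _ _ rQ) rmorph_nat.
  rewrite (trC _ ((kZ e J *m kZ e J) *m Lam (adm e) 1%:M (kZ e J *m kZ e J))).
    by rewrite Lam_Theta_mul.
  by rewrite map_mxM (rc_Lam aE) rQ map_mx1.
- by apply: inj; rewrite -map_trmx rc_WR // WJT.
- apply: inj; rewrite map_mxB !map_mxZ (rc_Lam aE) rQ rc_WR // map_mx1 rmorph_nat Lam_WJ //.
  by rewrite rmorphM rmorphN rmorphB rmorphXn !rmorph_nat.
apply: (@complexI R); rewrite rmorphM /= (trC _ _ rQ) (trC _ (WJ e J *m (kZ e J *m kZ e J))).
  by rewrite tr_WJ_Theta // rmorphN rmorph_nat.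
by rewrite map_mxM rQ rc_WR.
Qed.

End Isolation2.

(** * Orthonormal bases *)

Section OrthonormalBasis.
Variables (R : rcfType) (V : vectType R) (q : V -> V -> R).
Hypothesis qC : forall X Y, q X Y = q Y X.
Hypothesis qD : forall X Y Z, q (X + Y) Z = q X Z + q Y Z.
Hypothesis qZ : forall k X Y, q (k *: X) Y = k * q X Y.
Hypothesis q_gt0 : forall X, X != 0 -> 0 < q X X.

Let q0l Z : q 0 Z = 0. Proof. by rewrite -(scale0r (0 : V)) qZ mul0r. Qed.
Let q_sum I (r : seq I) (f : I -> V) Z : q (\sum_(i <- r) f i) Z = \sum_(i <- r) q (f i) Z.
Proof.
elim: r => [|i r IH]; first by rewrite !big_nil q0l.
by rewrite !big_cons qD IH.
Qed.

Definition orthonormal_family N (e : 'I_N -> V) :=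
  forall x y, q (e x) (e y) = (x == y)%:R.

(** The Gram-Schmidt process: v enlarges the family only if it is not in its span. *)
Lemma orthonormal_extend (s : seq V) : exists N (e : 'I_N -> V),
  orthonormal_family e /\ {in s, forall X, X = \sum_x q X (e x) *: e x}.
Proof.
elim: s => [|v s [N [e [on ex]]]].
  by exists 0, (fun=> 0); split=> // -[].
pose w := v - \sum_x q v (e x) *: e x.
have [w0|w0] := eqVneq w 0.
  exists N, e; split=> // X; rewrite inE => /predU1P [->|/ex //].
  by apply/eqP; rewrite -subr_eq0; apply/eqP.
have we y : q w (e y) = 0.
  rewrite /w qD -scaleN1r qZ q_sum mulN1r (bigD1 y) //= qZ on eqxx mulr1.
  rewrite big1 ?addr0 ?subrr // => x xy; by rewrite qZ on (negPf xy) mulr0.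
pose k := Num.sqrt (q w w).
have k0 : 0 < k by rewrite sqrtr_gt0 q_gt0.
have kk : k * k = q w w by rewrite -expr2 sqr_sqrtr // ltW // q_gt0.
pose u := k^-1 *: w.
have ue y : q u (e y) = 0 by rewrite qZ we mulr0.
have uu : q u u = 1.
  by rewrite qZ qC qZ -kk; field; rewrite gt_eqF.
pose f (x : 'I_N.+1) := if unlift ord0 x is Some y then e y else u.
have f0 : f ord0 = u by rewrite /f unlift_none.
have fS y : f (lift ord0 y) = e y by rewrite /f liftK.
exists N.+1, f; split=> [x y|X].
  case: (unliftP ord0 x) => [x'|] ->; case: (unliftP ord0 y) => [y'|] ->;
    rewrite ?f0 ?fS ?fS ?eqxx //.
  - by rewrite qC ue.
rewrite inE big_ord_recl f0; under eq_bigr => i _ do rewrite fS.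
case/predU1P => [->|/ex Xs].
  have vE : v = w + \sum_x q v (e x) *: e x by rewrite subrK.
  have -> : q v u = k.
    rewrite {1}vE qD q_sum big1 ?addr0 => [|x _]; last by rewrite qZ [q (e x) u]qC ue mulr0.
    by rewrite qC qZ -kk; field; rewrite gt_eqF.
  by rewrite {1}vE scalerA mulfV ?scale1r // gt_eqF.
have -> : q X u = 0.
  by rewrite Xs q_sum big1 // => x _; rewrite qZ [q (e x) u]qC ue mulr0.
by rewrite scale0r add0r.
Qed.

Lemma orthonormal_basis : exists N (e : 'I_N -> V),
  orthonormal_family e /\ forall X, X = \sum_x q X (e x) *: e x.
Proof.
have [N [e [on ex]]] := orthonormal_extend (vbasis {:V}).
exists N, e; split=> // X.
rewrite {1}(coord_vbasis (memvf X)) (eq_bigr (fun i => \sum_x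
  (coord (vbasis {:V}) i X * q (vbasis {:V})`_i (e x)) *: e x)); last first.
  move=> i _; rewrite {1}(ex (vbasis {:V})`_i) ?memt_nth // scaler_sumr.
  by apply: eq_bigr => x _; rewrite scalerA.
rewrite exchange_big /=; apply: eq_bigr => x _; rewrite -scaler_suml; congr (_ *: _).
rewrite {2}(coord_vbasis (memvf X)) q_sum; apply: eq_bigr => i _.
by rewrite qZ.
Qed.
End OrthonormalBasis.

Lemma mxtrace_sum (R : pzRingType) n (I : finType) (f : I -> 'M[R]_n) :
  \tr (\sum_i f i) = \sum_i \tr (f i).
Proof. exact: raddf_sum. Qed.

(** * The Ricci tensor in a frame *)

(** The matrices a x and nab x are those of ad and of the Levi-Civita connection in a frame that is
    orthonormal for an invariant form; A is the Gram matrix of the metric and P its inverse. *)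
Section KoszulRicci.
Variables (R : realFieldType) (N : nat) (a : 'I_N -> 'M[R]_N).
Hypothesis a_anti : forall x i j, a x i j = - a i x j.
Hypothesis a_skew : forall x, (a x)^T = - a x.
Variables (A P : 'M[R]_N) (nab : 'I_N -> 'M[R]_N).
Hypothesis AS : A^T = A.
Hypothesis AP : A *m P = 1%:M.
Hypothesis torsion_free : forall x k y, nab x k y - nab y k x = a x k y.
Hypothesis metric_compat : forall x, (nab x)^T *m A + A *m nab x = 0.

Let PA : P *m A = 1%:M. Proof. exact: mulmx1C. Qed.
Let PS : P^T = P.
Proof.
have : P^T *m A = 1%:M by rewrite -[A]AS -trmx_mul AP trmx1.
by move/(congr1 (mulmx^~ P)); rewrite mul1mx -mulmxA AP mulmx1.
Qed.
Let a_sk x i j : a x i j = - a x j i.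
Proof. by have /matrixP/(_ j i) := a_skew x; rewrite !mxE => ->. Qed.

Definition contr x : 'M[R]_N := \sum_k A k x *: a k.

(** The matrices A *m nab x are skew by compatibility with the metric, and the usual alternating sum
    of three torsion equations isolates one of them. *)
Lemma koszul x : 2%:R *: nab x = a x + P *m a x *m A - P *m contr x.
Proof.
have key : 2%:R *: (A *m nab x) = A *m a x + a x *m A - contr x.
  pose M y := A *m nab y.
  have Msk y i j : M y i j = - M y j i.
    have /matrixP/(_ i j) := metric_compat y; rewrite addmxE [RHS]mxE.
    have -> : ((nab y)^T *m A) i j = M y j i by rewrite -AS -trmx_mul mxE.
    by move/eqP; rewrite addr_eq0 => /eqP ->; rewrite opprK.
  have tor y z i : M y i z - M z i y = (A *m a y) i z.
    rewrite !mxE -sumrB; apply: eq_bigr => k _; by rewrite -mulrBr torsion_free.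
  have AE i j : A i j = A j i by rewrite -{1}AS mxE.
  apply/matrixP => z y; rewrite !(addmxE, oppmxE, scalemxE) -/(M x).
  have T1 : (a x *m A) z y = (A *m a z) y x.
    rewrite !mxE; apply: eq_bigr => k _.
    by rewrite mulrC AE a_anti a_sk opprK.
  have T2 : contr x z y = (A *m a y) x z.
    rewrite summxE mxE; apply: eq_bigr => k _.
    by rewrite scalemxE AE a_sk a_anti opprK.
  rewrite T1 T2 -!tor [M y z x]Msk [M z x y]Msk [M x y z]Msk; ring.
have := congr1 (mulmx P) key.
by rewrite mulmxBr mulmxDr !mulmxA -scalemxAr !mulmxA PA !mul1mx.
Qed.

Let Nab x := nab x - a x.

Lemma tr_mul_skew (X Y : 'M[R]_N) : X^T = X -> Y^T = - Y -> \tr (X *m Y) = 0.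
Proof.
move=> XS YS; have : \tr (X *m Y) = - \tr (X *m Y).
  by rewrite -{1}mxtrace_tr trmx_mul XS YS mulNmx raddfN /= mxtrace_mulC.
by move=> h; lra.
Qed.

Lemma tr_nab x : \tr (nab x) = 0.
Proof.
have -> : \tr (nab x) = \tr (P *m (A *m nab x)) by rewrite mulmxA PA mul1mx.
apply: tr_mul_skew => //; apply/eqP; rewrite -addr_eq0 trmx_mul AS.
by rewrite metric_compat.
Qed.

Lemma contr_skew x : (contr x)^T = - contr x.
Proof.
rewrite /contr [LHS]raddf_sum -sumrN; apply: eq_bigr => k _.
by rewrite [LHS]linearZ /= a_skew scalerN.
Qed.

(** Nab w is the matrix of X |-> nabla_X e_w. Since ad and nabla are trace-free, only the trace of a
    product of two such maps survives in the Ricci tensor. *)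
Lemma ricci_trace y z :
  \sum_x ((nab x *m nab y) x z - (nab y *m nab x) x z - \sum_k a x k y * nab k x z)
  = - \tr (Nab y *m Nab z).
Proof.
have NE x k w : nab x k w = Nab w k x.
  rewrite /Nab !(addmxE, oppmxE); have := torsion_free x k w.
  have -> : a x k w = - a w k x by rewrite a_sk a_anti opprK a_sk.
  by move/eqP; rewrite subr_eq addrC => /eqP.
rewrite !sumrB.
have -> : \sum_x (nab x *m nab y) x z = 0.
  under eq_bigr => x _ do rewrite mxE.
  rewrite exchange_big big1 //= => k _; rewrite -mulr_suml.
  have -> : \sum_i nab i i k = \tr (Nab k) by apply: eq_bigr => i _; exact: NE.
  rewrite /Nab raddfB /= tr_nab.
  have -> : \tr (a k) = 0.
    by rewrite -[a k]mul1mx; apply: tr_mul_skew; rewrite ?trmx1.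
  by rewrite subrr mul0r.
have -> : \sum_x (nab y *m nab x) x z = \tr (nab y *m Nab z).
  apply: eq_bigr => x _; rewrite [LHS]mxE [RHS]mxE.
  by apply: eq_bigr => k _; rewrite (NE x).
have -> : \sum_x \sum_k a x k y * nab k x z = - \tr (a y *m Nab z).
  rewrite exchange_big /= -sumrN; apply: eq_bigr => k _; rewrite mxE -sumrN.
  by apply: eq_bigr => x _; rewrite NE [a x k y]a_sk a_anti opprK a_sk mulNr.
by rewrite {3}/Nab mulmxBl raddfB /=; ring.
Qed.

(** After substitution of the Koszul formula the terms linear in contr cancel, and those
    quadratic in it make up A (Lam P P) A. *)
Lemma ricci_formula y z :
  4%:R * \sum_x ((nab x *m nab y) x z - (nab y *m nab x) x z - \sum_k a x k y * nab k x z)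
  = (2%:R *: Lam a 1%:M 1%:M - 2%:R *: Lam a P A + A *m Lam a P P *m A) y z.
Proof.
rewrite ricci_trace.
have N2 x : 2%:R *: Nab x = - a x + P *m a x *m A - P *m contr x.
  rewrite /Nab scalerBr koszul; move: (P *m a x *m A) (P *m contr x) => X Y.
  apply/matrixP => i j; rewrite !(addmxE, oppmxE, scalemxE); ring.
have -> : 4%:R * - \tr (Nab y *m Nab z) = - \tr ((2%:R *: Nab y) *m (2%:R *: Nab z)).
  by rewrite -scalemxAl -scalemxAr scalerA mxtraceZ; ring.
rewrite !N2.
have LE U V : Lam a U V y z = - \tr (a y *m U *m a z *m V).
  by rewrite LamE a_skew mulmxN mulNmx raddfN.
have ALA : (A *m Lam a P P *m A) y z = - \tr (P *m contr y *m (P *m contr z)).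
  have Pc w : P *m contr w = \sum_j A j w *: (P *m a j).
    by rewrite mulmx_sumr; apply: eq_bigr => j _; rewrite -scalemxAr.
  rewrite [LHS]mxE !Pc mulmx_sumr mxtrace_sum -sumrN; apply: eq_bigr => j _.
  rewrite -scalemxAr mxtraceZ mulmx_suml mxtrace_sum [_ y j]mxE mulrC -mulrN -sumrN.
  congr (_ * _); apply: eq_bigr => i _.
  rewrite -scalemxAl mxtraceZ -mulrN -{1}AS mxE LamE a_skew mulmxN mulNmx raddfN /=.
  congr (_ * - _); trace_rot.
rewrite !(addmxE, oppmxE, scalemxE) ALA !LE.
rewrite !(mulmxDl, mulmxBl, mulmxDr, mulmxBr, mulNmx, mulmxN, mulmx1).
move: (contr_skew y) (contr_skew z); move: (contr y) (contr z) => b b' bs bs'.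
have trP (X Y Z W : 'M[R]_N) : X^T = X -> Z^T = Z -> Y^T = - Y -> W^T = - W ->
    \tr (Y *m X *m W *m Z) = \tr (X *m Y *m Z *m W).
  move=> XS ZS YS WS; rewrite -mxtrace_tr !trmx_mul XS ZS YS WS.
  rewrite !(mulmxN, mulNmx) opprK; trace_rot.
have t1 : \tr (P *m a y *m A *m a z) = \tr (a y *m P *m a z *m A) by rewrite (trP P _ A).
have t2 : P *m a y *m A *m (P *m a z *m A) = P *m (a y *m a z) *m A.
  by rewrite !mulmxA -(mulmxA (P *m a y) A) AP mulmx1.
have t2' : \tr (P *m (a y *m a z) *m A) = \tr (a y *m a z).
  by rewrite mxtrace_mulC (mulmxA A P) AP mul1mx.
have t3 : P *m a y *m A *m (P *m b') = P *m a y *m b'.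
  by rewrite !mulmxA -(mulmxA (P *m a y) A) AP mulmx1.
have t3' : \tr (P *m a y *m b') = \tr (a y *m (P *m b')).
  have := trP P (a y) 1%:M b' PS (trmx1 _ _) (a_skew y) bs'.
  by rewrite !mulmx1 mulmxA.
have t4 : \tr (P *m b *m (P *m a z *m A)) = \tr (P *m b *m a z).
  have := trP P b 1%:M (a z) PS (trmx1 _ _) bs (a_skew z).
  rewrite !mulmx1 => <-; rewrite mxtrace_mulC.
  have -> : P *m a z *m A *m (P *m b) = P *m a z *m b.
    by rewrite !mulmxA -(mulmxA (P *m a z) A) AP mulmx1.
  trace_rot.
rewrite t2 t3 !opprK !(mxtraceD, raddfB, raddfN) /=.
rewrite t1 t2' t3' t4 !mulmxA.
ring.
Qed.

End KoszulRicci.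

Section MetricForm.
Variables (R : realType) (V : vectType R) (g : metric V).

Lemma metricC X Y : g X Y = g Y X.
Proof. by rewrite hermC expr0 mul1r. Qed.

Lemma metricZl k X Y : g (k *: X) Y = k * g X Y.
Proof. by rewrite linearZl_LR. Qed.

Lemma metric_suml (I : finType) (f : I -> V) Z : g (\sum_i f i) Z = \sum_i g (f i) Z.
Proof. by rewrite linear_sumlz. Qed.

Lemma metric_sumr (I : finType) (f : I -> V) Z : g Z (\sum_i f i) = \sum_i g Z (f i).
Proof. by rewrite metricC metric_suml; apply: eq_bigr => i _; rewrite metricC. Qed.

Lemma metricZr k X Y : g X (k *: Y) = k * g X Y.
Proof. by rewrite metricC metricZl metricC. Qed.

Lemma metric_gt0 X : X != 0 -> 0 < g X X.
Proof. exact: neq0_dnorm_gt0. Qed.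
End MetricForm.

(** ricci applies linfun to a bare function; the linear structure declared here lets it be
    evaluated. *)
Section CurvatureMap.
Variables (R : realType) (V : vectType R) (br : {bilinear V -> V -> V}).
Variables (nabla : 'Hom(V, 'End(V))) (Y Z : V).

Definition curvature_map X := curvature br nabla X Y Z.
HB.instance Definition _ := GRing.isLinear.Build R V V *:%R curvature_map
  (curvature_is_linear br nabla Y Z).

Lemma curvature_linfunE X :
  linfun (fun X => curvature br nabla X Y Z) X = curvature br nabla X Y Z.
Proof. exact: (lfunE curvature_map). Qed.
End CurvatureMap.

Section OrthonormalFrame.
Variables (R : realType) (V : vectType R) (q : V -> V -> R) (N : nat) (e : 'I_N -> V).
Hypothesis qD : forall X Y Z, q (X + Y) Z = q X Z + q Y Z.
Hypothesis qZ : forall k X Y, q (k *: X) Y = k * q X Y.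
Hypothesis on : orthonormal_family q e.
Hypothesis ex : forall X, X = \sum_x q X (e x) *: e x.

Let q0l Z : q 0 Z = 0. Proof. by rewrite -(scale0r (0 : V)) qZ mul0r. Qed.
Lemma form_suml I (r : seq I) (f : I -> V) Z :
  q (\sum_(i <- r) f i) Z = \sum_(i <- r) q (f i) Z.
Proof.
elim: r => [|i r IH]; first by rewrite !big_nil q0l.
by rewrite !big_cons qD IH.
Qed.

(** lftrace is computed in the fixed basis of V; each element of that basis is expanded in the
    frame, and the images of the frame are expanded in that basis. *)
Lemma lftrace_frame (f : 'End(V)) : lftrace f = \sum_x q (f (e x)) (e x).
Proof.
have vb := vbasisP {:V}.
rewrite /lftrace /mxtrace.
have E i : passmx.mxof (vbasis {:V}) (vbasis {:V}) f i i
    = \sum_x q (vbasis {:V})`_i (e x) * coord (vbasis {:V}) i (f (e x)).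
  rewrite !mxE /= -(passmx.rVofE vb) passmx.rVofK // {1}(ex (vbasis {:V})`_i).
  rewrite !linear_sum; apply: eq_bigr => x _.
  by rewrite !linearZ.
under eq_bigr => i _ do rewrite E.
rewrite exchange_big; apply: eq_bigr => x _ /=.
rewrite {2}(coord_vbasis (memvf (f (e x)))) form_suml; apply: eq_bigr => i _.
by rewrite qZ mulrC.
Qed.

Variable br : {bilinear V -> V -> V}.
Definition structure_mx x : 'M[R]_N := \matrix_(k, l) q (br (e x) (e l)) (e k).
Local Notation a := structure_mx.
Hypothesis a_anti : forall x i j, a x i j = - a i x j.
Hypothesis a_skew : forall x, (a x)^T = - a x.

Definition frame_gram (g : metric V) : 'M[R]_N := \matrix_(k, l) g (e k) (e l).

Lemma frame_gramT g : (frame_gram g)^T = frame_gram g.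
Proof. by apply/matrixP => k l; rewrite !mxE metricC. Qed.

Lemma frame_gram_unit g : frame_gram g \in unitmx.
Proof.
rewrite -row_free_unit -kermx_eq0; apply/rowV0P => v /sub_kermxP vA.
pose X := \sum_x v 0 x *: e x.
have gX y : g X (e y) = 0.
  rewrite metric_suml; transitivity ((v *m frame_gram g) 0 y); last by rewrite vA mxE.
  by rewrite mxE; apply: eq_bigr => x _; rewrite metricZl mxE.
have X0 : X = 0.
  apply/eqP/negPn/negP => /(metric_gt0 g).
  rewrite {2}/X metric_sumr big1 ?ltxx // => y _.
  by rewrite metricZr gX mulr0.
apply/rowP => y; rewrite mxE.
have : q X (e y) = 0 by rewrite X0 q0l.
rewrite /X form_suml (bigD1 y) //= big1 ?addr0 => [|x xy].
  by rewrite qZ on eqxx mulr1.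
by rewrite qZ on (negPf xy) mulr0.
Qed.

(** The two Levi-Civita equations determine the Ricci tensor, through ricci_formula. *)
Lemma einstein_frame g kappa : is_einstein br g kappa ->
  let A := frame_gram g in let P := invmx A in
  2%:R *: Lam a 1%:M 1%:M - 2%:R *: Lam a P A + A *m Lam a P P *m A
    = (4%:R * kappa) *: A.
Proof.
move=> [nabla [tors compat] ric] A P.
pose nab x : 'M[R]_N := \matrix_(k, l) q (nabla (e x) (e l)) (e k).
have nabE x l : nabla (e x) (e l) = \sum_k nab x k l *: e k.
  by rewrite {1}(ex (nabla _ _)); apply: eq_bigr => k _; rewrite mxE.
have AP : A *m P = 1%:M by rewrite mulmxV // frame_gram_unit.
have t1 x k y : nab x k y - nab y k x = a x k y.
  rewrite !mxE -tors -(scaleN1r (nabla (e y) _)) qD qZ mulN1r //.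
have t2 x : (nab x)^T *m A + A *m nab x = 0.
  apply/matrixP => y z; rewrite addmxE [RHS]mxE.
  transitivity (g (nabla (e x) (e y)) (e z) + g (e y) (nabla (e x) (e z))); last exact: compat.
  rewrite !nabE metric_suml metric_sumr; congr (_ + _); rewrite mxE; apply: eq_bigr => k _.
    by rewrite metricZl [(nab x)^T _ _]mxE [A _ _]mxE.
  by rewrite metricZr mulrC [A _ _]mxE.
apply/matrixP => y z.
rewrite -(ricci_formula a_anti a_skew (frame_gramT g) AP t1 t2) scalemxE -mulrA.
congr (_ * _); rewrite mxE -ric /ricci lftrace_frame; apply: eq_bigr => x _.
rewrite curvature_linfunE /curvature !(add_lfunE, opp_lfunE, comp_lfunE).
have brE : br (e x) (e y) = \sum_k a x k y *: e k.
  by rewrite {1}(ex (br _ _)); apply: eq_bigr => k _; rewrite mxE.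
have qq u v w t : q (nabla (e u) (nabla (e v) (e w))) (e t) = (nab u *m nab v) t w.
  rewrite (nabE v w) linear_sum form_suml mxE; apply: eq_bigr => k _.
  by rewrite linearZ qZ [nab u t k]mxE mulrC.
have qn : q (nabla (br (e x) (e y)) (e z)) (e x) = \sum_k a x k y * nab k x z.
  rewrite brE linear_sum sum_lfunE form_suml; apply: eq_bigr => k _.
  by rewrite linearZ scale_lfunE qZ [nab k x z]mxE.
rewrite -(scaleN1r (nabla (br _ _) _)) -(scaleN1r (nabla (e y) _)).
by rewrite !qD !qZ !qq qn !mulN1r.
Qed.

End OrthonormalFrame.

(** * The Lie algebra su(n) *)

Section SpecialUnitaryForm.
Variables (R : realType) (n : nat).
Hypothesis n_gt0 : (0 < n)%N.
Local Notation V := (su R n).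
Local Notation m := (n%:R : R).
Implicit Types X Y Z : V.

(** The trace of a product of two elements of su(n) is real (trformE), so taking the real part only
    changes the type. *)
Definition trform X Y : R := - complex.Re (\tr (su_val X *m su_val Y)).

Lemma su_adj X : (su_val X)^t* = - su_val X.
Proof. by have /andP[/eqP] := su_valP X. Qed.

Lemma su_tr X : \tr (su_val X) = 0.
Proof. by have /andP[_ /eqP] := su_valP X. Qed.

Lemma trformE X Y : \tr (su_val X *m su_val Y) = - (trform X Y)%:C.
Proof.
rewrite /trform rmorphN /= opprK; apply/esym/RRe_real/CrealP.
rewrite [LHS]tr_conj adjM !su_adj mulmxN mulNmx opprK; exact: mxtrace_mulC.
Qed.

Lemma trformC X Y : trform X Y = trform Y X.
Proof. by rewrite /trform mxtrace_mulC. Qed.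

Lemma trformD X Y Z : trform (X + Y) Z = trform X Z + trform Y Z.
Proof. by rewrite /trform mulmxDl !raddfD. Qed.

Lemma trformZ k X Y : trform (k *: X) Y = k * trform X Y.
Proof.
apply: (@complexI R); rewrite rmorphM /= -[LHS]opprK -trformE -[RHS]opprK -mulrN -trformE.
by rewrite -scalemxAl mxtraceZ.
Qed.

Lemma trform_gt0 X : X != 0 -> 0 < trform X X.
Proof.
move=> X0; have qE : (trform X X)%:C = \sum_i \sum_j `|su_val X i j| ^+ 2.
  rewrite -[LHS]opprK -trformE -[LHS]raddfN -mulmxN -su_adj /=.
  by apply: eq_bigr => i _; rewrite mxE; apply: eq_bigr => j _; rewrite !mxE normCK.
have ge0 i : 0 <= \sum_j `|su_val X i j| ^+ 2 by apply: sumr_ge0 => j _; rewrite exprn_ge0.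
rewrite lt_neqAle -lecR -(inj_eq (@complexI R)) qE sumr_ge0 // andbT eq_sym.
apply: contraNneq X0 => S0; apply/eqP/val_inj/matrixP => i j; rewrite mxE.
have /psumr_eq0P/(_ i isT) Si := S0.
have /psumr_eq0P/(_ j isT) := Si (fun k _ => ge0 k).
by move/(_ (fun k _ => exprn_ge0 2 (normr_ge0 _)))/eqP; rewrite sqrf_eq0 normr_eq0 => /eqP.
Qed.

Lemma su_bracket_anti X Y : su_bracket Y X = - su_bracket X Y.
Proof. by apply: val_inj; rewrite /= opprB. Qed.

Lemma trform_invariant X Y Z :
  trform (su_bracket X Y) Z + trform Y (su_bracket X Z) = 0.
Proof.
apply: (@complexI R); rewrite rmorphD /= -[X in X + _]opprK -trformE -[X in _ + X]opprK -trformE.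
rewrite -opprD /= mulmxBl mulmxBr !raddfB /= !mulmxA.
have -> : \tr (su_val X *m su_val Y *m su_val Z) = \tr (su_val Y *m su_val Z *m su_val X).
  trace_rot.
by rewrite addrC subrKA subrr oppr0.
Qed.

Lemma su_jacobi X Y Z : su_bracket (su_bracket X Y) Z =
  su_bracket X (su_bracket Y Z) - su_bracket Y (su_bracket X Z).
Proof.
apply: val_inj => /=; move: (su_val X) (su_val Y) (su_val Z) => A B C.
rewrite !(mulmxBl, mulmxBr) !mulmxA.
apply/matrixP => u v; rewrite !(addmxE, oppmxE); ring.
Qed.

Section Basis.
Variables (N : nat) (e : 'I_N -> V).
Hypothesis on : orthonormal_family trform e.
Hypothesis ex : forall X, X = \sum_x trform X (e x) *: e x.
Local Notation E x := (su_val (e x)).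

Lemma su_val_sum (I : finType) (f : I -> V) : su_val (\sum_i f i) = \sum_i su_val (f i).
Proof. by elim/big_ind2: _ => // X x Y y <- <-. Qed.

Lemma su_fierz_su X : \sum_x \tr (E x *m su_val X) *: E x = - su_val X.
Proof.
rewrite {2}(ex X) su_val_sum -sumrN; apply: eq_bigr => x _.
by rewrite trformE trformC scaleNr.
Qed.

(** On su(n) this is the expansion in the orthonormal basis. Both sides are complex linear and
    vanish at scalar matrices, and every matrix is X + i Y plus a scalar with X, Y in su(n). *)
Lemma su_fierz M : \sum_x \tr (E x *m M) *: E x = (\tr M / n%:R)%:M - M.
Proof.
have nC : (n%:R : R[i]) != 0 by rewrite pnatr_eq0 -lt0n.
pose M0 := M - (\tr M / n%:R)%:M.
have trM0 : \tr M0 = 0 by rewrite raddfB /= mxtrace_scalar -(mulr_natr (_ / _)) divfK ?subrr.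
have trM0' : \tr (M0^t*) = 0 by rewrite -tr_conj trM0 conjc0.
have adjK (W : 'M[R[i]]_n) : (W^t*)^t* = W by apply/matrixP => i j; rewrite !mxE conjCK.
have XP : (2%:R^-1 *: (M0 - M0^t*)) \in @skew_hermitian_traceless R n.
  rewrite unfold_in; apply/andP; split; apply/eqP.
    rewrite adjZ adjD adjN adjK -scalerN [in RHS]opprB; congr (_ *: _).
    by rewrite fmorphV rmorph_nat.
  by rewrite mxtraceZ raddfB /= trM0 trM0' subrr mulr0.
have YP : (- 'i%C / 2%:R *: (M0 + M0^t*)) \in @skew_hermitian_traceless R n.
  rewrite unfold_in; apply/andP; split; apply/eqP.
    rewrite adjZ adjD adjK -scaleNr [_ + M0]addrC; congr (_ *: _).
    rewrite rmorphM rmorphN fmorphV rmorph_nat -mulNr complexiE; congr (_ * _).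
    by congr (- _); exact: conjCi.
  by rewrite mxtraceZ mxtraceD trM0 trM0' addr0 mulr0.
have [X [Y ME]] : exists X Y, M = su_val X + 'i%C *: su_val Y + (\tr M / n%:R) *: 1%:M.
  exists (Su XP), (Su YP); rewrite /= scalerA scalemx1.
  rewrite -[LHS](subrK (\tr M / n%:R)%:M) -/M0; congr (_ + _).
  have -> : 'i%C * (- 'i%C / 2%:R) = 2%:R^-1 :> R[i].
    by rewrite mulrA mulrN -expr2 sqr_i opprK mul1r.
  rewrite -scalerDr addrACA addNr addr0 -[M0 + M0]mulr2n -(scaler_nat 2 M0) scalerA.
  by rewrite mulVf ?scale1r ?pnatr_eq0.
pose S (W : 'M[R[i]]_n) := \sum_x \tr (E x *m W) *: E x.
have SD W W' : S (W + W') = S W + S W'.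
  by rewrite /S -big_split; apply: eq_bigr => x _; rewrite /= mulmxDr mxtraceD scalerDl.
have SZ k W : S (k *: W) = k *: S W.
  by rewrite /S scaler_sumr; apply: eq_bigr => x _; rewrite /= -scalemxAr mxtraceZ scalerA.
have S1 : S 1%:M = 0 by rewrite /S big1 // => x _; rewrite mulmx1 su_tr scale0r.
have SX W : S (su_val W) = - su_val W by exact: su_fierz_su.
rewrite -/(S M); transitivity (S (su_val X + 'i%C *: su_val Y + (\tr M / n%:R) *: 1%:M)).
  by rewrite -ME.
rewrite !SD !SZ S1 scaler0 addr0 !SX scalerN -opprD {2}ME scalemx1 [in RHS]opprD [in RHS]addrC.
by rewrite subrK.
Qed.

Local Notation Em := (fun x => E x).

Lemma su_orth x y : \tr (E x *m E y) = - (x == y)%:R.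
Proof. by rewrite trformE on rmorph_nat. Qed.

Local Notation br := (@su_bracket R n).
Local Notation a := (structure_mx trform e br).

Lemma su_structure x : map_mx (real_complex R) (a x) = adm Em x.
Proof.
apply/matrixP => k l; rewrite admE 2!mxE.
rewrite -[LHS]opprK -trformE; congr (- _); exact: mxtrace_mulC.
Qed.

Lemma su_killing X Y : killing br X Y = - (2%:R * m) * trform X Y.
Proof.
rewrite /killing (lftrace_frame trformD trformZ ex).
apply: (@complexI R); rewrite rmorph_sum rmorphM rmorphN rmorphM !rmorph_nat /=.
have := killing_trace n_gt0 su_fierz (su_tr X) (su_tr Y).
rewrite trformE mulrN => /eqP; rewrite -eqr_oppLR => /eqP <-.
rewrite -sumrN; apply: eq_bigr => x _.
rewrite comp_lfunE !lfunE /= -[LHS]opprK -trformE.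
by [].
Qed.

End Basis.
End SpecialUnitaryForm.

(** * The bi-invariant metric is Einstein *)

Lemma lftraceZ (R : realType) (V : vectType R) k (f : 'End(V)) :
  lftrace (k *: f) = k * lftrace f.
Proof.
have L := @passmx.mxof_linear R V V (vbasis {:V}) (vbasis {:V}).
have L0 : passmx.mxof (vbasis {:V}) (vbasis {:V}) 0 = 0.
  by have := L (-1) 0 0; rewrite scaler0 addr0 scaleN1r addNr.
by rewrite /lftrace -[k *: f]addr0 L L0 addr0 mxtraceZ.
Qed.

Section HalfConnection.
Variables (R : realType) (V : vectType R) (br : {bilinear V -> V -> V}).

(** The Levi-Civita connection of a bi-invariant metric is half of the bracket. *)
Definition half_ad X : 'End(V) := 2%:R^-1 *: ad br X.

Fact half_ad_linear : linear half_ad.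
Proof.
move=> k X Y; apply/lfunP => Z.
by rewrite /half_ad !(add_lfunE, scale_lfunE) /ad !lfunE /= linearPl scalerDr !scalerA mulrC.
Qed.
HB.instance Definition _ := GRing.isLinear.Build R V 'End(V) *:%R half_ad half_ad_linear.

Lemma half_connectionE X Y : linfun half_ad X Y = 2%:R^-1 *: br X Y.
Proof. by rewrite lfunE /= scale_lfunE /ad lfunE. Qed.

Hypothesis br_anti : forall X Y, br Y X = - br X Y.
Hypothesis jacobi : forall X Y Z, br (br X Y) Z = br X (br Y Z) - br Y (br X Z).

Lemma half_levi_civita (g : metric V) :
  (forall X Y Z, g (br X Y) Z + g Y (br X Z) = 0) -> levi_civita br g (linfun half_ad).
Proof.
move=> inv; split=> [X Y|X Y Z].
  rewrite !half_connectionE (br_anti X Y) scalerN opprK -scalerDr -[br X Y + _]mulr2n.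
  by rewrite -(scaler_nat 2 (br X Y)) scalerA mulVf ?scale1r // pnatr_eq0.
by rewrite !half_connectionE metricZl metricZr -mulrDr inv mulr0.
Qed.

Lemma half_ricci Y Z : ricci br (linfun half_ad) Y Z = - (4%:R^-1) * killing br Z Y.
Proof.
rewrite /ricci /killing.
have -> : linfun (fun X => curvature br (linfun half_ad) X Y Z)
    = - (4%:R^-1) *: (ad br Z \o ad br Y)%VF.
  apply/lfunP => X; rewrite curvature_linfunE /curvature.
  rewrite !(add_lfunE, opp_lfunE, comp_lfunE, scale_lfunE) !half_connectionE /ad !lfunE /=.
  have Z2 U W : br U (2%:R^-1 *: W) = 2%:R^-1 *: br U W by rewrite linearZr_LR.
  rewrite !Z2 !scalerA -scalerBr -jacobi -scalerBl.
  by rewrite (br_anti (br Y X)) (br_anti X Y) linearNl opprK; congr (_ *: _); field.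
exact: lftraceZ.
Qed.
End HalfConnection.

(** * Isolation of the bi-invariant metric *)

Import numFieldNormedType.Exports.
Local Open Scope classical_set_scope.

Theorem theorem22p3 (R : realType) (n : nat) (hn : (3 <= n)%N)
    (g0 : metric (su R n)) (c : R)
    (hg0 : forall X Y : su R n, g0 X Y = c * killing (@su_bracket R n) X Y) :
  isolated [set g : metric (su R n) |
    exists2 kappa : R, is_einstein (@su_bracket R n) g0 kappa
                     & is_einstein (@su_bracket R n) g kappa] g0.
Proof.
have n_gt0 : (0 < n)%N by exact: leq_trans hn.
have [N [e [on ex]]] :=
  orthonormal_basis (@trformC R n) (@trformD R n) (@trformZ R n) (@trform_gt0 R n).
pose E x := su_val (e x).
have tr_e x : \tr (E x) = 0 by exact: su_tr.
have fierz := su_fierz n_gt0 ex.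
have orth := su_orth on.
have skew x : (E x)^t* = - E x by exact: su_adj.
pose br := @su_bracket R n.
pose a := structure_mx (@trform R n) e br.
have aE := su_structure e.
pose m : R := n%:R.
have aA := a_anti aE.
have aS := a_skew aE.
have L11 := Lam11 hn tr_e fierz orth aE.
(* g0 is al times the trace form, since the Killing form is - 2 m times the trace form. *)
pose al := - (2%:R * m) * c.
have g0E X Y : g0 X Y = al * trform X Y.
  by rewrite hg0 (su_killing n_gt0 ex) mulrCA mulrA.
have N0 : (0 < N)%N.
  rewrite lt0n; apply/eqP => N0; have := frame_card n_gt0 fierz orth.
  move/eqP; rewrite N0 eq_sym subr_eq0 -natrX -[1]/(1%:R) eqr_nat.
  by move: hn; case: (n) => [|[|k]] //; rewrite expnS expn1 mulSn.
pose i0 := Ordinal N0.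
have al0 : 0 < al.
  have e0 : e i0 != 0.
    apply/eqP => e0; have := on i0 i0; rewrite e0 eqxx => /eqP.
    by rewrite /trform mul0mx mxtrace0 oppr0 eq_sym oner_eq0.
  by have := metric_gt0 g0 e0; rewrite g0E on eqxx mulr1.
have fg0 : frame_gram e g0 = al *: 1%:M.
  by apply/matrixP => k l; rewrite scalemxE !mxE g0E on.
have [de de0 iso] := isolated_identity hn tr_e fierz orth skew aE.
have frame_eq g kappa :=
  @einstein_frame R _ _ N e (@trformD R n) (@trformZ R n) on ex br aA aS g kappa.
have al_neq0 : al != 0 by rewrite gt_eqF.
(* The Ricci tensor does not change when the metric is rescaled; this moves g0 to the identity. *)
have scaled (A P : 'M[R]_N) : Lam a (al *: P) (al^-1 *: A) = Lam a P A /\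
    (al^-1 *: A) *m Lam a (al *: P) (al *: P) *m (al^-1 *: A) = A *m Lam a P P *m A.
  split; first by rewrite LamZl LamZr scalerA mulfV // scale1r.
  rewrite LamZl LamZr -!(scalemxAl, scalemxAr) !scalerA.
  by rewrite -[RHS]scale1r; congr (_ *: _); field.
have kappaE kappa : is_einstein br g0 kappa -> 4%:R * kappa * al = 2%:R * m.
  have inv : invmx (al *: 1%:M) = al^-1 *: 1%:M :> 'M[R]_N.
    by rewrite !scalemx1 invmx_scalar.
  have [LPA ALA] := scaled (al *: 1%:M) (al^-1 *: 1%:M).
  rewrite !scalerA mulfV // mulVf // !scale1r mul1mx mulmx1 in LPA ALA.
  move=> /frame_eq /=; rewrite fg0 inv -LPA -ALA subrr add0r L11 scalerA.
  by move=> /matrixP/(_ i0 i0); rewrite !mxE eqxx !mulr1n !mulr1.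
have c0 : c != 0 by apply: contraNneq al_neq0 => c0; rewrite /al c0 mulr0.
have g0_einstein : is_einstein br g0 (- (4%:R^-1) / c).
  exists (linfun (half_ad br)).
    apply: half_levi_civita; first exact: su_bracket_anti.
    by move=> X Y Z; rewrite !g0E -mulrDr trform_invariant mulr0.
  move=> Y Z; rewrite half_ricci; last 2 first.
  - exact: su_bracket_anti.
  - exact: su_jacobi.
  by rewrite metricC hg0 mulrA divfK.
split; first by apply/mem_set; exists (- (4%:R^-1) / c).
pose vb := vbasis {:su R n}.
pose T k i := coord vb i (e k).
have fgE g k l : frame_gram e g k l = \sum_i \sum_j T k i * (T l j * gram g i j).
  rewrite mxE {1}(coord_vbasis (memvf (e k))) metric_suml; apply: eq_bigr => i _.
  rewrite metricZl {1}(coord_vbasis (memvf (e l))) metric_sumr mulr_sumr.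
  by apply: eq_bigr => j _; rewrite metricZr mxE.
(* Kt bounds the passage from the Gram matrix in the fixed basis, which defines the topology, to
   the one in the frame e. *)
pose Kt := \sum_(k < N) \sum_(l < N) \sum_i \sum_j `|T k i| * `|T l j|.
have Kt0 : 0 <= Kt by do 4 (apply: sumr_ge0 => ? _); rewrite mulr_ge0.
have Kt1 : 0 < Kt + 1 by rewrite ltr_wpDl.
pose eps := al * de / (Kt + 1).
have eps0 : 0 < eps by apply: divr_gt0 => //; exact: mulr_gt0.
have close g : ball (gram g0) eps (gram g) -> nrm (al^-1 *: frame_gram e g - 1%:M) < de.
  move=> gb.
  have -> : al^-1 *: frame_gram e g - 1%:M = al^-1 *: (frame_gram e g - frame_gram e g0).
    by rewrite scalerBr fg0 scalerA mulVf // scale1r.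
  rewrite nrmZ gtr0_norm ?invr_gt0 // mulrC ltr_pdivrMr // [de * al]mulrC.
  apply: le_lt_trans (_ : Kt * eps < _); last first.
    rewrite /eps mulrCA -[ltRHS]mulr1 ltr_pM2l; last exact: mulr_gt0.
    rewrite ltr_pdivrMr // mul1r.
    by rewrite ltrDl.
  rewrite mulr_suml; apply: ler_sum => k _; rewrite mulr_suml; apply: ler_sum => l _.
  rewrite addmxE oppmxE !fgE -sumrB; apply: le_trans (ler_norm_sum _ _ _) _.
  rewrite mulr_suml; apply: ler_sum => i _; rewrite -sumrB.
  apply: le_trans (ler_norm_sum _ _ _) _.
  rewrite mulr_suml; apply: ler_sum => j _; rewrite -!mulrBr !normrM mulrA.
  rewrite ler_wpM2l ?mulr_ge0 // distrC ltW //.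
  by have := gb.2 i j; rewrite !mxE.
exists (@gram R _ @^-1` ball (gram g0) eps)%classic.
  by apply: (@initial_continuous _ _ (@gram R (su R n)) g0); exact: nbhsx_ballx.
apply/seteqP; split=> [g [/close gde [kappa k0 kg]]|g ->]; last first.
  split; first exact: ballxx.
  by exists (- (4%:R^-1) / c).
apply: metric_eq => X Y.
have AP : frame_gram e g *m invmx (frame_gram e g) = 1%:M.
  by apply: mulmxV; apply: (frame_gram_unit (@trformD R n) (@trformZ R n) on).
have [LPA ALA] := scaled (frame_gram e g) (invmx (frame_gram e g)).
have A1 : al^-1 *: frame_gram e g = 1%:M.
  apply: (iso _ (al *: invmx (frame_gram e g))) => //.
  - by rewrite linearZ /= frame_gramT.
  - by rewrite -scalemxAl -scalemxAr AP scalerA mulVf // scale1r.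
  rewrite /einstein_op LPA ALA.
  have := frame_eq _ _ kg; rewrite /= L11 scalerA.
  have -> : 2%:R * (2%:R * m) = 4%:R * m by ring.
  move=> ->; rewrite -(kappaE _ k0) scalerA mulfK //.
  by rewrite subrr.
have fgg : frame_gram e g = frame_gram e g0.
  by rewrite fg0 -A1 scalerA mulfV // scale1r.
have gE (h : metric (su R n)) :
    h X Y = \sum_x \sum_y trform X (e x) * (trform Y (e y) * frame_gram e h x y).
  rewrite {1}(ex X) metric_suml; apply: eq_bigr => x _.
  rewrite metricZl {1}(ex Y) metric_sumr mulr_sumr.
  by apply: eq_bigr => y _; rewrite metricZr mxE.
by rewrite !gE fgg.
Qed.
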